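(* Consider pairs $(F,G)$ of one-dimensional one-sided cellular automata $F,G:A^{\mathbb{N}}\to A^{\mathbb{N}}$ on the same full shift over a finite alphabet $A$, each given by a local rule. The following two sets of such pairs are recursively inseparable: (i) the pairs with $h(F)>h(G)$; (ii) the pairs such that $F$ and $G$ are strongly conjugate and $h(F)=h(G)=0$. That is, there is no recursive set of pairs that contains every pair of (i) and no pair of (ii).
   Context: For a finite alphabet $A$, $A^{\mathbb{N}}$ carries the product of the discrete topologies (a compact metric space); the shift is $\sigma(c)_i=c_{i+1}$. A cellular automaton (CA) on $A^{\mathbb{N}}$ is a continuous map $F:A^{\mathbb{N}}\to A^{\mathbb{N}}$ with $F\sigma=\sigma F$; equivalently it is given by a local rule $f:A^{[0,r]}\to A$ via $F(c)_i=f(c_{i},\dots,c_{i+r})$. For a dynamical system $(X,f)$ (compact metric $X$, continuous $f$), $h(X,f)$ denotes topological entropy (with $\log_2$), and we write $h(F)=h(A^{\mathbb{N}},F)$. Two CA $(A^{\mathbb{N}},F)$, $(B^{\mathbb{N}},G)$ are strongly conjugate if there is a homeomorphism $\phi:A^{\mathbb{N}}\to B^{\mathbb{N}}$ with $\phi F=G\phi$ and $\phi\sigma=\sigma\phi$. *)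

(* Defs.v *)
From Stdlib Require Import Reals List Arith.
Open Scope R_scope.

Inductive rf : Type :=
| RZero : rf
| RSucc : rf
| RProj : nat -> rf
| RComp : rf -> list rf -> rf
| RPrec : rf -> rf -> rf
| RMu : rf -> rf.

Inductive eval : rf -> list nat -> nat -> Prop :=
| ev_zero : forall v, eval RZero v 0
| ev_succ : forall x v, eval RSucc (x :: v) (S x)
| ev_proj : forall i v, (i < length v)%nat -> eval (RProj i) v (nth i v 0%nat)
| ev_comp : forall f gs v ws y, evals gs v ws -> eval f ws y -> eval (RComp f gs) v y
| ev_prec0 : forall f g v y, eval f v y -> eval (RPrec f g) (0%nat :: v) y
| ev_precS : forall f g n v y z,
    eval (RPrec f g) (n :: v) y -> eval g (n :: y :: v) z ->
    eval (RPrec f g) (S n :: v) z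
| ev_mu : forall f v n,
    eval f (n :: v) 0%nat ->
    (forall m, (m < n)%nat -> exists y, y <> 0%nat /\ eval f (m :: v) y) ->
    eval (RMu f) v n
with evals : list rf -> list nat -> list nat -> Prop :=
| evs_nil : forall v, evals nil v nil
| evs_cons : forall g gs v w ws, eval g v w -> evals gs v ws -> evals (g :: gs) v (w :: ws).

Definition recursive_set (S : nat -> Prop) : Prop :=
  exists c : rf, forall n,
    (S n /\ eval c (n :: nil) 1%nat) \/ (~ S n /\ eval c (n :: nil) 0%nat).

Definition rec_inseparable (P Q : nat -> Prop) : Prop :=
  ~ exists S, recursive_set S /\ (forall n, P n -> S n) /\ (forall n, Q n -> ~ S n).

Definition cantor_pair (x y : nat) : nat := ((x + y) * S (x + y) / 2 + y)%nat.

Fixpoint code_list (l : list nat) : nat :=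
  match l with
  | nil => 0%nat
  | x :: l' => S (cantor_pair x (code_list l'))
  end.

Definition config := nat -> nat.

Definition in_space (k : nat) (c : config) : Prop := forall i, (c i < k)%nat.

(* index of the word [a_0; ...; a_r] in lexicographic order (base k, a_0 most significant) *)
Definition word_index (k : nat) (w : list nat) : nat :=
  fold_left (fun acc a => acc * k + a)%nat w 0%nat.

(* local rule f : A^[0,r] -> A given by its table (length k^(r+1)) *)
Definition wf_rule (k r : nat) (tab : list nat) : Prop :=
  length tab = (k ^ S r)%nat /\ forall a, In a tab -> (a < k)%nat.

Definition ca (k r : nat) (tab : list nat) (c : config) : config :=
  fun i => nth (word_index k (map c (seq i (S r)))) tab 0%nat.

Definition shift (c : config) : config := fun i => c (S i).

Definition is_dist (x y : config) (d : R) : Prop :=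
  ((forall i, x i = y i) /\ d = 0) \/
  (exists i, x i <> y i /\ (forall j, (j < i)%nat -> x j = y j) /\ d = / 2 ^ i).

Definition log2 (x : R) : R := ln x / ln 2.

Definition nsep (F : config -> config) (n : nat) (eps : R) (x y : config) : Prop :=
  exists t, (t < n)%nat /\ exists d, is_dist (Nat.iter t F x) (Nat.iter t F y) d /\ d > eps.

Definition separated_set (k : nat) (F : config -> config) (n : nat) (eps : R)
    (L : list config) : Prop :=
  (forall x, In x L -> in_space k x) /\
  forall i j, (i < j)%nat -> (j < length L)%nat ->
    nsep F n eps (nth i L (fun _ => 0%nat)) (nth j L (fun _ => 0%nat)).

Definition max_sep (k : nat) (F : config -> config) (n : nat) (eps : R) (N : nat) : Prop :=
  (exists L, separated_set k F n eps L /\ length L = N) /\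
  (forall L, separated_set k F n eps L -> (length L <= N)%nat).

Definition is_limsup (u : nat -> R) (l : R) : Prop :=
  forall e, e > 0 ->
    (exists N, forall n, (N <= n)%nat -> u n < l + e) /\
    (forall N, exists n, (N <= n)%nat /\ u n > l - e).

Definition is_entropy (k : nat) (F : config -> config) (h : R) : Prop :=
  exists (s : nat -> R -> nat) (L : R -> R),
    (forall n eps, eps > 0 -> max_sep k F (S n) eps (s n eps)) /\
    (forall eps, eps > 0 ->
       is_limsup (fun n => log2 (INR (s n eps)) / INR (S n)) (L eps)) /\
    (forall eta, eta > 0 -> exists delta, delta > 0 /\
       forall eps, 0 < eps < delta -> Rabs (L eps - h) < eta).

Definition continuous_on (k : nat) (phi : config -> config) : Prop :=
  forall x, in_space k x -> forall m, exists l, forall y, in_space k y ->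
    (forall i, (i < l)%nat -> x i = y i) -> forall i, (i < m)%nat -> phi x i = phi y i.

Definition homeomorphism (k : nat) (phi : config -> config) : Prop :=
  (forall x, in_space k x -> in_space k (phi x)) /\
  continuous_on k phi /\
  exists psi : config -> config,
    (forall x, in_space k x -> in_space k (psi x)) /\
    continuous_on k psi /\
    (forall x, in_space k x -> forall i, psi (phi x) i = x i) /\
    (forall x, in_space k x -> forall i, phi (psi x) i = x i).

Definition strongly_conjugate (k : nat) (F G : config -> config) : Prop :=
  exists phi, homeomorphism k phi /\
    (forall x, in_space k x -> forall i, phi (F x) i = G (phi x) i) /\
    (forall x, in_space k x -> forall i, phi (shift x) i = shift (phi x) i).

Record ca_pair := {
  alph : nat;          (* alphabet A = {0, ..., alph - 1} *)
  radF : nat; ruleF : list nat;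
  radG : nat; ruleG : list nat }.

Definition wf_pair (p : ca_pair) : Prop :=
  (1 <= alph p)%nat /\ wf_rule (alph p) (radF p) (ruleF p) /\ wf_rule (alph p) (radG p) (ruleG p).

Definition caF (p : ca_pair) := ca (alph p) (radF p) (ruleF p).
Definition caG (p : ca_pair) := ca (alph p) (radG p) (ruleG p).

Definition enc_pair (p : ca_pair) : nat :=
  code_list (alph p :: radF p :: code_list (ruleF p) :: radG p :: code_list (ruleG p) :: nil).

(* Main.v *)
(** Nilpotency of one-sided cellular automata [H] with a spreading state is undecidable in a uniform way,
    and it is turned into the separation problem as follows.  Add to [H] a fibre [(Z/m)^2] and let
    [G(a, x, y) = (H a, y, x)] and [F(a, x, y) = (H a, y, x + s)], where [s] is the right neighbour's [y],
    replaced by 0 where [a] is dead.  Both act bijectively on fibres.  If [H] is nilpotent, the fibre map of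
    [F^(2T)] is a strong conjugacy and all entropies vanish.  Otherwise [F] is a reversible linear
    automaton of entropy at least [log m] over a live orbit, while [h(G) = h(H) <= 2 log |A| < log m].

    A counter machine halts iff the following [H] is nilpotent.  [H] is the level 0 of a family of
    automata: the cells of level [n] carry an address and a clock, hence form blocks, and a block of level
    [n] simulates one cell of level [n + 1], whose address, clock and payload it holds as unary markers.
    The payload is finite and the instructions that make a block simulate depend on (address, clock)
    only through a table that is the same for all levels, so a block finds the instruction of the
    simulated cell at the place where that cell's address and clock markers meet its own coordinates.
    Level [n] also knows the machine configuration at time [n], its cell [x] recording which counters
    have value [x]; one machine step relates consecutive levels.  A cell dies when it sees an
    inconsistency or a halting state, so an orbit lives forever iff the machine never halts.

    Given a recursive separating set, run its decision procedure in the machine on the code of the very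
    pair [(F, G)] built from that machine, and halt iff the answer is "yes". *)
From Stdlib Require Import Reals List Arith ZArith Lia Lra Bool Classical IndefiniteDescription
  FunctionalExtensionality.
Require Import Defs.
Import ListNotations.
Open Scope R_scope.
Local Open Scope nat_scope.

(** * Finite types *)


(** The table interpreted by a block has to list the local rule, while the local rule obeys the
    table. The circle is broken by passing the instruction to the rule as an argument, the field
    [cac] of the class: [phi] is fixed and its inputs are numbered first, and [tab] is computed from
    it afterwards, so no fixed point theorem is used. The self-reference of the machine is handled
    in the same spirit: the program is fixed before the number [e], and [e] is only its input. The
    block length doubles from level to level because the machine data of level [n] must fit into one
    block, and a step may lengthen the tape by one cell; two marker rails then suffice to write an
    address below [2 * b]. Consistency cannot be assumed of a row, it has to be enforced by death.
    Hence every property that makes a block decodable is tested by some cell at some time of the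
    macro step, and surviving one macro step must be equivalent to being decodable with a surviving
    simulated row. Death in one step at a high level then becomes death in bounded time at level 0,
    and liveness at level 0 for long times comes from liveness for one step at high levels. *)

Definition finite (T : Type) : Prop :=
  exists (K : nat) (e : T -> nat) (d : nat -> T), forall v, e v < K /\ d (e v) = v.

Lemma finite_bool : finite bool.
Proof. exists 2, (fun b : bool => if b then 1 else 0), (fun n => n =? 1). intros []; simpl; split; auto. Qed.

Lemma finite_option T : finite T -> finite (option T).
Proof.
  intros (K & e & d & H).
  exists (S K), (fun o => match o with Some v => S (e v) | None => 0 end),
    (fun n => match n with S m => Some (d m) | 0 => None end).
  intros [v|]; simpl; [destruct (H v) as [? ->]|]; split; auto; lia.
Qed.

Lemma finite_prod T U : finite T -> finite U -> finite (T * U).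
Proof.
  intros (K & e & d & H) (K' & e' & d' & H').
  exists (K * K'), (fun p => e (fst p) * K' + e' (snd p)), (fun n => (d (n / K'), d' (n mod K'))).
  intros [t u]; simpl; destruct (H t) as [h1 h2], (H' u) as [h3 h4]; split; [nia|].
  rewrite Nat.div_add_l, Nat.div_small, Nat.add_0_r by lia.
  rewrite (Nat.add_comm _ (e' u)), Nat.Div0.mod_add, Nat.mod_small by lia. congruence.
Qed.

Lemma finite_retract T U (f : T -> U) (g : U -> T) :
  (forall t, g (f t) = t) -> finite U -> finite T.
Proof.
  intros gf (K & e & d & H). exists K, (fun t => e (f t)), (fun n => g (d n)).
  intros t; destruct (H (f t)) as [h1 h2]; rewrite h2; auto.
Qed.

(* [fin n] has [n + 1] elements. *)
Fixpoint fin (n : nat) : Type := match n with 0 => unit | S m => option (fin m) end.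

Fixpoint fval (n : nat) : fin n -> nat :=
  match n with
  | 0 => fun _ => 0
  | S m => fun x => match x with Some y => S (fval m y) | None => 0 end
  end.

Fixpoint fmk (n i : nat) : fin n :=
  match n return fin n with
  | 0 => tt
  | S m => match i with 0 => None | S j => Some (fmk m j) end
  end.

Lemma fval_fmk n i : i <= n -> fval n (fmk n i) = i.
Proof. revert i; induction n as [|n IH]; intros [|i] h; simpl; auto; [lia|]. rewrite IH; lia. Qed.

Lemma finite_fin n : finite (fin n).
Proof.
  induction n; simpl; [|now apply finite_option].
  exists 1, (fun _ => 0), (fun _ => tt). intros []; auto.
Qed.

(** * A self-simulating family of cellular automata *)

Inductive phase := P0 | P1 | P2.

Definition nextph p := match p with P0 => P1 | P1 => P2 | P2 => P0 end.
Definition ph_eqb p q :=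
  match p, q with P0, P0 | P1, P1 | P2, P2 => true | _, _ => false end.

Lemma finite_phase : finite phase.
Proof.
  exists 3, (fun p => match p with P0 => 0 | P1 => 1 | P2 => 2 end),
    (fun n => match n with 0 => P0 | 1 => P1 | _ => P2 end).
  intros []; split; auto.
Qed.

(* Instructions of the third phase, see [tab]: compare with the class marker, with the left, own and
   right payload markers, emit, kill, store; [vc] selects the addresses where payload codes live. *)
Record act := Act { ck : bool; cl : bool; cc : bool; cr : bool; em : bool; kl : bool; sto : bool; vc : bool }.

Definition act0 := Act false false false false false false false false.

(** A sum with unit [act0], so that instructions travelling on a bus can be superposed. In a block
    that represents a cell at most one summand reaching address 0 differs from [act0]. *)
Definition orA (a b : act) : act :=
  Act (ck a || ck b) (cl a || cl b) (cc a || cc b) (cr a || cr b)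
      (em a || em b) (kl a || kl b) (sto a || sto b) (vc a || vc b).

Lemma orA_0_l a : orA act0 a = a. Proof. now destruct a. Qed.
Lemma orA_0_r a : orA a act0 = a.
Proof. destruct a; unfold orA; simpl; now rewrite !orb_false_r. Qed.


Set Implicit Arguments.

Section Rule.
Variables (St Sy : Type) (step : St -> Sy -> St) (delta : St -> bool -> Sy -> Sy -> Sy -> Sy)
  (blank : Sy) (hlt : St -> bool).

(* What the local rule may know about the coordinates of a cell: control state and symbol of the
   machine, whether the address is 0, is the last one, equals [w] (start of a phase), and the instruction. *)
Record cls := Cls { cst : St; csy : Sy; cz : bool; cL : bool; cdg : bool; cac : act }.

Definition info := (Sy * bool * bool * bool)%type.

Variables (Q : nat) (encC : cls -> nat).

(* Payload of a cell.  A block of [b] cells with addresses [x = 0, ..., b - 1] simulates one cell with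
   state [(X, W, a)] of the next level; the unary markers encoding it are [vx0], [vx1] at address [X]
   resp. [X - b], [vw0], [vw1] likewise for [W], and [vv] at the code of the payload [a].  [vsy] copies
   the machine symbol of the cell.  A macro step consists of three phases [vph] of [b] steps each:
   - [P0]: [bx], [bw], [bv], [ba] carry to address 0, where [ax], [aw], [av], [aa], [vas] collect them,
     the class of the simulated cell and the number of markers; [vsh] is a left moving copy of [vw0],
     and the place where it meets [vx0] shows the pair [(X, W)];
   - [P1]: the class arrived at address 0 is sent right as a countdown [vcd] and leaves a marker [vuc]
     at its code; [tx0], ..., [tv] and [tr] fetch the markers of the right and of the left block;
   - [P2]: right moving copies [sl], [sc], [sr], [sk] of the markers of the three payloads and of the
     class are compared in [mt] by the columns of the table of the local rule, and the matching column
     sends [vg] to the code of the new payload. *)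
Record V := mkV {
  vph : phase; vsy : Sy;
  vx0 : bool; vx1 : bool; vw0 : bool; vw1 : bool; vv : bool;
  tx0 : bool; tx1 : bool; tw0 : bool; tw1 : bool; tv : bool; tr : bool; vsh : bool;
  bx : option info; ax : option info; bw : bool; aw : bool; bv : bool; av : bool;
  ba : act; aa : act; vas : St; vcd : option (fin Q); vuc : bool;
  sl : bool; sc : bool; sr : bool; sk : bool; mt : bool; vg : bool }.

(** The stored phase is that of the preceding step; the phase in force has already advanced when
    address and clock coincide. *)
Definition eph (c : cls) (v : V) : phase := if cdg c then nextph (vph v) else vph v.

Definition orelse {T} (a b : option T) : option T := match a with Some _ => a | None => b end.

(** In the first step of the phase the moving copy [vsh] is not loaded yet, so the marker itself is
    read. *)
Definition hit (c : cls) (v : V) : bool := vx0 v && (if cdg c then vw0 v else vsh v).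

(** A marker on the first rail stands for an address below [b], where the next machine symbol is
    computed from the three symbols around it, and which is never the last address. On the second
    rail the address is at least [b]: never 0, and outside the tape. *)
Definition emX (c : cls) (l v r : V) : option info :=
  if vx0 v then Some (delta (cst c) (cz c) (vsy l) (csy c) (if cL c then blank else vsy r),
                      cz c, false, vw0 v)
  else if vx1 v then Some (blank, false, cL c, vw1 v)
  else None.

(** Meant for address 0: there [vas] is the machine step on the symbol at 0, which is the symbol
    scanned by the control. *)
Definition newcls (v : V) : option cls :=
  match orelse (bx v) (ax v) with
  | Some (g, z, l, d) => Some (Cls (vas v) g z l d (orA (aa v) (ba v)))
  | None => None
  end.

Definition isP1 p := ph_eqb p P1.
Definition isP2 p := ph_eqb p P2.

(** The new clock of a simulated cell is not computed: in a consistent row it equals the present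
    clock of the right neighbour, so the markers [tw0] and [tw1] fetched in [P1] replace [vw0] and
    [vw1]. *)
Definition upd (c : cls) (l v r : V) : V :=
  let f := eph c v in
  let d := cdg c in
  let a := cac c in
  {| vph := f; vsy := csy c;
     vx0 := vx0 v; vx1 := vx1 v;
     vw0 := if isP2 f && d then tw0 v else vw0 v;
     vw1 := if isP2 f && d then tw1 v else vw1 v;
     vv := if isP2 f && sto a then vg v else vv v;
     tx0 := if isP1 f && d then vx0 r else tx0 r;
     tx1 := if isP1 f && d then vx1 r else tx1 r;
     tw0 := if isP1 f && d then vw0 r else tw0 r;
     tw1 := if isP1 f && d then vw1 r else tw1 r;
     tv := if isP1 f && d then vv r else tv r;
     tr := if isP1 f && d then vv l else tr l;
     vsh := if d then vw0 r else vsh r;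
     bx := if d then emX c l v r else bx r;
     ax := if d then None else orelse (bx v) (ax v);
     bw := if d then vw0 v || vw1 v else bw r;
     aw := if d then false else bw v || aw v;
     bv := if d then vv v && vc a else bv r;
     av := if d then false else bv v || av v;
     ba := orA (if d then act0 else ba r) (if hit c v then a else act0);
     aa := if d then act0 else orA (aa v) (ba v);
     vas := if d then step (cst c) (csy c) else vas v;
     vcd := if isP1 f && d then
              (if cz c then option_map (fun k => fmk Q (encC k)) (newcls v) else None)
            else match vcd l with
                 | Some k => match fval Q k with 0 => None | S j => Some (fmk Q j) end
                 | None => None
                 end;
     vuc := if isP1 f && d then false
            else vuc v || match vcd v with Some k => fval Q k =? 0 | None => false end;
     sl := if d then tr l else sl l;
     sc := if d then vv l else sc l;
     sr := if d then tv l else sr l;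
     sk := if d then vuc l else sk l;
     mt := if d then true
           else mt v && implb (ck a) (sk v) && implb (cl a) (sl v)
                     && implb (cc a) (sc v) && implb (cr a) (sr v);
     vg := if d then false else vg r || (em a && mt v) |}.

Definition isSome {T} (o : option T) : bool := match o with Some _ => true | None => false end.

(** The faults, in order: a halting state, different phases of neighbours, both rails marked in one
    cell, a second marker arriving at address 0, a total count different from one, addresses or
    clocks of adjacent blocks that are not consecutive, a matching column whose entry is death. The
    count is closed when [P1] starts; the item from the last cell is then still on the bus, hence
    exactly one of bus and collector must be filled. *)
Definition kill (c : cls) (l v r : V) : bool :=
  let f := eph c v in
  let d := cdg c in
  hlt (cst c)
  || negb (ph_eqb (vph r) (vph v))
  || ph_eqb f P0 && d && (vx0 v && vx1 v || vw0 v && vw1 v)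
  || ph_eqb f P0 && negb d && cz c
     && (isSome (bx v) && isSome (ax v) || bw v && aw v || bv v && av v)
  || isP1 f && d && cz c
     && (eqb (isSome (bx v)) (isSome (ax v)) || eqb (bw v) (aw v) || eqb (bv v) (av v))
  || isP2 f && d
     && negb (if cL c
              then eqb (vx0 r) (vx1 v) && eqb (vx1 r) (vx0 v)
                   && eqb (vw0 r) (vw1 v) && eqb (vw1 r) (vw0 v)
              else eqb (tx0 r) (vx0 v) && eqb (tx1 r) (vx1 v)
                   && eqb (tw0 r) (vw0 v) && eqb (tw1 r) (vw1 v))
  || isP2 f && negb d && kl (cac c) && mt v.

Definition phi (c : cls) (l v r : V) : option V :=
  if kill c l v r then None else Some (upd c l v r).

Lemma finite_cls : finite St -> finite Sy -> finite cls.
Proof.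
  intros hS hG.
  apply (finite_retract _ (St * Sy * (bool * bool * bool * (bool * bool * bool * bool * (bool * bool * bool * bool))))
    (fun c => (cst c, csy c, (cz c, cL c, cdg c, (ck (cac c), cl (cac c), cc (cac c), cr (cac c),
       (em (cac c), kl (cac c), sto (cac c), vc (cac c))))))
    (fun p => match p with (s, g, (z, l, d, (a1, a2, a3, a4, (a5, a6, a7, a8)))) =>
       Cls s g z l d (Act a1 a2 a3 a4 a5 a6 a7 a8) end)).
  - intros [s g z l d []]; reflexivity.
  - repeat apply finite_prod; auto using finite_bool.
Qed.

Lemma finite_act : finite act.
Proof.
  apply (finite_retract _ (bool * bool * bool * bool * (bool * bool * bool * bool))
    (fun a => (ck a, cl a, cc a, cr a, (em a, kl a, sto a, vc a)))
    (fun p => match p with (a1, a2, a3, a4, (a5, a6, a7, a8)) => Act a1 a2 a3 a4 a5 a6 a7 a8 end)).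
  - intros []; reflexivity.
  - repeat apply finite_prod; auto using finite_bool.
Qed.

Lemma finite_V : finite St -> finite Sy -> finite V.
Proof.
  intros hS hG.
  apply (finite_retract _
    (phase * Sy * (bool * bool * bool * bool * bool) * (bool * bool * bool * bool * bool * bool * bool)
     * (option info * option info * bool * bool * bool * bool) * (act * act * St * option (fin Q) * bool)
     * (bool * bool * bool * bool * bool * bool))
    (fun v => (vph v, vsy v, (vx0 v, vx1 v, vw0 v, vw1 v, vv v),
       (tx0 v, tx1 v, tw0 v, tw1 v, tv v, tr v, vsh v),
       (bx v, ax v, bw v, aw v, bv v, av v), (ba v, aa v, vas v, vcd v, vuc v),
       (sl v, sc v, sr v, sk v, mt v, vg v)))
    (fun p => match p with
      (a, b, (c1, c2, c3, c4, c5), (d1, d2, d3, d4, d5, d6, d7), (e1, e2, e3, e4, e5, e6),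
       (f1, f2, f3, f4, f5), (g1, g2, g3, g4, g5, g6)) =>
      mkV a b c1 c2 c3 c4 c5 d1 d2 d3 d4 d5 d6 d7 e1 e2 e3 e4 e5 e6 f1 f2 f3 f4 f5 g1 g2 g3 g4 g5 g6 end)).
  - intros []; reflexivity.
  - repeat apply finite_prod; repeat apply finite_option; repeat apply finite_prod;
      auto using finite_bool, finite_phase, finite_fin, finite_act.
Qed.
End Rule.

Ltac decide_false c :=
  replace c with false by (symmetry;
    first [apply Z.eqb_neq | apply Nat.eqb_neq | apply Z.ltb_ge | apply Nat.ltb_ge | apply Z.leb_gt]; lia).

Ltac decide_true c :=
  replace c with true by (symmetry;
    first [apply Z.eqb_eq | apply Nat.eqb_eq | apply Nat.ltb_lt | apply Nat.leb_le]; lia).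

Lemma bool_iff_eq (x y : bool) : x = y -> (x = true <-> y = true).
Proof. now intros ->. Qed.

(** * The instruction table and the levels of the hierarchy *)

Section Sim.
Variables (St Sy : Type) (step : St -> Sy -> St) (delta : St -> bool -> Sy -> Sy -> Sy -> Sy)
  (blank : Sy) (hlt : St -> bool).
Variables (Q : nat) (encC : cls St Sy -> nat) (decC : nat -> cls St Sy).
Hypothesis HC : forall c, encC c < Q /\ decC (encC c) = c.
Variables (K : nat) (encV : V St Sy Q -> nat) (decV : nat -> V St Sy Q).
Hypothesis HV : forall v, encV v < K /\ decV (encV v) = v.

Notation V := (V St Sy Q).
Notation upd := (upd step delta blank encC).
Notation kill := (kill hlt).
Notation phi := (phi step delta blank hlt encC).

(** Columns occupy the addresses from [Kp] up to [XM], to the right of all codes, so markers moving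
    right pass them at positive times. Column [x] has seen all its markers after step [x]; [TA] is
    large enough for its signal to leave later than that and still be due at time [TA]. All nonzero
    instructions satisfy [x + o < C0]. *)
Definition Kp := Nat.max K Q.
Definition NI := Q * K * K * K.
Definition XM := Kp + NI.
Definition TA := 2 * XM + 2.
Definition C0 := TA + XM + 2.

Definition iC (I : nat) := I / K / K / K.
Definition iL (I : nat) := (I / K / K) mod K.
Definition iM (I : nat) := (I / K) mod K.
Definition iR (I : nat) := I mod K.
Definition index (c l m r : nat) := ((c * K + l) * K + m) * K + r.

Definition phiI (I : nat) : option V :=
  phi (decC (iC I)) (decV (iL I)) (decV (iM I)) (decV (iR I)).

(* Column [Kp + I] of a block recognizes the [I]-th combination of inputs of the local rule. *)
Definition tab (x o : nat) : act :=
  let I := x - Kp in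
  let col := (Kp <=? x) && (x <? XM) in
  {| ck := col && (o =? x - iC I);
     cl := col && (o =? x - iL I);
     cc := col && (o =? x - iM I);
     cr := col && (o =? x - iR I);
     em := col && match phiI I with Some v => o =? TA - 1 - x + encV v | None => false end;
     kl := col && match phiI I with Some _ => false | None => o =? S x end;
     sto := (x <? K) && (o =? TA);
     vc := (x <? K) && (o =? 0) |}.

(* The instruction of a cell is a function of [x] and [w = x + time] that is the same on all levels: the
   lookup in phase [P0] detects a coincidence at exactly the cell [(X, W)], which knows [Theta X W]. *)
Definition Theta (x w : Z) : act :=
  if ((0 <=? x) && (x <=? w) && (w <? Z.of_nat C0))%Z
  then tab (Z.to_nat x) (Z.to_nat (w - x)) else act0.

Definition lcls (b : nat) (s : St) (gam : Z -> Sy) (x w : Z) : cls St Sy :=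
  Cls s (gam x) (x =? 0)%Z (x =? Z.of_nat b - 1)%Z (x =? w)%Z (Theta x w).

Definition succB (b : nat) (x : Z) : Z := if (x =? Z.of_nat b - 1)%Z then 0%Z else (x + 1)%Z.

Definition state := (Z * Z * V)%type.

(* The local rule of a level with blocks of length [b]; [None] is the dead state. *)
Definition Hlev (b : nat) (s : St) (gam : Z -> Sy) (l c r : state) : option state :=
  match l, c, r with
  | (_, _, vl), (x, w, v), (xr, wr, vr) =>
    if ((xr =? succB b x) && (wr =? succB b w))%Z then
      match phi (lcls b s gam x w) vl v vr with
      | Some v' => Some (x, succB b w, v')
      | None => None
      end
    else None
  end.

Definition valid (b : nat) (z : state) : Prop :=
  match z with (x, w, _) => (0 <= x < Z.of_nat b /\ 0 <= w < Z.of_nat b)%Z end.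

(* One step of the machine separates the symbols of consecutive levels. *)
Definition gnext (s : St) (gam : Z -> Sy) (x : Z) : Sy :=
  delta s (x =? 0)%Z (if (x =? 0)%Z then blank else gam (x - 1)%Z) (gam x) (gam (x + 1)%Z).

Lemma index_dec c l m r : l < K -> m < K -> r < K ->
  iC (index c l m r) = c /\ iL (index c l m r) = l /\ iM (index c l m r) = m /\ iR (index c l m r) = r.
Proof.
  intros hl hm hr. unfold iC, iL, iM, iR, index.
  assert (E : forall a d, d < K -> (a * K + d) / K = a /\ (a * K + d) mod K = d).
  { intros a d h. rewrite Nat.div_add_l, Nat.div_small by lia.
    rewrite (Nat.add_comm (a * K) d), Nat.Div0.mod_add, Nat.mod_small by lia. lia. }
  destruct (E ((c * K + l) * K + m) r hr) as [-> ->].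
  destruct (E (c * K + l) m hm) as [-> ->]. destruct (E c l hl) as [-> ->]. auto.
Qed.

Lemma index_lt c l m r : c < Q -> l < K -> m < K -> r < K -> index c l m r < NI.
Proof.
  unfold index, NI. intros.
  assert (h1 : c * K + l < Q * K) by nia.
  assert (h2 : (c * K + l) * K + m < Q * K * K) by nia. nia.
Qed.

Lemma dec_index I : index (iC I) (iL I) (iM I) (iR I) = I.
Proof.
  unfold index, iC, iL, iM, iR.
  destruct (Nat.eq_dec K 0) as [->|h]; [simpl; lia|].
  pose proof (Nat.div_mod I K h). pose proof (Nat.div_mod (I / K) K h).
  pose proof (Nat.div_mod (I / K / K) K h). nia.
Qed.

Lemma iLMR_lt I : I < NI -> iL I < K /\ iM I < K /\ iR I < K /\ iC I < Q.
Proof.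
  intros h. assert (hK : K <> 0) by (intros ->; unfold NI in h; lia).
  unfold iL, iM, iR, iC. repeat split; try (apply Nat.mod_upper_bound; auto).
  repeat apply Nat.Div0.div_lt_upper_bound. unfold NI in h. lia.
Qed.

(** Needed where the clock has wrapped around the block: there [x + o] is at least the block length,
    [Theta] answers [act0], and the table has to agree. *)
Lemma tab_big x o : C0 <= x + o -> tab x o = act0.
Proof.
  intros h. assert (hm : Kp <= XM) by (unfold XM; lia).
  assert (K <= Kp) by (unfold Kp; lia).
  unfold C0, TA in h. unfold tab.
  destruct ((Kp <=? x) && (x <? XM)) eqn:E1.
  - apply andb_true_iff in E1 as [E1 E2]. apply Nat.leb_le in E1. apply Nat.ltb_lt in E2.
    assert (Ev : forall v, (o =? TA - 1 - x + encV v) = false).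
    { intros v. apply Nat.eqb_neq. destruct (HV v). unfold TA. lia. }
    assert (E3 : forall k, (o =? x - k) = false) by (intros; apply Nat.eqb_neq; lia).
    assert (E4 : (o =? S x) = false) by (apply Nat.eqb_neq; lia).
    assert (E5 : (o =? 0) = false) by (apply Nat.eqb_neq; lia).
    assert (E6 : (x <? K) = false) by (apply Nat.ltb_ge; lia).
    rewrite !E3, E4, E5, E6. destruct (phiI _); [rewrite Ev|]; reflexivity.
  - destruct (x <? K) eqn:E6; simpl; [|reflexivity]. apply Nat.ltb_lt in E6.
    replace (o =? TA) with false by (symmetry; apply Nat.eqb_neq; unfold TA; lia).
    decide_false (o =? 0). reflexivity.
Qed.

(** * Dynamics of an aligned row of one level *)

Section Level.
Variables (b : nat) (s : St) (gam : Z -> Sy).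
Hypothesis hb : C0 <= b.
Hypothesis hgam : forall x, (Z.of_nat b - 1 <= x)%Z -> gam x = blank.
Hypothesis hdelta : forall s, delta s false blank blank blank = blank.
Notation B := (Z.of_nat b).
Notation zn := Z.of_nat.

Lemma b_pos : 0 < b.
Proof. unfold C0 in hb. lia. Qed.
Lemma K_lt_b : Kp < XM + 1 /\ XM + TA < b /\ K <= Kp /\ Q <= Kp /\ 2 * XM + 2 = TA.
Proof. unfold C0, TA, XM, Kp in *. lia. Qed.

Definition clat (t : nat) (i : Z) : cls St Sy :=
  lcls b s gam (i mod B)%Z ((i + zn t) mod B)%Z.

Variable u0 : Z -> V.

(** The orbit computed as if no cell ever died. Deaths are examined afterwards through [killat], so
    the tracks can be described without case distinctions. *)
Fixpoint u (t : nat) (i : Z) : V :=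
  match t with
  | 0 => u0 i
  | S t' => upd (clat t' i) (u t' (i - 1)%Z) (u t' i) (u t' (i + 1)%Z)
  end.

Hypothesis hph : forall i, vph (u0 i) = P2.
Hypothesis hsy : forall i, vsy (u0 i) = gam (i mod B)%Z.

Lemma modB J x : (0 <= x < B)%Z -> ((J * B + x) mod B = x)%Z.
Proof. intros h. rewrite Z.add_comm, Z.mod_add by lia. apply Z.mod_small; lia. Qed.

Lemma cdg_at p o i : o < b -> cdg (clat (p * b + o) i) = (o =? 0).
Proof.
  intros h. unfold clat, lcls; simpl.
  set (x := (i mod B)%Z).
  assert (hx : (0 <= x < B)%Z) by (apply Z.mod_pos_bound; lia).
  assert (hi : i = (i / B * B + x)%Z) by (unfold x; rewrite (Z.div_mod i B) at 1; lia).
  assert (E : ((i + zn (p * b + o)) mod B = (x + zn o) mod B)%Z).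
  { replace (i + zn (p * b + o))%Z with (x + zn o + (i / B + zn p) * B)%Z by lia.
    apply Z.mod_add; lia. }
  rewrite E. destruct (Nat.eqb_spec o 0) as [->|ho].
  - rewrite Z.add_0_r, Z.mod_small, Z.eqb_refl by lia. reflexivity.
  - apply Z.eqb_neq. destruct (Z_lt_ge_dec (x + zn o) B).
    + rewrite Z.mod_small; lia.
    + replace (x + zn o)%Z with (x + zn o - B + 1 * B)%Z by lia.
      rewrite Z.mod_add, Z.mod_small; lia.
Qed.

Lemma cac_at p o J x : o < b -> x < b -> cac (clat (p * b + o) (J * B + zn x)) = tab x o.
Proof.
  intros h hx. unfold clat, lcls; simpl. rewrite modB by lia. unfold Theta.
  assert (E : ((J * B + zn x + zn (p * b + o)) mod B = (zn x + zn o) mod B)%Z).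
  { replace (J * B + zn x + zn (p * b + o))%Z with (zn x + zn o + (J + zn p) * B)%Z by lia.
    apply Z.mod_add; lia. }
  rewrite E. destruct (lt_dec (x + o) b) as [h'|h'].
  - rewrite Z.mod_small by lia.
    destruct (lt_dec (x + o) C0).
    + replace (_ && _ && _) with true by (symmetry; rewrite !andb_true_iff, !Z.leb_le, Z.ltb_lt; lia).
      f_equal; lia.
    + decide_false (zn x + zn o <? zn C0)%Z.
      rewrite andb_false_r, (@tab_big x o) by lia. reflexivity.
  - replace (zn x + zn o)%Z with (zn x + zn o - B + 1 * B)%Z by lia.
    rewrite Z.mod_add, Z.mod_small by lia.
    decide_false (zn x <=? zn x + zn o - B)%Z.
    rewrite andb_false_r, (@tab_big x o) by lia. reflexivity.
Qed.

Lemma csy_at t i : csy (clat t i) = gam (i mod B)%Z. Proof. reflexivity. Qed.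
Lemma cst_at t i : cst (clat t i) = s. Proof. reflexivity. Qed.
Lemma cz_at t i : cz (clat t i) = (i mod B =? 0)%Z. Proof. reflexivity. Qed.
Lemma cL_at t i : cL (clat t i) = (i mod B =? B - 1)%Z. Proof. reflexivity. Qed.

Definition phase_of (p : nat) : phase := match p with 0 => P0 | 1 => P1 | _ => P2 end.

Lemma tb t : exists p o, t = p * b + o /\ o < b.
Proof.
  pose proof b_pos. exists (t / b), (t mod b). split.
  - rewrite Nat.mul_comm. apply Nat.div_mod; lia.
  - apply Nat.mod_upper_bound; lia.
Qed.

Lemma ph_prog p o i : o < b ->
  eph (clat (p * b + o) i) (u (p * b + o) i) = phase_of (p mod 3) /\
  vph (u (S (p * b + o)) i) = phase_of (p mod 3).
Proof.
  intros ho.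
  assert (E : forall t, (forall p o, t = p * b + o -> o < b ->
     eph (clat t i) (u t i) = phase_of (p mod 3)) /\
     (forall p o, t = p * b + o -> o < b -> vph (u (S t) i) = phase_of (p mod 3))).
  { induction t as [|t IH].
    - assert (E : forall p o, 0 = p * b + o -> o < b -> eph (clat 0 i) (u 0 i) = phase_of (p mod 3)).
      { intros p' o' h h'. pose proof b_pos.
        assert (p' = 0 /\ o' = 0) as [-> ->] by nia.
        unfold eph. change 0 with (0 * b + 0) at 1. rewrite cdg_at by lia. simpl. now rewrite hph. }
      split; [exact E|]. intros p' o' h h'. rewrite <- (E p' o' h h'). reflexivity.
    - assert (E : forall p o, S t = p * b + o -> o < b ->
        eph (clat (S t) i) (u (S t) i) = phase_of (p mod 3)).
      { intros p' o' h h'. unfold eph. rewrite h at 1. rewrite cdg_at by lia.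
        destruct o' as [|o'].
        - destruct p' as [|p']; [lia|]. change (0 =? 0) with true. cbv iota.
          destruct IH as [_ IH]. rewrite (IH p' (b - 1)) by lia.
          replace (S p' mod 3) with (match p' mod 3 with 0 => 1 | 1 => 2 | _ => 0 end).
          2:{ pose proof (Nat.div_mod p' 3). pose proof (Nat.mod_upper_bound p' 3).
              destruct (p' mod 3) as [|[|[|]]] eqn:E3; try lia.
              - symmetry; replace (S p') with (1 + (p' / 3) * 3) by lia. now rewrite Nat.Div0.mod_add.
              - symmetry; replace (S p') with (2 + (p' / 3) * 3) by lia. now rewrite Nat.Div0.mod_add.
              - symmetry; replace (S p') with (0 + (p' / 3 + 1) * 3) by lia. now rewrite Nat.Div0.mod_add. }
          destruct (p' mod 3) as [|[|]]; reflexivity.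
        - change (S o' =? 0) with false. cbv iota. destruct IH as [_ IH]. rewrite (IH p' o') by lia. reflexivity. }
      split; [exact E|]. intros p' o' h h'. rewrite <- (E p' o' h h'). reflexivity. }
  destruct (E (p * b + o)) as [E1 E2]. split; [eapply E1|eapply E2]; eauto.
Qed.

Lemma eph_at p o i : p < 3 -> o < b ->
  eph (clat (p * b + o) i) (u (p * b + o) i) = phase_of p.
Proof. intros hp h. destruct (ph_prog p i h) as [E _]. now rewrite Nat.mod_small in E by lia. Qed.

Lemma vph_all t i j : vph (u t i) = vph (u t j).
Proof.
  destruct t as [|t]; [simpl; now rewrite !hph|].
  destruct (tb t) as (p & o & -> & h).
  destruct (ph_prog p i h) as [_ ->]. destruct (ph_prog p j h) as [_ ->]. reflexivity.
Qed.

Lemma vph_end i : vph (u (3 * b) i) = P2.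
Proof.
  pose proof b_pos. destruct (@ph_prog 2 (b - 1) i) as [_ E]; [lia|].
  replace (S (2 * b + (b - 1))) with (3 * b) in E by lia. now rewrite E.
Qed.

Lemma vsy_all t i : vsy (u t i) = gam (i mod B)%Z.
Proof. destruct t; [apply hsy|reflexivity]. Qed.


(** Common form of the left moving tracks: loaded from [g] when phase [p] starts, then shifted once
    per step. At [o = b] each cell holds the entry of the next block at its own address. *)
Lemma shiftL T (f g : V -> T) p :
  (forall i, f (u (S (p * b + 0)) i) = g (u (p * b) (i + 1)%Z)) ->
  (forall o i, 1 <= o < b -> f (u (S (p * b + o)) i) = f (u (p * b + o) (i + 1)%Z)) ->
  forall o i, 1 <= o <= b -> f (u (p * b + o) i) = g (u (p * b) (i + zn o)%Z).
Proof.
  intros h0 h1 o. induction o as [|o IH]; intros i ho; [lia|].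
  rewrite Nat.add_succ_r. destruct (Nat.eq_dec o 0) as [->|]; [apply h0|].
  rewrite h1, IH by lia. do 2 f_equal. lia.
Qed.

Lemma shiftR T (f g : V -> T) p :
  (forall i, f (u (S (p * b + 0)) i) = g (u (p * b) (i - 1)%Z)) ->
  (forall o i, 1 <= o < b -> f (u (S (p * b + o)) i) = f (u (p * b + o) (i - 1)%Z)) ->
  forall o i, 1 <= o <= b -> f (u (p * b + o) i) = g (u (p * b) (i - zn o)%Z).
Proof.
  intros h0 h1 o. induction o as [|o IH]; intros i ho; [lia|].
  rewrite Nat.add_succ_r. destruct (Nat.eq_dec o 0) as [->|]; [apply h0|].
  rewrite h1, IH by lia. do 2 f_equal. lia.
Qed.

Lemma x0_all t i : vx0 (u t i) = vx0 (u0 i).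
Proof. induction t; auto. Qed.
Lemma x1_all t i : vx1 (u t i) = vx1 (u0 i).
Proof. induction t; auto. Qed.

Lemma not2 t i : t < 2 * b -> isP2 (eph (clat t i) (u t i)) = false.
Proof.
  intros h. destruct (tb t) as (p & o & -> & ho).
  assert (p < 2) by nia. rewrite eph_at by lia. destruct p as [|[|]]; auto; lia.
Qed.

Lemma w0_early t i : t <= 2 * b -> vw0 (u t i) = vw0 (u0 i).
Proof.
  induction t as [|t IH]; intros h; auto.
  transitivity (vw0 (u t i)); [|apply IH; lia]. cbn [u upd vw0]. now rewrite not2 by lia.
Qed.
Lemma w1_early t i : t <= 2 * b -> vw1 (u t i) = vw1 (u0 i).
Proof.
  induction t as [|t IH]; intros h; auto.
  transitivity (vw1 (u t i)); [|apply IH; lia]. cbn [u upd vw1]. now rewrite not2 by lia.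
Qed.
Lemma vv_early t i : t <= 2 * b -> vv (u t i) = vv (u0 i).
Proof.
  induction t as [|t IH]; intros h; auto.
  transitivity (vv (u t i)); [|apply IH; lia]. cbn [u upd vv]. now rewrite not2 by lia.
Qed.

Ltac shift0 f := cbn [u upd f]; rewrite eph_at, cdg_at, ?Nat.add_0_r by lia; reflexivity.
Ltac shift1 f :=
  let o := fresh in let i := fresh in let ho := fresh in intros o i ho; cbn [u upd f]; rewrite ?eph_at, cdg_at by lia;
  destruct o; [lia|]; rewrite ?andb_false_r; reflexivity.

Lemma tx0_at o i : 1 <= o <= b -> tx0 (u (1 * b + o) i) = vx0 (u0 (i + zn o)%Z).
Proof.
  intros h. pose proof b_pos. rewrite <- (x0_all (1 * b)).
  apply (shiftL (@tx0 _ _ _) (@vx0 _ _ _)); auto; [intros; shift0 tx0|shift1 tx0].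
Qed.

Lemma tx1_at o i : 1 <= o <= b -> tx1 (u (1 * b + o) i) = vx1 (u0 (i + zn o)%Z).
Proof.
  intros h. pose proof b_pos. rewrite <- (x1_all (1 * b)).
  apply (shiftL (@tx1 _ _ _) (@vx1 _ _ _)); auto; [intros; shift0 tx1|shift1 tx1].
Qed.

Lemma tw0_at o i : 1 <= o <= b -> tw0 (u (1 * b + o) i) = vw0 (u0 (i + zn o)%Z).
Proof.
  intros h. pose proof b_pos. rewrite <- (@w0_early (1 * b)) by lia.
  apply (shiftL (@tw0 _ _ _) (@vw0 _ _ _)); auto; [intros; shift0 tw0|shift1 tw0].
Qed.

Lemma tw1_at o i : 1 <= o <= b -> tw1 (u (1 * b + o) i) = vw1 (u0 (i + zn o)%Z).
Proof.
  intros h. pose proof b_pos. rewrite <- (@w1_early (1 * b)) by lia.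
  apply (shiftL (@tw1 _ _ _) (@vw1 _ _ _)); auto; [intros; shift0 tw1|shift1 tw1].
Qed.

Lemma tv_at o i : 1 <= o <= b -> tv (u (1 * b + o) i) = vv (u0 (i + zn o)%Z).
Proof.
  intros h. pose proof b_pos. rewrite <- (@vv_early (1 * b)) by lia.
  apply (shiftL (@tv _ _ _) (@vv _ _ _)); auto; [intros; shift0 tv|shift1 tv].
Qed.

Lemma tr_at o i : 1 <= o <= b -> tr (u (1 * b + o) i) = vv (u0 (i - zn o)%Z).
Proof.
  intros h. pose proof b_pos. rewrite <- (@vv_early (1 * b)) by lia.
  apply (shiftR (@tr _ _ _) (@vv _ _ _)); auto; [intros; shift0 tr|shift1 tr].
Qed.

Lemma vsh_at o i : 1 <= o <= b -> vsh (u (0 * b + o) i) = vw0 (u0 (i + zn o)%Z).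
Proof.
  intros h. pose proof b_pos. rewrite <- (@w0_early (0 * b)) by lia.
  apply (shiftL (@vsh _ _ _) (@vw0 _ _ _)); auto.
  - intros. cbn [u upd vsh]. rewrite cdg_at, ?Nat.add_0_r by lia. reflexivity.
  - shift1 vsh.
Qed.

(** * Phase [P0]: what arrives at address 0 *)

Definition EX (i : Z) : option (info Sy) :=
  emX delta blank (clat 0 i) (u0 (i - 1)%Z) (u0 i) (u0 (i + 1)%Z).
Definition BW (i : Z) : bool := vw0 (u0 i) || vw1 (u0 i).
Definition BV (i : Z) : bool := vv (u0 i) && vc (cac (clat 0 i)).

Lemma cdg0 i : cdg (clat 0 i) = true.
Proof. pose proof b_pos. change 0 with (0 * b + 0). now rewrite cdg_at by lia. Qed.

Lemma cdgS o i : S o < b -> cdg (clat (S o) i) = false.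
Proof. intros. change (S o) with (0 * b + S o). now rewrite cdg_at by lia. Qed.

Lemma bus (T : Type) (f : V -> T) (g : Z -> T) : (forall i, f (u 1 i) = g i) ->
  (forall o i, S o < b -> f (u (S (S o)) i) = f (u (S o) (i + 1)%Z)) ->
  forall o i, o < b -> f (u (S o) i) = g (i + zn o)%Z.
Proof.
  intros h0 h1 o. induction o as [|o IH]; intros i h.
  - now rewrite Z.add_0_r.
  - rewrite h1, IH by lia. f_equal. lia.
Qed.

Ltac bus_tac f :=
  intros; match goal with |- _ (u (S ?n) _) = _ => set (m := n); cbn [u upd f]; subst m end;
  rewrite ?cdg0, ?cdgS by lia; reflexivity.

Lemma bx_at o i : o < b -> bx (u (S o) i) = EX (i + zn o)%Z.
Proof. apply (bus (@bx _ _ _) EX); bus_tac bx. Qed.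
Lemma bw_at o i : o < b -> bw (u (S o) i) = BW (i + zn o)%Z.
Proof. apply (bus (@bw _ _ _) BW); bus_tac bw. Qed.
Lemma bv_at o i : o < b -> bv (u (S o) i) = BV (i + zn o)%Z.
Proof. apply (bus (@bv _ _ _) BV); bus_tac bv. Qed.

Fixpoint accb (e : nat -> bool) (k : nat) : bool :=
  match k with 0 => false | S j => e j || accb e j end.

Lemma aw_at o i : o < b -> aw (u (S o) i) = accb (fun j => BW (i + zn j)%Z) o.
Proof.
  induction o as [|o IH]; intros h.
  - cbn [u upd aw]. now rewrite cdg0.
  - set (n := S o) in *. cbn [u upd aw]. subst n. rewrite cdgS by lia.
    cbn [accb]. now rewrite <- IH, bw_at by lia.
Qed.

Lemma av_at o i : o < b -> av (u (S o) i) = accb (fun j => BV (i + zn j)%Z) o.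
Proof.
  induction o as [|o IH]; intros h.
  - cbn [u upd av]. now rewrite cdg0.
  - set (n := S o) in *. cbn [u upd av]. subst n. rewrite cdgS by lia.
    cbn [accb]. now rewrite <- IH, bv_at by lia.
Qed.

Lemma ax_at o i : o < b -> isSome (ax (u (S o) i)) = accb (fun j => isSome (EX (i + zn j)%Z)) o.
Proof.
  induction o as [|o IH]; intros h.
  - cbn [u upd ax]. now rewrite cdg0.
  - set (n := S o) in *. cbn [u upd ax]. subst n. rewrite cdgS by lia.
    cbn [accb]. rewrite <- IH, bx_at by lia. now destruct (EX _).
Qed.

Lemma ax_val o i j0 : o < b -> (forall j, j < b -> j <> j0 -> EX (i + zn j)%Z = None) ->
  ax (u (S o) i) = if j0 <? o then EX (i + zn j0)%Z else None.
Proof.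
  intros h hj. induction o as [|o IH].
  - cbn [u upd ax]. now rewrite cdg0.
  - set (n := S o) in *. cbn [u upd ax]. subst n. rewrite cdgS by lia.
    rewrite IH, bx_at by lia. destruct (Nat.eq_dec o j0) as [->|ne].
    + rewrite Nat.ltb_irrefl. decide_true (j0 <? S j0).
      now destruct (EX _).
    + rewrite hj by lia. simpl. destruct (Nat.ltb_spec j0 o), (Nat.ltb_spec j0 (S o)); auto; lia.
Qed.

Definition uniq (e : nat -> bool) : Prop := exists j0, j0 < b /\ forall j, j < b -> e j = (j =? j0).

Lemma accb_form e j0 k : k <= b -> (forall j, j < b -> e j = (j =? j0)) -> accb e k = (j0 <? k).
Proof.
  intros hk he. induction k as [|k IH]; simpl; auto.
  rewrite IH, he by lia.
  destruct (Nat.eqb_spec k j0), (Nat.ltb_spec j0 k), (Nat.ltb_spec j0 (S k)); auto; lia.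
Qed.

(** The first condition, tested at every arrival, excludes a second marker. The item of address
    [b - 1] is never collected, so the final test asks that exactly one of it and the collected
    value be true. *)
Lemma uniq_iff e :
  ((forall k, S k < b -> e k && accb e k = false) /\ eqb (e (b - 1)) (accb e (b - 1)) = false) <-> uniq e.
Proof.
  pose proof b_pos as hb0. split.
  - intros [h1 h2].
    assert (C : forall n, n <= b - 1 -> (accb e n = false /\ forall j, j < n -> e j = false) \/
      (accb e n = true /\ exists j0, j0 < n /\ forall j, j < n -> e j = (j =? j0))).
    { induction n as [|n IH]; intros hn.
      - left; split; auto; intros; lia.
      - specialize (h1 n ltac:(lia)).
        destruct IH as [[i1 i2]|[i1 (j0 & i2 & i3)]]; [lia| |]; simpl; rewrite i1 in *.
        + destruct (e n) eqn:En.
          * right; split; auto. exists n; split; [lia|]. intros j hj.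
            destruct (Nat.eqb_spec j n) as [->|]; auto. apply i2; lia.
          * left; split; auto. intros j hj. destruct (Nat.eq_dec j n) as [->|]; auto. apply i2; lia.
        + rewrite andb_true_r in h1. right; split; [now rewrite h1|].
          exists j0; split; [lia|]. intros j hj. destruct (Nat.eq_dec j n) as [->|]; [|apply i3; lia].
          rewrite h1. symmetry; apply Nat.eqb_neq; lia. }
    destruct (C (b - 1)) as [[i1 i2]|[i1 (j0 & i2 & i3)]]; [lia| |]; rewrite i1 in h2.
    + exists (b - 1); split; [lia|]. intros j hj.
      destruct (Nat.eqb_spec j (b - 1)) as [->|]; [now destruct (e (b - 1))|apply i2; lia].
    + exists j0; split; [lia|]. intros j hj.
      destruct (Nat.eq_dec j (b - 1)) as [->|]; [|apply i3; lia].
      destruct (e (b - 1)); [discriminate|]. symmetry; apply Nat.eqb_neq; lia.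
  - intros (j0 & h0 & he). split.
    + intros k hk. rewrite he, (fun k hk => @accb_form e j0 k hk he) by lia.
      destruct (Nat.eqb_spec k j0), (Nat.ltb_spec j0 k); auto; lia.
    + rewrite he, (fun k hk => @accb_form e j0 k hk he) by lia.
      destruct (Nat.eqb_spec (b - 1) j0), (Nat.ltb_spec j0 (b - 1)); auto; lia.
Qed.

Lemma hit_at o i : o < b -> hit (clat o i) (u o i) = vx0 (u0 i) && vw0 (u0 (i + zn o)%Z).
Proof.
  intros h. unfold hit. rewrite x0_all. destruct o as [|o].
  - rewrite cdg0, Z.add_0_r. reflexivity.
  - rewrite cdgS by lia. change (S o) with (0 * b + S o) at 1. now rewrite vsh_at by lia.
Qed.

Definition EA (o : nat) (i : Z) : act :=
  if vx0 (u0 i) && vw0 (u0 (i + zn o)%Z) then cac (clat o i) else act0.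

Lemma EA_at o i : o < b -> (if hit (clat o i) (u o i) then cac (clat o i) else act0) = EA o i.
Proof. intros h. now rewrite hit_at. Qed.

Section SingleAct.
Variables (i : Z) (y0 o0 : nat) (A : act).
Hypothesis hyo : y0 + o0 < b.
Hypothesis hEA : forall y o, y + o < b ->
  EA o (i + zn y)%Z = if (y =? y0) && (o =? o0) then A else act0.

(** An instruction put on the bus at address [y0] at time [o0] moves left once per step, so the sum
    of its address and its time stays [y0 + o0 + 1]. Deposits with [y + o >= b] cannot reach address
    0 within the phase, which is why nothing is assumed about them. *)
Lemma ba_at o y : y + S o <= b ->
  ba (u (S o) (i + zn y)%Z) = if (y <=? y0) && (y + S o =? y0 + o0 + 1) then A else act0.
Proof.
  revert y. induction o as [|o IH]; intros y h.
  - cbn [u upd ba]. rewrite cdg0, orA_0_l.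
    change (u0 (i + zn y)%Z) with (u 0 (i + zn y)%Z). rewrite EA_at, hEA by lia.
    destruct (Nat.eqb_spec y y0), (Nat.eqb_spec 0 o0), (Nat.leb_spec y y0), (Nat.eqb_spec (y + 1) (y0 + o0 + 1));
      simpl; auto; lia.
  - set (n := S o) in *. cbn [u upd ba]. subst n. rewrite EA_at, cdgS, hEA by lia.
    replace (i + zn y + 1)%Z with (i + zn (S y))%Z by lia. rewrite IH by lia.
    destruct (Nat.leb_spec (S y) y0), (Nat.eqb_spec (S y + S o) (y0 + o0 + 1)),
      (Nat.eqb_spec y y0), (Nat.eqb_spec (S o) o0), (Nat.leb_spec y y0), (Nat.eqb_spec (y + S (S o)) (y0 + o0 + 1));
      simpl; auto using orA_0_l, orA_0_r; try lia.
Qed.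

Lemma aa_at o : S o <= b -> aa (u (S o) i) = if y0 + o0 + 1 <=? o then A else act0.
Proof.
  induction o as [|o IH]; intros h.
  - cbn [u upd aa]. rewrite cdg0. destruct (Nat.leb_spec (y0 + o0 + 1) 0); auto; lia.
  - set (n := S o) in *. cbn [u upd aa]. subst n. rewrite cdgS, IH by lia.
    replace i with (i + zn 0)%Z at 1 by lia. rewrite ba_at by lia.
    change (0 <=? y0) with true. rewrite Nat.add_0_l.
    destruct (Nat.leb_spec (y0 + o0 + 1) o),
      (Nat.eqb_spec (S o) (y0 + o0 + 1)), (Nat.leb_spec (y0 + o0 + 1) (S o));
      simpl; auto using orA_0_l, orA_0_r; try lia.
Qed.

Lemma act_total : orA (aa (u b i)) (ba (u b i)) = A.
Proof.
  pose proof b_pos. replace b with (S (b - 1)) by lia. rewrite aa_at by lia.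
  replace i with (i + zn 0)%Z at 1 by lia. rewrite ba_at by lia.
  change (0 <=? y0) with true. rewrite Nat.add_0_l.
  destruct (Nat.leb_spec (y0 + o0 + 1) (b - 1)), (Nat.eqb_spec (S (b - 1)) (y0 + o0 + 1));
    simpl; auto using orA_0_l, orA_0_r; lia.
Qed.
End SingleAct.

Lemma vas_at i : vas (u b i) = step s (gam (i mod B)%Z).
Proof.
  assert (E : forall o, S o <= b -> vas (u (S o) i) = step s (gam (i mod B)%Z)).
  { induction o as [|o IH]; intros h.
    - cbn [u upd vas]. now rewrite cdg0.
    - set (n := S o) in *. cbn [u upd vas]. subst n. rewrite cdgS, IH by lia. reflexivity. }
  pose proof b_pos. specialize (E (b - 1)). replace (S (b - 1)) with b in E by lia. apply E; lia.
Qed.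

(** * Phase [P1]: the marker of the simulated class *)

Definition codeJ (J : Z) : option nat := option_map encC (newcls (u b (J * B)%Z)).

Lemma codeJ_lt J c : codeJ J = Some c -> c < Q.
Proof. unfold codeJ. destruct (newcls _); intros E; inversion E. apply HC. Qed.

Lemma Q_lt : Q + 2 < b.
Proof. pose proof K_lt_b. lia. Qed.

(** After [j + 1] steps the countdown of a block sits at address [j] with [c - j] left. As
    [c < Q < b] it expires inside its own block and never disturbs the next one. *)
Lemma vcd_at j J y : j < b -> y < b ->
  vcd (u (S (1 * b + j)) (J * B + zn y)%Z) =
  match codeJ J with
  | Some c => if (y =? j) && (j <=? c) then Some (fmk Q (c - j)) else None
  | None => None
  end.
Proof.
  pose proof Q_lt as hQ. revert J y. induction j as [|j IH]; intros J y hj hy.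
  - cbn [u upd vcd]. rewrite eph_at, cdg_at by lia. simpl phase_of. cbn [isP1 ph_eqb andb Nat.eqb].
    rewrite cz_at, modB by lia. unfold codeJ. rewrite Nat.add_0_r, Nat.mul_1_l.
    destruct y as [|y].
    + rewrite Z.add_0_r. simpl. destruct (newcls _); simpl; now rewrite ?Nat.sub_0_r.
    + decide_false (zn (S y) =? 0)%Z.
      simpl. now destruct (newcls _).
  - rewrite Nat.add_succ_r. set (n := S (1 * b + j)) in *. cbn [u upd vcd]. subst n.
    rewrite <- Nat.add_succ_r, eph_at, cdg_at by lia. simpl phase_of. cbn [isP1 ph_eqb andb Nat.eqb].
    rewrite Nat.add_succ_r.
    destruct y as [|y].
    + replace (J * B + zn 0 - 1)%Z with ((J - 1) * B + zn (b - 1))%Z by lia.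
      rewrite IH by lia. simpl.
      destruct (codeJ (J - 1)) as [c|] eqn:Ec; [|now destruct (codeJ J)].
      pose proof (codeJ_lt _ Ec).
      destruct (Nat.eqb_spec (b - 1) j); [|now destruct (codeJ J)].
      destruct (Nat.leb_spec j c); [lia|now destruct (codeJ J)].
    + replace (J * B + zn (S y) - 1)%Z with (J * B + zn y)%Z by lia.
      rewrite IH by lia. destruct (codeJ J) as [c|] eqn:Ec; auto.
      pose proof (codeJ_lt _ Ec).
      simpl Nat.eqb. destruct (Nat.eqb_spec y j) as [->|]; simpl; auto.
      destruct (Nat.leb_spec j c).
      * rewrite fval_fmk by lia. destruct (c - j) eqn:E.
        -- destruct c; auto. destruct (Nat.leb_spec j c); auto; lia.
        -- destruct c; [lia|]. destruct (Nat.leb_spec j c); [|lia]. do 2 f_equal. lia.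
      * destruct c; auto. destruct (Nat.leb_spec j c); auto; lia.
Qed.

Lemma vuc_at j J y : j < b -> y < b ->
  vuc (u (S (1 * b + j)) (J * B + zn y)%Z) =
  match codeJ J with Some c => (y =? c) && (c <? j) | None => false end.
Proof.
  pose proof Q_lt as hQ. revert J y. induction j as [|j IH]; intros J y hj hy.
  - cbn [u upd vuc]. rewrite eph_at, cdg_at by lia. simpl.
    destruct (codeJ J); auto. now rewrite andb_false_r.
  - rewrite Nat.add_succ_r. set (n := S (1 * b + j)) in *. cbn [u upd vuc]. subst n.
    rewrite <- Nat.add_succ_r, eph_at, cdg_at by lia. simpl phase_of. cbn [isP1 ph_eqb andb Nat.eqb].
    rewrite Nat.add_succ_r, IH, vcd_at by lia. destruct (codeJ J) as [c|] eqn:Ec; auto.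
    pose proof (codeJ_lt _ Ec).
    destruct (Nat.eqb_spec y c) as [->|]; simpl.
    + destruct (Nat.eqb_spec c j) as [->|]; simpl.
      * rewrite Nat.leb_refl, Nat.sub_diag, fval_fmk, Nat.ltb_irrefl by lia. simpl.
        symmetry; apply Nat.ltb_lt; lia.
      * destruct (Nat.ltb_spec c j), (Nat.ltb_spec c (S j)); auto; lia.
    + destruct (Nat.eqb_spec y j) as [->|]; simpl; auto. destruct (Nat.leb_spec j c); auto.
      rewrite fval_fmk by lia. apply Nat.eqb_neq; lia.
Qed.

Lemma vuc_2b J y : y < b ->
  vuc (u (2 * b) (J * B + zn y)%Z) = match codeJ J with Some c => y =? c | None => false end.
Proof.
  intros hy. pose proof Q_lt. replace (2 * b) with (S (1 * b + (b - 1))) by lia.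
  rewrite vuc_at by lia. destruct (codeJ J) as [c|] eqn:Ec; auto.
  pose proof (codeJ_lt _ Ec).
  destruct (Nat.ltb_spec c (b - 1)); [apply andb_true_r|lia].
Qed.

(** * Phase [P2]: matching the columns and writing the new payload *)

Ltac shift2 f := cbn [u upd f]; rewrite cdg_at, ?Nat.add_0_r by lia; reflexivity.
Ltac shift3 f :=
  let o := fresh in let i := fresh in let ho := fresh in intros o i ho; cbn [u upd f];
  rewrite cdg_at by lia; destruct o; [lia|]; reflexivity.

Lemma sl_at o i : 1 <= o <= b -> sl (u (2 * b + o) i) = vv (u0 (i - zn o - B)%Z).
Proof.
  intros h. pose proof b_pos. rewrite <- tr_at by lia. replace (1 * b + b) with (2 * b) by lia.
  apply (shiftR (@sl _ _ _) (@tr _ _ _)); auto; [intros; shift2 sl|shift3 sl].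
Qed.

Lemma sc_at o i : 1 <= o <= b -> sc (u (2 * b + o) i) = vv (u0 (i - zn o)%Z).
Proof.
  intros h. pose proof b_pos. rewrite <- (@vv_early (2 * b)) by lia.
  apply (shiftR (@sc _ _ _) (@vv _ _ _)); auto; [intros; shift2 sc|shift3 sc].
Qed.

Lemma sr_at o i : 1 <= o <= b -> sr (u (2 * b + o) i) = vv (u0 (i - zn o + B)%Z).
Proof.
  intros h. pose proof b_pos. rewrite <- tv_at by lia. replace (1 * b + b) with (2 * b) by lia.
  apply (shiftR (@sr _ _ _) (@tv _ _ _)); auto; [intros; shift2 sr|shift3 sr].
Qed.

Lemma sk_at o i : 1 <= o <= b -> sk (u (2 * b + o) i) = vuc (u (2 * b) (i - zn o)%Z).
Proof.
  intros h. pose proof b_pos.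
  apply (shiftR (@sk _ _ _) (@vuc _ _ _)); auto; [intros; shift2 sk|shift3 sk].
Qed.

Definition UC (J : Z) (y : nat) : bool := vuc (u (2 * b) (J * B + zn y)%Z).
Definition UV (J : Z) (y : nat) : bool := vv (u0 (J * B + zn y)%Z).

Lemma tab_cmp I o : I < NI ->
  ck (tab (Kp + I) o) = (o =? Kp + I - iC I) /\ cl (tab (Kp + I) o) = (o =? Kp + I - iL I) /\
  cc (tab (Kp + I) o) = (o =? Kp + I - iM I) /\ cr (tab (Kp + I) o) = (o =? Kp + I - iR I).
Proof.
  intros h. unfold tab; simpl. replace (Kp + I - Kp) with I by lia.
  replace ((Kp <=? Kp + I) && (Kp + I <? XM)) with true; [repeat split|].
  symmetry; rewrite andb_true_iff, Nat.leb_le, Nat.ltb_lt; unfold XM; lia.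
Qed.

(** A marker that leaves address [d] at the start of the phase passes address [Kp + I] at time
    [Kp + I - d], the only time at which the column compares it. Each of the four inputs therefore
    contributes one factor, at its own time. *)
Lemma mt_at o J I : 1 <= o <= b -> I < NI ->
  mt (u (2 * b + o) (J * B + zn (Kp + I))%Z) =
  implb (Kp + I - iC I <? o) (UC J (iC I)) && implb (Kp + I - iL I <? o) (UV (J - 1) (iL I))
  && implb (Kp + I - iM I <? o) (UV J (iM I)) && implb (Kp + I - iR I <? o) (UV (J + 1) (iR I)).
Proof.
  intros ho hI. pose proof K_lt_b as hK. destruct (iLMR_lt hI) as (hl & hm & hr & hc).
  assert (hx : Kp + I < XM) by (unfold XM; lia).
  induction o as [|o IH]; [lia|].
  rewrite Nat.add_succ_r. cbn [u upd mt]. rewrite cdg_at by lia.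
  destruct (Nat.eqb_spec o 0) as [->|ne].
  { simpl. rewrite !(proj2 (Nat.ltb_ge _ _)) by lia. reflexivity. }
  rewrite IH, cac_at by lia. destruct (tab_cmp o hI) as (-> & -> & -> & ->).
  rewrite sl_at, sc_at, sr_at, sk_at by lia.
  assert (E : forall d x x', d < Kp -> (o = Kp + I - d -> x = x') ->
    implb (Kp + I - d <? S o) x' = implb (Kp + I - d <? o) x' && implb (o =? Kp + I - d) x).
  { intros d x x' hd hx'. destruct (Nat.ltb_spec (Kp + I - d) (S o)), (Nat.ltb_spec (Kp + I - d) o),
      (Nat.eqb_spec o (Kp + I - d)); simpl; rewrite ?andb_true_r; try lia; auto.
    symmetry; auto. }
  rewrite (E (iC I) (vuc (u (2 * b) (J * B + zn (Kp + I) - zn o)%Z)) (UC J (iC I))); [|lia|].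
  2:{ intros h. unfold UC. do 2 f_equal. lia. }
  rewrite (E (iL I) (vv (u0 (J * B + zn (Kp + I) - zn o - B)%Z)) (UV (J - 1) (iL I))); [|lia|].
  2:{ intros h. unfold UV. do 2 f_equal. lia. }
  rewrite (E (iM I) (vv (u0 (J * B + zn (Kp + I) - zn o)%Z)) (UV J (iM I))); [|lia|].
  2:{ intros h. unfold UV. do 2 f_equal. lia. }
  rewrite (E (iR I) (vv (u0 (J * B + zn (Kp + I) - zn o + B)%Z)) (UV (J + 1) (iR I))); [|lia|].
  2:{ intros h. unfold UV. do 2 f_equal. lia. }
  rewrite <- !andb_assoc.
  repeat match goal with |- context[implb ?a ?c] => generalize (implb a c); intro end.
  repeat match goal with x : bool |- _ => destruct x end; reflexivity.
Qed.

Definition matches (J : Z) (I : nat) : bool :=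
  UC J (iC I) && UV (J - 1) (iL I) && UV J (iM I) && UV (J + 1) (iR I).

Lemma mt_final o J I : Kp + I < o <= b -> I < NI ->
  mt (u (2 * b + o) (J * B + zn (Kp + I))%Z) = matches J I.
Proof.
  intros ho hI. rewrite mt_at by lia. rewrite !(proj2 (Nat.ltb_lt _ _)) by lia. reflexivity.
Qed.

Definition EM (o : nat) (i : Z) : bool :=
  em (cac (clat (2 * b + o) i)) && mt (u (2 * b + o) i).

Lemma vg_at o i : 1 <= o <= b ->
  vg (u (2 * b + o) i) = true <-> exists o', 1 <= o' < o /\ EM o' (i + zn (o - 1 - o'))%Z = true.
Proof.
  revert i. induction o as [|o IH]; intros i h; [lia|].
  rewrite Nat.add_succ_r. cbn [u upd vg]. rewrite cdg_at by lia.
  destruct (Nat.eqb_spec o 0) as [->|ne].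
  { split; [discriminate|]. intros (o' & ? & _); lia. }
  fold (EM o i). rewrite orb_true_iff, IH by lia. split.
  - intros [(o' & h1 & h2)|h2].
    + exists o'; split; [lia|]. rewrite <- h2. f_equal. lia.
    + exists o; split; [lia|]. rewrite <- h2. f_equal. lia.
  - intros (o' & h1 & h2). destruct (Nat.eq_dec o' o) as [->|].
    + right. rewrite <- h2. f_equal. lia.
    + left. exists o'; split; [lia|]. rewrite <- h2. f_equal. lia.
Qed.

Lemma divB i : exists J y, i = (J * B + zn y)%Z /\ y < b.
Proof.
  pose proof b_pos. exists (i / B)%Z, (Z.to_nat (i mod B)).
  pose proof (Z.mod_pos_bound i B). rewrite Z2Nat.id by lia. split; [|lia].
  rewrite (Z.div_mod i B) at 1; lia.
Qed.

Lemma EM_true o J y : o < b -> y < b ->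
  EM o (J * B + zn y)%Z = true <->
  exists I v, y = Kp + I /\ I < NI /\ phiI I = Some v /\ o = TA - 1 - y + encV v /\ matches J I = true.
Proof.
  intros ho hy. pose proof K_lt_b as hK. unfold EM. rewrite cac_at, andb_true_iff by lia.
  unfold tab; cbn [em]. rewrite andb_true_iff, andb_true_iff, Nat.leb_le, Nat.ltb_lt. split.
  - intros [[[h1 h2] h3] h4]. exists (y - Kp). destruct (phiI (y - Kp)) as [v|]; [|discriminate].
    apply Nat.eqb_eq in h3. exists v. unfold XM in *. repeat split; try lia.
    replace y with (Kp + (y - Kp)) in h4 by lia. rewrite mt_final in h4; auto; lia.
  - intros (I & v & -> & h1 & h2 & h3 & h4). replace (Kp + I - Kp) with I by lia.
    rewrite h2, h3, Nat.eqb_refl. unfold XM in *. repeat split; try lia.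
    rewrite <- h3, mt_final; auto. lia.
Qed.

(** Column [y] emits for the result [v] at time [TA - 1 - y + encV v]; moving left, the signal is at
    address [encV v] at time [TA], whatever the column. Since [encV v] and [x] are both below [b], a
    signal found at [x] at that time comes from the same block. *)
Lemma vg_TA J x : x < b ->
  vg (u (2 * b + TA) (J * B + zn x)%Z) = true <->
  exists I v, I < NI /\ phiI I = Some v /\ x = encV v /\ matches J I = true.
Proof.
  intros hx. pose proof K_lt_b as hK. rewrite vg_at by lia. split.
  - intros (o' & h1 & h2).
    destruct (divB (J * B + zn x + zn (TA - 1 - o'))) as (J' & y & e & hy).
    rewrite e in h2. apply EM_true in h2; [|lia|lia].
    destruct h2 as (I & v & -> & h3 & h4 & -> & h5).
    destruct (HV v) as [hv _]. unfold XM in hK.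
    assert (J = J') by nia. subst J'. exists I, v; repeat split; auto. lia.
  - intros (I & v & h1 & h2 & -> & h3). destruct (HV v) as [hv _]. unfold XM in hK.
    exists (TA - 1 - (Kp + I) + encV v). split; [lia|].
    replace (J * B + zn (encV v) + zn (TA - 1 - (TA - 1 - (Kp + I) + encV v)))%Z
      with (J * B + zn (Kp + I))%Z by lia.
    apply EM_true; [lia|lia|]. exists I, v; auto.
Qed.

Lemma vv_end J x : x < K -> vv (u (3 * b) (J * B + zn x)%Z) = vg (u (2 * b + TA) (J * B + zn x)%Z).
Proof.
  intros hx. pose proof K_lt_b as hK.
  assert (E : forall o, TA < o <= b -> vv (u (2 * b + o) (J * B + zn x)%Z) = vg (u (2 * b + TA) (J * B + zn x)%Z)).
  { induction o as [|o IH]; intros h; [lia|].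
    rewrite Nat.add_succ_r. cbn [u upd vv]. rewrite eph_at, cac_at by lia.
    simpl phase_of. unfold tab; cbn [isP2 ph_eqb sto andb].
    decide_true (x <? K). simpl.
    destruct (Nat.eqb_spec o TA) as [->|]; auto. apply IH; lia. }
  replace (3 * b) with (2 * b + b) by lia. apply E. lia.
Qed.

Lemma w_end i : vw0 (u (3 * b) i) = vw0 (u0 (i + B)%Z) /\ vw1 (u (3 * b) i) = vw1 (u0 (i + B)%Z).
Proof.
  pose proof b_pos.
  assert (E : forall o, 1 <= o <= b -> vw0 (u (2 * b + o) i) = vw0 (u0 (i + B)%Z) /\
    vw1 (u (2 * b + o) i) = vw1 (u0 (i + B)%Z)).
  { induction o as [|o IH]; intros h; [lia|].
    rewrite Nat.add_succ_r. cbn [u upd vw0 vw1]. rewrite eph_at, cdg_at by lia. simpl phase_of.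
    cbn [isP2 ph_eqb andb]. destruct (Nat.eqb_spec o 0) as [->|]; [|apply IH; lia].
    rewrite Nat.add_0_r. replace (2 * b) with (1 * b + b) by lia. now rewrite tw0_at, tw1_at by lia. }
  replace (3 * b) with (2 * b + b) by lia. apply E. lia.
Qed.

(** * Rows that survive a macro step *)

Definition killat (t : nat) (i : Z) : bool :=
  kill (clat t i) (u t (i - 1)%Z) (u t i) (u t (i + 1)%Z).

Definition nokill : Prop := forall t i, t < 3 * b -> killat t i = false.

Lemma ph_eqb_refl p : ph_eqb p p = true. Proof. now destruct p. Qed.

Lemma killat_eq p o i : p < 3 -> o < b -> killat (p * b + o) i =
  let t := p * b + o in
  hlt s
  || ph_eqb (phase_of p) P0 && (o =? 0)
     && (vx0 (u t i) && vx1 (u t i) || vw0 (u t i) && vw1 (u t i))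
  || ph_eqb (phase_of p) P0 && negb (o =? 0) && (i mod B =? 0)%Z
     && (isSome (bx (u t i)) && isSome (ax (u t i)) || bw (u t i) && aw (u t i) || bv (u t i) && av (u t i))
  || isP1 (phase_of p) && (o =? 0) && (i mod B =? 0)%Z
     && (eqb (isSome (bx (u t i))) (isSome (ax (u t i))) || eqb (bw (u t i)) (aw (u t i))
         || eqb (bv (u t i)) (av (u t i)))
  || isP2 (phase_of p) && (o =? 0)
     && negb (if (i mod B =? B - 1)%Z
              then eqb (vx0 (u t (i + 1)%Z)) (vx1 (u t i)) && eqb (vx1 (u t (i + 1)%Z)) (vx0 (u t i))
                   && eqb (vw0 (u t (i + 1)%Z)) (vw1 (u t i)) && eqb (vw1 (u t (i + 1)%Z)) (vw0 (u t i))
              else eqb (tx0 (u t (i + 1)%Z)) (vx0 (u t i)) && eqb (tx1 (u t (i + 1)%Z)) (vx1 (u t i))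
                   && eqb (tw0 (u t (i + 1)%Z)) (vw0 (u t i)) && eqb (tw1 (u t (i + 1)%Z)) (vw1 (u t i)))
  || isP2 (phase_of p) && negb (o =? 0) && kl (cac (clat t i)) && mt (u t i).
Proof.
  intros hp ho. unfold killat, kill. rewrite eph_at, cdg_at by auto.
  rewrite (vph_all _ (i + 1)%Z i), ph_eqb_refl. simpl negb. rewrite orb_false_r. reflexivity.
Qed.

Definition check (i : Z) : bool :=
  if (i mod B =? B - 1)%Z
  then eqb (vx0 (u0 (i + 1)%Z)) (vx1 (u0 i)) && eqb (vx1 (u0 (i + 1)%Z)) (vx0 (u0 i))
       && eqb (vw0 (u0 (i + 1)%Z)) (vw1 (u0 i)) && eqb (vw1 (u0 (i + 1)%Z)) (vw0 (u0 i))
  else eqb (vx0 (u0 (i + 1 + B)%Z)) (vx0 (u0 i)) && eqb (vx1 (u0 (i + 1 + B)%Z)) (vx1 (u0 i))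
       && eqb (vw0 (u0 (i + 1 + B)%Z)) (vw0 (u0 i)) && eqb (vw1 (u0 (i + 1 + B)%Z)) (vw1 (u0 i)).

Lemma isSome_EX i : isSome (EX i) = vx0 (u0 i) || vx1 (u0 i).
Proof. unfold EX, emX. destruct (vx0 (u0 i)), (vx1 (u0 i)); reflexivity. Qed.

Definition BX (i : Z) : bool := vx0 (u0 i) || vx1 (u0 i).

Lemma accb_ext e f k : (forall j, e j = f j) -> accb e k = accb f k.
Proof. intros h. induction k; simpl; congruence. Qed.

Lemma count_at o i : o < b ->
  isSome (bx (u (S o) i)) = BX (i + zn o)%Z /\ isSome (ax (u (S o) i)) = accb (fun j => BX (i + zn j)%Z) o /\
  bw (u (S o) i) = BW (i + zn o)%Z /\ aw (u (S o) i) = accb (fun j => BW (i + zn j)%Z) o /\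
  bv (u (S o) i) = BV (i + zn o)%Z /\ av (u (S o) i) = accb (fun j => BV (i + zn j)%Z) o.
Proof.
  intros h. rewrite bx_at, ax_at, bw_at, aw_at, bv_at, av_at, isSome_EX by auto. repeat split.
  apply accb_ext. intros. apply isSome_EX.
Qed.

Definition wellmarked : Prop :=
  (forall i, vx0 (u0 i) && vx1 (u0 i) || vw0 (u0 i) && vw1 (u0 i) = false) /\
  forall J, uniq (fun j => BX (J * B + zn j)%Z) /\ uniq (fun j => BW (J * B + zn j)%Z) /\
            uniq (fun j => BV (J * B + zn j)%Z).

Lemma modB0 J : ((J * B) mod B = 0)%Z.
Proof. pose proof b_pos. apply Z.mod_mul; lia. Qed.

(** Each fault is visible at a definite time: overlapping rails at time 0, repeated markers during
    [P0], missing ones at time [b], wrong neighbours at time [2 * b], and a forbidden match of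
    column [Kp + I] at step [S (Kp + I)] of [P2], the first at which the match is final. *)
Lemma nokill_iff : nokill <->
  hlt s = false /\ wellmarked /\ (forall i, check i = true) /\
  (forall J I, I < NI -> phiI I = None -> matches J I = false).
Proof.
  pose proof b_pos as hb0. pose proof K_lt_b as hK. split.
  - intros h. assert (h' : forall p o i, p < 3 -> o < b -> killat (p * b + o) i = false) by (intros; apply h; nia).
    clear h. split; [|split; [split|split]].
    + specialize (h' 0 0 0%Z ltac:(lia) ltac:(lia)). rewrite killat_eq in h' by lia.
      destruct (hlt s); [discriminate|auto].
    + intros i. specialize (h' 0 0 i ltac:(lia) ltac:(lia)). rewrite killat_eq in h' by lia.
      cbv zeta in h'. simpl phase_of in h'. cbn [ph_eqb andb isP1 isP2 Nat.eqb negb orb Nat.mul Nat.add u] in h'.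
      rewrite !orb_false_r, orb_false_iff in h'. apply h'.
    + intros J.
      assert (h1 : forall k, S k < b ->
        BX (J * B + zn k)%Z && accb (fun j => BX (J * B + zn j)%Z) k
        || BW (J * B + zn k)%Z && accb (fun j => BW (J * B + zn j)%Z) k
        || BV (J * B + zn k)%Z && accb (fun j => BV (J * B + zn j)%Z) k = false).
      { intros k hk. specialize (h' 0 (S k) (J * B)%Z ltac:(lia) ltac:(lia)).
        rewrite killat_eq, modB0 in h' by lia. cbv zeta in h'. change (0 * b + S k) with (S k) in h'.
        destruct (@count_at k (J * B)%Z) as (e1 & e2 & e3 & e4 & e5 & e6); [lia|].
        rewrite e1, e2, e3, e4, e5, e6 in h'.
        simpl phase_of in h'. cbn [ph_eqb andb isP1 isP2 Nat.eqb negb orb Z.eqb] in h'.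
        rewrite !orb_false_r, orb_false_iff in h'. apply h'. }
      assert (h2 : eqb (BX (J * B + zn (b - 1))%Z) (accb (fun j => BX (J * B + zn j)%Z) (b - 1))
        || eqb (BW (J * B + zn (b - 1))%Z) (accb (fun j => BW (J * B + zn j)%Z) (b - 1))
        || eqb (BV (J * B + zn (b - 1))%Z) (accb (fun j => BV (J * B + zn j)%Z) (b - 1)) = false).
      { specialize (h' 1 0 (J * B)%Z ltac:(lia) ltac:(lia)).
        rewrite killat_eq, modB0 in h' by lia. cbv zeta in h'.
        destruct (@count_at (b - 1) (J * B)%Z) as (e1 & e2 & e3 & e4 & e5 & e6); [lia|].
        replace (1 * b + 0) with (S (b - 1)) in h' by lia.
        rewrite e1, e2, e3, e4, e5, e6 in h'.
        simpl phase_of in h'. cbn [ph_eqb andb isP1 isP2 Nat.eqb negb orb Z.eqb] in h'.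
        rewrite !orb_false_r, orb_false_iff in h'. apply h'. }
      rewrite !orb_false_iff in h2. destruct h2 as [[h2 h3] h4].
      repeat split; apply uniq_iff; (split; [|assumption]); intros k hk; specialize (h1 k hk);
        rewrite !orb_false_iff in h1; apply h1.
    + intros i. specialize (h' 2 0 i ltac:(lia) ltac:(lia)). rewrite killat_eq in h' by lia.
      cbv zeta in h'. replace (2 * b + 0) with (1 * b + b) in h' by lia.
      rewrite tx0_at, tx1_at, tw0_at, tw1_at, !x0_all, !x1_all, !w0_early, !w1_early in h' by lia.
      simpl phase_of in h'. cbn [ph_eqb andb isP1 isP2 Nat.eqb negb orb] in h'.
      rewrite !orb_false_r, orb_false_iff in h'. apply negb_false_iff, h'.
    + intros J I hI hn. assert (hx : Kp + I < XM) by (unfold XM; lia).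
      specialize (h' 2 (S (Kp + I)) (J * B + zn (Kp + I))%Z ltac:(lia) ltac:(lia)).
      rewrite killat_eq in h' by lia. cbv zeta in h'.
      rewrite mt_final, cac_at in h' by lia.
      simpl phase_of in h'. cbn [ph_eqb andb isP1 isP2 Nat.eqb negb orb] in h'.
      unfold tab in h'; cbn [kl] in h'. replace (Kp + I - Kp) with I in h' by lia.
      rewrite hn, Nat.eqb_refl in h'.
      replace ((Kp <=? Kp + I) && (Kp + I <? XM)) with true in h'
        by (symmetry; rewrite andb_true_iff, Nat.leb_le, Nat.ltb_lt; lia).
      simpl in h'. rewrite !orb_false_iff in h'. apply h'.
  - intros (hh & (hm & hu) & hc & hp) t i ht. destruct (tb t) as (p & o & -> & ho).
    assert (p < 3) by nia. rewrite killat_eq by lia. cbv zeta. rewrite hh, orb_false_l.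
    destruct (divB i) as (J & y & hi & hy).
    destruct p as [|[|[|]]]; [| | |lia]; simpl phase_of; cbn [ph_eqb isP1 isP2];
      rewrite ?andb_false_l, ?orb_false_l, ?orb_false_r, ?andb_true_l.
    + destruct o as [|k].
      * cbn [Nat.mul Nat.add u Nat.eqb negb]. rewrite hm. reflexivity.
      * cbn [Nat.eqb negb]. rewrite ?andb_false_l, ?orb_false_l, ?andb_true_l.
        destruct (Z.eqb_spec (i mod B) 0) as [e|]; [|reflexivity].
        rewrite hi, modB in e by lia. assert (y = 0) by lia. subst y. rewrite Z.add_0_r in hi. subst i.
        change (0 * b + S k) with (S k).
        destruct (@count_at k (J * B)%Z) as (e1 & e2 & e3 & e4 & e5 & e6); [lia|].
        rewrite e1, e2, e3, e4, e5, e6. destruct (hu J) as (u1 & u2 & u3).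
        apply uniq_iff in u1, u2, u3.
        rewrite (proj1 u1), (proj1 u2), (proj1 u3) by lia. reflexivity.
    + destruct o as [|k]; [|reflexivity]. cbn [Nat.eqb negb]. rewrite ?andb_true_l.
        destruct (Z.eqb_spec (i mod B) 0) as [e|]; [|reflexivity].
        rewrite hi, modB in e by lia. assert (y = 0) by lia. subst y. rewrite Z.add_0_r in hi. subst i.
        replace (1 * b + 0) with (S (b - 1)) by lia.
        destruct (@count_at (b - 1) (J * B)%Z) as (e1 & e2 & e3 & e4 & e5 & e6); [lia|].
        rewrite e1, e2, e3, e4, e5, e6. destruct (hu J) as (u1 & u2 & u3).
        apply uniq_iff in u1, u2, u3.
        rewrite (proj2 u1), (proj2 u2), (proj2 u3) by lia. reflexivity.
    + destruct o as [|k].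
      * cbn [Nat.eqb negb]. rewrite ?andb_false_l, ?orb_false_r, ?andb_true_l.
        replace (2 * b + 0) with (1 * b + b) by lia.
        rewrite tx0_at, tx1_at, tw0_at, tw1_at, !x0_all, !x1_all, !w0_early, !w1_early by lia.
        apply negb_false_iff. exact (hc i).
      * cbn [Nat.eqb negb]. rewrite ?andb_false_l, ?orb_false_l, ?andb_true_l.
        subst i. rewrite cac_at by lia. unfold tab; cbn [kl].
        destruct ((Kp <=? y) && (y <? XM)) eqn:E; [|reflexivity].
        apply andb_true_iff in E as [E1 E2]. apply Nat.leb_le in E1. apply Nat.ltb_lt in E2.
        destruct (phiI (y - Kp)) eqn:Ep; [reflexivity|].
        destruct (Nat.eqb_spec (S k) (S y)) as [e|]; [|reflexivity].
        replace y with (Kp + (y - Kp)) by lia. unfold XM in E2.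
        rewrite mt_final by lia. apply hp; auto; lia.
Qed.

(** * Blocks as cells of the next level *)

Definition marks (n : nat) (x : nat) (f0 f1 : bool) (X : Z) : Prop :=
  f0 = (X =? zn x)%Z /\ f1 = (X =? zn n + zn x)%Z.

(** The payload is given by any [n] with [decV n = a], not by [encV a]: every block with a single
    payload marker must represent something, even if the marked number is not the code of a
    payload. *)
Definition rep1 (v : Z -> V) (J : Z) (z : state) : Prop :=
  match z with (X, W, a) =>
    (forall x, x < b -> marks b x (vx0 (v (J * B + zn x)%Z)) (vx1 (v (J * B + zn x)%Z)) X /\
                        marks b x (vw0 (v (J * B + zn x)%Z)) (vw1 (v (J * B + zn x)%Z)) W) /\
    exists n, n < K /\ decV n = a /\ forall x, x < K -> vv (v (J * B + zn x)%Z) = (x =? n)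
  end.

Definition rep (v : Z -> V) (z : Z -> state) : Prop :=
  forall J, rep1 v J (z J) /\ valid (2 * b) (z J).

Lemma vc_at J x : x < b -> vc (cac (clat 0 (J * B + zn x)%Z)) = (x <? K).
Proof.
  intros h. pose proof b_pos. change 0 with (0 * b + 0). rewrite cac_at by lia.
  unfold tab; cbn [vc]. apply andb_true_r.
Qed.

Lemma wellmarked_rep J : wellmarked -> exists z, rep1 u0 J z /\ valid (2 * b) z.
Proof.
  intros [hm hu]. pose proof K_lt_b as hK. destruct (hu J) as ((x & hx & ex) & (w & hw & ew) & (n & hn & en)).
  assert (M : forall f0 f1 j, j < b -> (forall i, f0 i && f1 i = false) ->
     (forall k, k < b -> f0 (J * B + zn k)%Z || f1 (J * B + zn k)%Z = (k =? j)) ->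
     exists X, (0 <= X < zn (2 * b))%Z /\ forall k, k < b -> marks b k (f0 (J * B + zn k)%Z) (f1 (J * B + zn k)%Z) X).
  { intros f0 f1 j hj hf he. exists (if f0 (J * B + zn j)%Z then zn j else (B + zn j)%Z). split.
    - destruct (f0 _); lia.
    - intros k hk. specialize (he k hk) as hek. specialize (hf (J * B + zn k)%Z). unfold marks.
      destruct (Nat.eqb_spec k j) as [->|ne].
      + destruct (f0 _), (f1 _); try discriminate; split; symmetry;
          rewrite ?Z.eqb_eq, ?Z.eqb_neq; lia.
      + destruct (f0 (J * B + zn k)%Z), (f1 (J * B + zn k)%Z); try discriminate;
          destruct (f0 (J * B + zn j)%Z); split; symmetry; apply Z.eqb_neq; lia. }
  destruct (M (fun i => vx0 (u0 i)) (fun i => vx1 (u0 i)) x) as (X & hX & eX); auto.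
  { intros i. specialize (hm i). apply orb_false_iff in hm. apply hm. }
  destruct (M (fun i => vw0 (u0 i)) (fun i => vw1 (u0 i)) w) as (W & hW & eW); auto.
  { intros i. specialize (hm i). apply orb_false_iff in hm. apply hm. }
  exists (X, W, decV n). split; [|split; auto]. split; [intros k hk; auto|].
  exists n. assert (en0 := en n hn). unfold BV in en0. rewrite vc_at, Nat.eqb_refl in en0 by auto.
  apply andb_true_iff in en0 as [_ en0]. apply Nat.ltb_lt in en0. repeat split; auto.
  intros k hk. specialize (en k ltac:(lia)). unfold BV in en. rewrite vc_at in en by lia.
  rewrite (proj2 (Nat.ltb_lt k K) hk), andb_true_r in en. exact en.
Qed.

Section Rep.
Variable z : Z -> state.
Hypothesis hz : rep u0 z.

Notation s' := (step s (gam 0%Z)).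
Notation gam' := (gnext s gam).
Definition zX (J : Z) := fst (fst (z J)).
Definition zW (J : Z) := snd (fst (z J)).
Definition zV (J : Z) := snd (z J).

Lemma z_eq J : z J = (zX J, zW J, zV J).
Proof. unfold zX, zW, zV. now destruct (z J) as [[? ?] ?]. Qed.

Lemma z_range J : (0 <= zX J < 2 * B /\ 0 <= zW J < 2 * B)%Z.
Proof.
  destruct (hz J) as [_ h]. rewrite z_eq in h. unfold valid in h. lia.
Qed.

Lemma x_at J x : x < b -> vx0 (u0 (J * B + zn x)%Z) = (zX J =? zn x)%Z /\
  vx1 (u0 (J * B + zn x)%Z) = (zX J =? B + zn x)%Z.
Proof. intros h. destruct (hz J) as [h' _]. rewrite z_eq in h'. apply (proj1 h' x h). Qed.

Lemma w_at J x : x < b -> vw0 (u0 (J * B + zn x)%Z) = (zW J =? zn x)%Z /\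
  vw1 (u0 (J * B + zn x)%Z) = (zW J =? B + zn x)%Z.
Proof. intros h. destruct (hz J) as [h' _]. rewrite z_eq in h'. apply (proj1 h' x h). Qed.

Lemma v_at J : exists n, n < K /\ decV n = zV J /\ forall x, x < K -> UV J x = (x =? n).
Proof. destruct (hz J) as [h' _]. rewrite z_eq in h'. apply h'. Qed.

Definition res (X : Z) : nat := Z.to_nat (if (X <? B)%Z then X else X - B)%Z.

Lemma rep_wellmarked : wellmarked.
Proof.
  pose proof K_lt_b as hK. split.
  - intros i. destruct (divB i) as (J & y & -> & hy).
    destruct (x_at J hy) as [-> ->], (w_at J hy) as [-> ->].
    destruct (Z.eqb_spec (zX J) (zn y)), (Z.eqb_spec (zX J) (B + zn y)),
      (Z.eqb_spec (zW J) (zn y)), (Z.eqb_spec (zW J) (B + zn y)); auto; lia.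
  - intros J. destruct (z_range J) as [h1 h2].
    assert (E : forall X k, (0 <= X < 2 * B)%Z -> k < b ->
      (X =? zn k)%Z || (X =? B + zn k)%Z = (k =? res X)).
    { intros X k hX hk. unfold res. destruct (Z.ltb_spec X B);
        destruct (Z.eqb_spec X (zn k)), (Z.eqb_spec X (B + zn k)), (Nat.eqb_spec k (Z.to_nat X)),
          (Nat.eqb_spec k (Z.to_nat (X - B))); simpl; auto; lia. }
    assert (R : forall X, (0 <= X < 2 * B)%Z -> res X < b).
    { intros X hX. unfold res. destruct (Z.ltb_spec X B); lia. }
    split; [|split].
    + exists (res (zX J)); split; [auto|]. intros k hk. unfold BX. destruct (x_at J hk) as [-> ->]. auto.
    + exists (res (zW J)); split; [auto|]. intros k hk. unfold BW. destruct (w_at J hk) as [-> ->]. auto.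
    + destruct (v_at J) as (n & hn & _ & e). exists n; split; [lia|]. intros k hk. unfold BV.
      rewrite vc_at by lia. destruct (Nat.ltb_spec k K).
      * rewrite andb_true_r. apply e; lia.
      * rewrite andb_false_r. symmetry; apply Nat.eqb_neq; lia.
Qed.

Definition cls' (J : Z) : cls St Sy := lcls (2 * b) s' gam' (zX J) (zW J).

Lemma gam'_big X : (B <= X)%Z -> gam' X = blank.
Proof.
  intros h. unfold gnext. pose proof b_pos.
  decide_false (X =? 0)%Z.
  rewrite !hgam by lia. apply hdelta.
Qed.

Lemma EX_at J y : y < b -> EX (J * B + zn y)%Z =
  if (y =? res (zX J)) then
    Some (gam' (zX J), (zX J =? 0)%Z, (zX J =? zn (2 * b) - 1)%Z, (zX J =? zW J)%Z)
  else None.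
Proof.
  intros hy. destruct (z_range J) as [h1 h2]. unfold EX, emX. cbn [u].
  destruct (x_at J hy) as [-> ->], (w_at J hy) as [-> ->].
  rewrite cst_at, cz_at, cL_at, csy_at, !hsy, !modB by lia.
  unfold res. destruct (Z.ltb_spec (zX J) B) as [hl|hl].
  - decide_false (zX J =? B + zn y)%Z.
    destruct (Z.eqb_spec (zX J) (zn y)) as [e|ne].
    + decide_true (y =? Z.to_nat (zX J)).
      rewrite e.
      decide_false (zn y =? zn (2 * b) - 1)%Z.
      replace (zW J =? zn y)%Z with (zn y =? zW J)%Z by apply Z.eqb_sym.
      do 4 f_equal. unfold gnext. f_equal.
      (* At address 0 the left neighbour is the last cell of the previous block. Its symbol is blank
         because the tape is blank already from [B - 1] on, which agrees with the boundary value in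
         [gnext]. *)
      * destruct (Z.eqb_spec (zn y) 0) as [e0|ne0].
        -- replace (J * B + zn y - 1)%Z with ((J - 1) * B + zn (b - 1))%Z by lia.
           rewrite modB by lia. apply hgam; lia.
        -- replace (J * B + zn y - 1)%Z with (J * B + zn (y - 1))%Z by lia.
           rewrite modB by lia. f_equal; lia.
      * destruct (Z.eqb_spec (zn y) (B - 1)) as [e0|ne0].
        -- symmetry; apply hgam; lia.
        -- replace (J * B + zn y + 1)%Z with (J * B + zn (y + 1))%Z by lia.
           rewrite modB by lia. f_equal; lia.
    + decide_false (y =? Z.to_nat (zX J)). reflexivity.
  - decide_false (zX J =? zn y)%Z.
    destruct (Z.eqb_spec (zX J) (B + zn y)) as [e|ne].
    + decide_true (y =? Z.to_nat (zX J - B)).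
      rewrite gam'_big by lia.
      decide_false (zX J =? 0)%Z.
      replace (zn y =? B - 1)%Z with (zX J =? zn (2 * b) - 1)%Z.
      2:{ destruct (Z.eqb_spec (zX J) (zn (2 * b) - 1)), (Z.eqb_spec (zn y) (B - 1)); auto; lia. }
      replace (zW J =? B + zn y)%Z with (zX J =? zW J)%Z.
      2:{ destruct (Z.eqb_spec (zX J) (zW J)), (Z.eqb_spec (zW J) (B + zn y)); auto; lia. }
      reflexivity.
    + decide_false (y =? Z.to_nat (zX J - B)). reflexivity.
Qed.

Lemma act_at J : orA (aa (u b (J * B)%Z)) (ba (u b (J * B)%Z)) = Theta (zX J) (zW J).
Proof.
  pose proof K_lt_b as hK. destruct (z_range J) as [h1 h2].
  assert (EA0 : forall y o, y + o < b -> EA o (J * B + zn y)%Z =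
    if (zX J =? zn y)%Z && (zW J =? zn (y + o))%Z then tab y o else act0).
  { intros y o h. unfold EA. assert (hy : y < b) by lia. destruct (x_at J hy) as [-> _].
    replace (J * B + zn y + zn o)%Z with (J * B + zn (y + o))%Z by lia.
    assert (ho : y + o < b) by lia. destruct (w_at J ho) as [-> _].
    change o with (0 * b + o) at 2. rewrite cac_at by lia. reflexivity. }
  unfold Theta. destruct ((0 <=? zX J) && (zX J <=? zW J) && (zW J <? zn C0))%Z eqn:E.
  - rewrite !andb_true_iff, !Z.leb_le, Z.ltb_lt in E.
    apply act_total with (y0 := Z.to_nat (zX J)) (o0 := Z.to_nat (zW J - zX J)); [lia|].
    intros y o h. rewrite EA0 by lia.
    destruct (Z.eqb_spec (zX J) (zn y)), (Z.eqb_spec (zW J) (zn (y + o))),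
      (Nat.eqb_spec y (Z.to_nat (zX J))), (Nat.eqb_spec o (Z.to_nat (zW J - zX J)));
      simpl; auto; try lia.
  (* Here [Theta] is [act0]. A coincidence within the block can only occur at [y + o >= C0], where
     the table vanishes, so nothing is deposited and the position [0], [0] is a dummy. *)
  - apply act_total with (y0 := 0) (o0 := 0); [lia|].
    intros y o h. rewrite EA0 by lia.
    destruct (Z.eqb_spec (zX J) (zn y)), (Z.eqb_spec (zW J) (zn (y + o))); simpl;
      try (now destruct ((y =? 0) && (o =? 0))).
    rewrite tab_big; [now destruct ((y =? 0) && (o =? 0))|].
    destruct (le_lt_dec C0 (y + o)); auto.
    rewrite !andb_false_iff, !Z.leb_gt, Z.ltb_ge in E. lia.
Qed.

Lemma codeJ_at J : codeJ J = Some (encC (cls' J)).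
Proof.
  pose proof b_pos. destruct (z_range J) as [h1 h2].
  assert (hr : res (zX J) < b) by (unfold res; destruct (Z.ltb_spec (zX J) B); lia).
  unfold codeJ, newcls. rewrite act_at, vas_at, modB0.
  assert (E : orelse (bx (u b (J * B)%Z)) (ax (u b (J * B)%Z)) = EX (J * B + zn (res (zX J)))%Z).
  { assert (e1 : bx (u (S (b - 1)) (J * B)%Z) = EX (J * B + zn (b - 1))%Z) by (apply bx_at; lia).
    assert (e2 : ax (u (S (b - 1)) (J * B)%Z) =
      if res (zX J) <? b - 1 then EX (J * B + zn (res (zX J)))%Z else None).
    { apply ax_val; [lia|]. intros j hj hne. rewrite EX_at by lia.
      now rewrite (proj2 (Nat.eqb_neq _ _) hne). }
    replace (S (b - 1)) with b in e1, e2 by lia. rewrite e1, e2, EX_at by lia. destruct (Nat.eqb_spec (b - 1) (res (zX J))) as [e|ne].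
    - rewrite EX_at, Nat.eqb_refl by lia. reflexivity.
    - decide_true (res (zX J) <? b - 1). reflexivity. }
  rewrite E, EX_at, Nat.eqb_refl by lia. reflexivity.
Qed.

(** The part of the relation between [X] and its successor [Y] modulo [2 * b] that is visible at
    address [y]. From the last address the successor lies at address 0 on the other rail. *)
Definition linked (X Y : Z) (y : nat) : Prop :=
  if (zn y =? B - 1)%Z
  then (Y =? 0)%Z = (X =? B + zn y)%Z /\ (Y =? B + 0)%Z = (X =? zn y)%Z
  else (Y =? zn (y + 1))%Z = (X =? zn y)%Z /\ (Y =? B + zn (y + 1))%Z = (X =? B + zn y)%Z.

Lemma check_iff : (forall i, check i = true) <->
  forall J, zX (J + 1) = succB (2 * b) (zX J) /\ zW (J + 1) = succB (2 * b) (zW J).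
Proof.
  pose proof b_pos as hb0.
  assert (E : forall X Y y, (0 <= X < 2 * B)%Z -> (0 <= Y < 2 * B)%Z -> y < b ->
     Y = succB (2 * b) X -> linked X Y y).
  { intros X Y y hX hY hy ->. unfold linked, succB in *.
    destruct (Z.eqb_spec (zn y) (B - 1)), (Z.eqb_spec X (zn (2 * b) - 1)); split;
      apply eq_true_iff_eq; rewrite !Z.eqb_eq; lia. }
  split.
  - intros h J. destruct (z_range J) as [h1 h2], (z_range (J + 1)) as [h3 h4].
    assert (F : forall y, y < b -> linked (zX J) (zX (J + 1)) y /\ linked (zW J) (zW (J + 1)) y).
    { intros y hy. specialize (h (J * B + zn y)%Z). unfold linked. unfold check in h. rewrite modB in h by lia.
      destruct (x_at J hy) as [e1 e2], (w_at J hy) as [e3 e4]. rewrite e1, e2, e3, e4 in h.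
      destruct (Z.eqb_spec (zn y) (B - 1)) as [e|ne].
      - replace (J * B + zn y + 1)%Z with ((J + 1) * B + zn 0)%Z in h by lia.
        destruct (x_at (J + 1) hb0) as [e5 e6], (w_at (J + 1) hb0) as [e7 e8].
        rewrite e5, e6, e7, e8 in h. rewrite !andb_true_iff, !eqb_true_iff in h. tauto.
      - replace (J * B + zn y + 1 + B)%Z with ((J + 1) * B + zn (y + 1))%Z in h by lia.
        assert (hy' : y + 1 < b) by lia.
        destruct (x_at (J + 1) hy') as [e5 e6], (w_at (J + 1) hy') as [e7 e8].
        rewrite e5, e6, e7, e8 in h. rewrite !andb_true_iff, !eqb_true_iff in h. tauto. }
    assert (G : forall X Y, (0 <= X < 2 * B)%Z -> (0 <= Y < 2 * B)%Z ->
      (forall y, y < b -> linked X Y y) -> Y = succB (2 * b) X).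
    { intros X Y hX hY hF. specialize (hF (res X)).
      assert (hr : res X < b) by (unfold res; destruct (Z.ltb_spec X B); lia).
      specialize (hF hr). unfold linked, res in *. unfold succB.
      destruct (Z.ltb_spec X B); destruct (Z.eqb_spec X (zn (2 * b) - 1));
      match type of hF with if ?c then _ else _ => destruct c eqn:Ec end;
      rewrite ?Z.eqb_eq, ?Z.eqb_neq in Ec; try lia;
      destruct hF as [f1 f2]; apply bool_iff_eq in f1, f2; rewrite !Z.eqb_eq in f1, f2; lia. }
    split; apply G; auto; intros y hy; apply (F y hy).
  - intros h i. destruct (divB i) as (J & y & -> & hy). unfold check. rewrite modB by lia.
    destruct (z_range J) as [h1 h2], (z_range (J + 1)) as [h3 h4], (h J) as [h5 h6].
    pose proof (E _ _ _ h1 h3 hy h5) as EX'. pose proof (E _ _ _ h2 h4 hy h6) as EW'. unfold linked in *.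
    destruct (x_at J hy) as [-> ->], (w_at J hy) as [-> ->].
    destruct (Z.eqb_spec (zn y) (B - 1)) as [e|ne].
    + replace (J * B + zn y + 1)%Z with ((J + 1) * B + zn 0)%Z by lia.
      destruct (x_at (J + 1) hb0) as [-> ->], (w_at (J + 1) hb0) as [-> ->].
      change (zn 0) with 0%Z. rewrite !andb_true_iff, !eqb_true_iff. tauto.
    + replace (J * B + zn y + 1 + B)%Z with ((J + 1) * B + zn (y + 1))%Z by lia.
      assert (hy' : y + 1 < b) by lia.
      destruct (x_at (J + 1) hy') as [-> ->], (w_at (J + 1) hy') as [-> ->].
      rewrite !andb_true_iff, !eqb_true_iff. tauto.
Qed.

Definition phiJ (J : Z) : option V := phi (cls' J) (zV (J - 1)) (zV J) (zV (J + 1)).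

(** Each of the four inputs has one marker in its block, and mixed radix digits determine the index.
    Uniqueness gives both a single new payload and no death caused by an unrelated entry of the
    table. *)
Lemma matches_iff J : exists I0, I0 < NI /\ phiI I0 = phiJ J /\
  forall I, I < NI -> matches J I = (I =? I0).
Proof.
  pose proof K_lt_b as hK.
  destruct (v_at (J - 1)) as (l & hl & el & fl), (v_at J) as (m & hm & em & fm),
    (v_at (J + 1)) as (r & hr & er & fr). destruct (HC (cls' J)) as [hc ec].
  exists (index (encC (cls' J)) l m r). split; [now apply index_lt|].
  destruct (@index_dec (encC (cls' J)) l m r hl hm hr) as (d1 & d2 & d3 & d4). split.
  - unfold phiI, phiJ. now rewrite d1, d2, d3, d4, ec, el, em, er.
  - intros I hI. destruct (iLMR_lt hI) as (h1 & h2 & h3 & h4). unfold matches.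
    rewrite fl, fm, fr by auto. unfold UC. rewrite vuc_2b, codeJ_at by lia.
    apply eq_true_iff_eq. rewrite !andb_true_iff, !Nat.eqb_eq. split.
    + intros [[[<- <-] <-] <-]. symmetry; apply dec_index.
    + intros ->. auto.
Qed.

Definition znext (J : Z) : option state :=
  Hlev (2 * b) s' gam' (z (J - 1)%Z) (z J) (z (J + 1)%Z).

Lemma znext_eq J : znext J =
  if ((zX (J + 1) =? succB (2 * b) (zX J)) && (zW (J + 1) =? succB (2 * b) (zW J)))%Z
  then match phiJ J with Some v => Some (zX J, succB (2 * b) (zW J), v) | None => None end
  else None.
Proof. unfold znext, Hlev, phiJ, cls'. now rewrite (z_eq (J - 1)), (z_eq J), (z_eq (J + 1)). Qed.

Theorem sim_step : nokill <-> hlt s = false /\ forall J, znext J <> None.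
Proof.
  rewrite nokill_iff, check_iff. split.
  - intros (h1 & _ & h2 & h3). split; auto. intros J. rewrite znext_eq.
    destruct (h2 J) as [-> ->]. rewrite !Z.eqb_refl. simpl.
    destruct (matches_iff J) as (I & hI & <- & hm).
    destruct (phiI I) eqn:E; [discriminate|].
    specialize (h3 J I hI E). rewrite hm, Nat.eqb_refl in h3 by auto. discriminate.
  - intros (h1 & h2). split; auto. split; [apply rep_wellmarked|]. split.
    + intros J. specialize (h2 J). rewrite znext_eq in h2.
      destruct (Z.eqb_spec (zX (J + 1)) (succB (2 * b) (zX J))), (Z.eqb_spec (zW (J + 1)) (succB (2 * b) (zW J)));
        auto; now destruct h2.
    + intros J I hI hn. specialize (h2 J). rewrite znext_eq in h2.
      destruct (matches_iff J) as (I0 & hI0 & e & hm). rewrite hm by auto.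
      apply Nat.eqb_neq. intros ->. rewrite <- e, hn in h2.
      now destruct ((zX (J + 1) =? _) && _)%Z.
Qed.

Theorem sim_end z' : (forall J, znext J = Some (z' J)) -> rep (u (3 * b)) z'.
Proof.
  intros h J. pose proof K_lt_b as hK. specialize (h J) as hJ. rewrite znext_eq in hJ.
  destruct (Z.eqb_spec (zX (J + 1)) (succB (2 * b) (zX J))) as [e1|], (Z.eqb_spec (zW (J + 1)) (succB (2 * b) (zW J))) as [e2|];
    try discriminate.
  cbn [andb] in hJ. destruct (phiJ J) as [v|] eqn:Ev; [|discriminate].
  assert (hz' : z' J = (zX J, succB (2 * b) (zW J), v)) by congruence. rewrite hz'. clear hz' hJ.
  destruct (z_range J) as [r1 r2], (z_range (J + 1)) as [r3 r4].
  split; [|split; [lia|rewrite <- e2; lia]].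
  split.
  - intros x hx. unfold marks. rewrite x0_all, x1_all. split; [now apply x_at|].
    destruct (w_end (J * B + zn x)%Z) as [-> ->].
    replace (J * B + zn x + B)%Z with ((J + 1) * B + zn x)%Z by lia.
    rewrite <- e2. now apply w_at.
  - destruct (HV v) as [hv ev]. exists (encV v). repeat split; auto. intros x hx.
    rewrite vv_end by auto. apply eq_true_iff_eq. rewrite vg_TA, Nat.eqb_eq by lia.
    destruct (matches_iff J) as (I0 & hI0 & e & hm). split.
    + intros (I & v' & h1 & h2 & -> & h3). rewrite hm in h3 by auto. apply Nat.eqb_eq in h3. subst I.
      congruence.
    + intros ->. exists I0, v. rewrite hm, Nat.eqb_refl by auto. repeat split; auto. congruence.
Qed.
End Rep.

Definition cfg (v : Z -> V) (t : nat) (i : Z) : state := ((i mod B)%Z, ((i + zn t) mod B)%Z, v i).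

Lemma succ_mod i : succB b (i mod B)%Z = ((i + 1) mod B)%Z.
Proof.
  destruct (divB i) as (J & y & -> & hy). rewrite modB by lia. unfold succB.
  destruct (Z.eqb_spec (zn y) (B - 1)).
  - replace (J * B + zn y + 1)%Z with ((J + 1) * B + 0)%Z by lia. rewrite modB; lia.
  - replace (J * B + zn y + 1)%Z with (J * B + (zn y + 1))%Z by lia. rewrite modB; lia.
Qed.

Lemma step_cfg t i :
  Hlev b s gam (cfg (u t) t (i - 1)%Z) (cfg (u t) t i) (cfg (u t) t (i + 1)%Z) =
  if killat t i then None else Some (cfg (u (S t)) (S t) i).
Proof.
  unfold Hlev, cfg. rewrite !succ_mod.
  replace (i + 1 + zn t)%Z with (i + zn t + 1)%Z by lia. rewrite !Z.eqb_refl. cbn [andb].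
  unfold phi. fold (clat t i). fold (killat t i). destruct (killat t i); auto.
  replace (i + zn (S t))%Z with (i + zn t + 1)%Z by lia. reflexivity.
Qed.

End Level.

(** * Transfer of liveness between consecutive levels *)

Fixpoint alive (b : nat) (s : St) (gam : Z -> Sy) (T : nat) (c : Z -> state) : Prop :=
  match T with
  | 0 => True
  | S T' => exists c', (forall i, Hlev b s gam (c (i - 1)%Z) (c i) (c (i + 1)%Z) = Some (c' i)) /\
                       alive b s gam T' c'
  end.

Section Alive.
Variables (b : nat) (s : St) (gam : Z -> Sy).
Hypothesis hb : C0 <= b.
Hypothesis hgam : forall x, (Z.of_nat b - 1 <= x)%Z -> gam x = blank.
Hypothesis hdelta : forall s, delta s false blank blank blank = blank.
Notation B := (Z.of_nat b).
Notation zn := Z.of_nat.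
Notation al := (alive b s gam).

Lemma alive_ext T c d : (forall i, c i = d i) -> al T c -> al T d.
Proof.
  destruct T; cbn [alive]; auto. intros h (c' & h1 & h2). exists c'; split; auto.
  intros i. now rewrite <- !h.
Qed.

Lemma alive_tr T c a : al T c -> al T (fun i => c (i + a)%Z).
Proof.
  revert c. induction T as [|T IH]; intros c; cbn [alive]; auto. intros (c' & h1 & h2).
  exists (fun i => c' (i + a)%Z). split; auto. intros i. rewrite <- h1.
  f_equal; f_equal; lia.
Qed.

Lemma alive_le T T' c : T' <= T -> al T c -> al T' c.
Proof.
  revert T c. induction T' as [|T' IH]; intros T c h; cbn [alive]; auto.
  destruct T; [lia|]. cbn [alive]. intros (c' & h1 & h2). exists c'; split; auto. apply (IH T); auto; lia.
Qed.

Lemma alive_cfg u0 T t :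
  al T (cfg b (u b s gam u0 t) t) <-> forall t' i, t' < T -> killat b s gam u0 (t + t') i = false.
Proof.
  revert t. induction T as [|T IH]; intros t; cbn [alive].
  - split; auto; intros; lia.
  - split.
    + intros (c' & h1 & h2).
      assert (k0 : forall i, killat b s gam u0 t i = false /\ c' i = cfg b (u b s gam u0 (S t)) (S t) i).
      { intros i. specialize (h1 i). rewrite step_cfg in h1 by auto.
        destruct (killat b s gam u0 t i); [discriminate|]. split; congruence. }
      apply (@alive_ext T c' (cfg b (u b s gam u0 (S t)) (S t)) (fun i => proj2 (k0 i))) in h2.
      rewrite IH in h2.
      intros t' i ht'. destruct t' as [|t']; [rewrite Nat.add_0_r; apply k0|].
      rewrite Nat.add_succ_r. apply h2; lia.
    + intros h. exists (cfg b (u b s gam u0 (S t)) (S t)). split.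
      * intros i. rewrite step_cfg by auto. rewrite <- (Nat.add_0_r t) at 1. rewrite h by lia. reflexivity.
      * apply IH. intros t' i ht'. specialize (h (S t') i). rewrite Nat.add_succ_r in h. apply h; lia.
Qed.

Lemma u_add u0 t i : u b s gam u0 (3 * b + t) i = u b s gam (u b s gam u0 (3 * b)) t i.
Proof.
  revert i. induction t as [|t IH]; intros i; [now rewrite Nat.add_0_r|].
  rewrite Nat.add_succ_r. cbn [u]. rewrite !IH. f_equal. unfold clat, lcls.
  assert (E : ((i + zn (3 * b + t)) mod B = (i + zn t) mod B)%Z).
  { replace (i + zn (3 * b + t))%Z with (i + zn t + 3 * B)%Z by lia.
    apply Z.mod_add. pose proof (b_pos hb). lia. }
  now rewrite E.
Qed.

Lemma killat_add u0 t i : killat b s gam u0 (3 * b + t) i = killat b s gam (u b s gam u0 (3 * b)) t i.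
Proof.
  unfold killat. rewrite !u_add. f_equal. unfold clat, lcls.
  assert (E : ((i + zn (3 * b + t)) mod B = (i + zn t) mod B)%Z).
  { replace (i + zn (3 * b + t))%Z with (i + zn t + 3 * B)%Z by lia.
    apply Z.mod_add. pose proof (b_pos hb). lia. }
  now rewrite E.
Qed.

Definition aligned (v : Z -> V) : Prop :=
  (forall i, vph (v i) = P2) /\ forall i, vsy (v i) = gam (i mod B)%Z.

Lemma aligned_end v : aligned v -> aligned (u b s gam v (3 * b)).
Proof.
  intros [h1 h2]. split.
  - intros i. apply (@vph_end b s gam hb v h1).
  - intros i. apply (@vsy_all b s gam v h2).
Qed.

Notation al' := (alive (2 * b) (step s (gam 0%Z)) (gnext s gam)).

Lemma sim_alive T v z : aligned v -> rep b v z -> hlt s = false ->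
  (al (3 * b * T) (cfg b v 0) <-> al' T z).
Proof.
  revert v z. induction T as [|T IH]; intros v z hv hr hs.
  - rewrite Nat.mul_0_r. cbn [alive]. tauto.
  - destruct hv as [hv1 hv2].
    pose proof (@sim_step b s gam hb hgam hdelta v hv1 hv2 z hr) as SS.
    pose proof (@sim_end b s gam hb hgam hdelta v hv1 hv2 z hr) as SE.
    change (cfg b v 0) with (cfg b (u b s gam v 0) 0). rewrite alive_cfg.
    assert (N : forall z', rep b (u b s gam v (3 * b)) z' ->
      (al (3 * b * T) (cfg b (u b s gam v (3 * b)) 0) <-> al' T z')).
    { intros z' hz'. apply IH; auto. apply aligned_end; split; auto. }
    assert (N2 : al (3 * b * T) (cfg b (u b s gam v (3 * b)) 0) <->
      forall t' i, t' < 3 * b * T -> killat b s gam v (3 * b + t') i = false).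
    { change (cfg b (u b s gam v (3 * b)) 0) with (cfg b (u b s gam (u b s gam v (3 * b)) 0) 0).
      rewrite alive_cfg. split; intros h t' i ht'; specialize (h t' i ht').
      - now rewrite killat_add. - now rewrite killat_add in h. }
    split.
    + intros h. assert (nk : nokill b s gam v) by (intros t i ht; apply (h t); nia).
      apply SS in nk as [_ nk].
      exists (fun J => match znext b s gam z J with Some x => x | None => z J end).
      assert (e : forall J, znext b s gam z J = Some (match znext b s gam z J with Some x => x | None => z J end)).
      { intros J. specialize (nk J). destruct (znext b s gam z J); congruence. }
      split; [exact e|]. apply (N _ (SE _ e)). apply N2. intros t' i ht'. apply (h (3 * b + t')). nia.
    + intros (z' & e & h). apply (N _ (SE _ e)) in h. rewrite N2 in h. assert (nk : nokill b s gam v).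
      { apply SS. split; auto. intros J. unfold znext. rewrite e. discriminate. }
      intros t' i ht'. destruct (lt_dec t' (3 * b)) as [l|l]; [apply nk; auto|].
      replace (0 + t') with (3 * b + (t' - 3 * b)) by lia. apply h. nia.
Qed.

(** The signal tracks may be filled arbitrarily, since each of them is reloaded at the start of a
    phase before it matters. *)
Definition idle (p : phase) (g : Sy) (a0 a1 c0 c1 d : bool) : V :=
  {| vph := p; vsy := g; vx0 := a0; vx1 := a1; vw0 := c0; vw1 := c1; vv := d;
     tx0 := false; tx1 := false; tw0 := false; tw1 := false; tv := false; tr := false; vsh := false;
     bx := None; ax := None; bw := false; aw := false; bv := false; av := false;
     ba := act0; aa := act0; vas := s; vcd := None; vuc := false;
     sl := false; sc := false; sr := false; sk := false; mt := false; vg := false |}.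

Definition encz (z : Z -> state) (i : Z) : V :=
  let x := (i mod B)%Z in
  match z (i / B)%Z with (X, W, a) =>
    idle P2 (gam x) (X =? x)%Z (X =? B + x)%Z (W =? x)%Z (W =? B + x)%Z (x =? zn (encV a))%Z
  end.

Lemma encz_rep z : (forall J, valid (2 * b) (z J)) -> aligned (encz z) /\ rep b (encz z) z.
Proof.
  intros h. pose proof (K_lt_b hb) as hK. split; [split|].
  - intros i. unfold encz. now destruct (z _) as [[? ?] ?].
  - intros i. unfold encz. now destruct (z _) as [[? ?] ?].
  - intros J. split; [|apply h].
    assert (E : forall x, x < b -> ((J * B + zn x) / B = J /\ (J * B + zn x) mod B = zn x)%Z).
    { intros x hx. split; [|apply (modB hb); lia].
      rewrite Z.div_add_l by lia. rewrite Z.div_small by lia. lia. }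
    unfold rep1. destruct (z J) as [[X W] a] eqn:ez. split.
    + intros x hx. unfold marks, encz. destruct (E x hx) as [-> ->]. rewrite ez. simpl. auto.
    + destruct (HV a) as [h1 h2]. exists (encV a). repeat split; auto. intros x hx.
      unfold encz. destruct (E x) as [-> ->]; [lia|]. rewrite ez. simpl.
      destruct (Z.eqb_spec (zn x) (zn (encV a))), (Nat.eqb_spec x (encV a)); auto; lia.
Qed.

Lemma alive_down T z : hlt s = false -> (forall J, valid (2 * b) (z J)) -> al' T z ->
  exists c, (forall i, valid b (c i)) /\ al (3 * b * T) c.
Proof.
  intros hs hz h. destruct (encz_rep z hz) as [h1 h2].
  exists (cfg b (encz z) 0). split; [|now apply (sim_alive T h1 h2 hs)].
  intros i. unfold valid, cfg. pose proof (b_pos hb). split; apply Z.mod_pos_bound; lia.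
Qed.

(* Number of steps before a synchronous configuration reaches the start of a macro step. *)
Definition wait (o : nat) (p : phase) : nat :=
  (if o =? 0 then 0 else b - o) + match p with P0 => 2 * b | P1 => b | P2 => 0 end.

Definition sync (o : nat) (p : phase) (c : Z -> state) : Prop :=
  forall i, exists v, c i = ((i mod B)%Z, ((i + zn o) mod B)%Z, v) /\ vph v = p /\ vsy v = gam (i mod B)%Z.

Lemma sync_step o p c c' : o < b -> sync o p c ->
  (forall i, Hlev b s gam (c (i - 1)%Z) (c i) (c (i + 1)%Z) = Some (c' i)) ->
  sync (if S o =? b then 0 else S o) (if o =? 0 then nextph p else p) c'.
Proof.
  intros ho hs h i. destruct (hs (i - 1)%Z) as (vl & el & _), (hs i) as (v & e & ep & _), (hs (i + 1)%Z) as (vr & er & _).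
  specialize (h i). rewrite el, e, er in h. unfold Hlev in h.
  destruct (_ && _); [|discriminate]. unfold phi in h.
  destruct (kill _ _ _ _); [discriminate|].
  assert (e' : c' i = ((i mod B)%Z, succB b ((i + zn o) mod B)%Z, upd (lcls b s gam (i mod B)%Z ((i + zn o) mod B)%Z) vl v vr)) by congruence.
  eexists. rewrite e'. split; [|split].
  - rewrite (succ_mod hb). do 2 f_equal. destruct (Nat.eqb_spec (S o) b) as [<-|].
    + replace (i + zn o + 1)%Z with (i + zn 0 + 1 * zn (S o))%Z by lia. rewrite Z.mod_add; lia.
    + f_equal; lia.
  - cbn [upd vph]. unfold eph. fold (clat b s gam o i).
    change o with (0 * b + o) at 1. rewrite (cdg_at s gam hb) by lia. now rewrite ep.
  - reflexivity.
Qed.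

Lemma sync_reach n : forall o p c T, wait o p <= n -> o < b -> sync o p c -> al (n + T) c ->
  exists v, aligned v /\ al T (cfg b v 0).
Proof.
  pose proof (b_pos hb) as hb0.
  induction n as [|n IH]; intros o p c T hw ho hs ha.
  - assert (o = 0 /\ p = P2) as [-> ->].
    { unfold wait in hw. destruct (Nat.eqb_spec o 0), p; lia || auto. }
    exists (fun i => snd (c i)). split; [split|].
    + intros i. destruct (hs i) as (v & e & h1 & h2). now rewrite e.
    + intros i. destruct (hs i) as (v & e & h1 & h2). now rewrite e.
    + eapply alive_ext; [|exact ha]. intros i. unfold cfg. destruct (hs i) as (v & e & _). now rewrite e.
  - destruct (Nat.eq_dec (wait o p) 0) as [w0|w0].
    + apply (IH o p c T); auto; [lia|]. apply (alive_le (T := S n + T)); auto; lia.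
    + cbn [Nat.add alive] in ha. destruct ha as (c' & h1 & h2).
      apply (IH _ _ c' T) with (3 := @sync_step o p c c' ho hs h1); auto.
      * unfold wait in *.
        destruct (Nat.eqb_spec o 0), (Nat.eqb_spec (S o) b), p; cbn [Nat.eqb nextph]; lia.
      * destruct (Nat.eqb_spec (S o) b); lia.
Qed.

Lemma succB_inj x y : (0 <= x < B)%Z -> (0 <= y < B)%Z -> succB b x = succB b y -> x = y.
Proof.
  intros hx hy. unfold succB. destruct (Z.eqb_spec x (B - 1)), (Z.eqb_spec y (B - 1)); lia.
Qed.

Lemma chain (f : Z -> Z) : (forall i, 0 <= f i < B)%Z -> (forall i, f (i + 1)%Z = succB b (f i)) ->
  forall i, f i = ((i + f 0) mod B)%Z.
Proof.
  intros hf h. pose proof (b_pos hb) as hb0.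
  assert (P : forall n, f (zn n) = ((zn n + f 0) mod B)%Z /\ f (- zn n)%Z = ((- zn n + f 0) mod B)%Z).
  { induction n as [|n [IH1 IH2]].
    - simpl. rewrite Z.mod_small; auto.
    - split.
      + replace (zn (S n)) with (zn n + 1)%Z by lia. rewrite h, IH1, (succ_mod hb). f_equal; lia.
      + apply succB_inj; auto; [apply Z.mod_pos_bound; lia|]. rewrite <- h, (succ_mod hb).
        replace (- zn (S n) + 1)%Z with (- zn n)%Z by lia. rewrite IH2. f_equal; lia. }
  intros i. destruct (Z_le_gt_dec 0 i).
  - rewrite <- (Z2Nat.id i) by lia. apply P.
  - replace i with (- zn (Z.to_nat (- i)))%Z by lia. apply P.
Qed.

(** Surviving one step forces the addresses and clocks of the whole row to be consecutive and the
    phases to agree, and that step also writes the correct symbols into [vsy]. The next start of a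
    macro step is then at most [3 * b] steps away. *)
Lemma alive_sync c T : (forall i, valid b (c i)) -> al (1 + (3 * b + T)) c ->
  exists v, aligned v /\ al T (cfg b v 0).
Proof.
  intros hv (c' & h1 & h2). pose proof (b_pos hb) as hb0.
  set (fx := fun i => fst (fst (c i))). set (fw := fun i => snd (fst (c i))).
  assert (e : forall i, c i = (fx i, fw i, snd (c i))) by (intros i; unfold fx, fw; now destruct (c i) as [[? ?] ?]).
  assert (hf : forall i, (0 <= fx i < B /\ 0 <= fw i < B)%Z).
  { intros i. specialize (hv i). rewrite e in hv. exact hv. }
  assert (S1 : forall i, (fx (i + 1)%Z = succB b (fx i) /\ fw (i + 1)%Z = succB b (fw i)) /\
     vph (snd (c (i + 1)%Z)) = vph (snd (c i)) /\
     exists v, c' i = (fx i, succB b (fw i), v) /\ vsy v = gam (fx i) /\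
       vph v = if (fx i =? fw i)%Z then nextph (vph (snd (c i))) else vph (snd (c i))).
  { intros i. specialize (h1 i). rewrite (e (i - 1)%Z), (e i), (e (i + 1)%Z) in h1. unfold Hlev in h1.
    destruct (Z.eqb_spec (fx (i + 1)%Z) (succB b (fx i))), (Z.eqb_spec (fw (i + 1)%Z) (succB b (fw i))); try discriminate.
    cbn [andb] in h1. unfold phi in h1. destruct (kill _ _ _ _) eqn:ek; [discriminate|].
    split; auto. split.
    - unfold kill in ek. rewrite !orb_false_iff in ek. destruct ek as [[[[[[_ ek] _] _] _] _] _].
      apply negb_false_iff in ek. now destruct (vph (snd (c (i + 1)%Z))), (vph (snd (c i))).
    - eexists. split; [symmetry; apply (f_equal (fun o => match o with Some x => x | None => c' i end)) in h1; exact h1|]. split; reflexivity. }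
  assert (cx := chain fx (fun i => proj1 (hf i)) (fun i => proj1 (proj1 (S1 i)))).
  assert (cw := chain fw (fun i => proj2 (hf i)) (fun i => proj2 (proj1 (S1 i)))).
  assert (cp : forall i, vph (snd (c i)) = vph (snd (c 0%Z))).
  { assert (P : forall n, vph (snd (c (zn n))) = vph (snd (c 0%Z)) /\ vph (snd (c (- zn n)%Z)) = vph (snd (c 0%Z))).
    { induction n as [|n [IH1 IH2]]; [simpl; auto|]. split.
      - replace (zn (S n)) with (zn n + 1)%Z by lia. now rewrite (proj1 (proj2 (S1 _))).
      - rewrite <- IH2. replace (- zn n)%Z with (- zn (S n) + 1)%Z by lia.
        now rewrite (proj1 (proj2 (S1 _))). }
    intros i. destruct (Z_le_gt_dec 0 i).
    - rewrite <- (Z2Nat.id i) by lia. apply P.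
    - replace i with (- zn (Z.to_nat (- i)))%Z by lia. apply P. }
  (* Translating by [a] moves an address 0 to cell 0; [o] and [p] are the offset and the phase after
     the one step already made. *)
  set (a := (- fx 0%Z)%Z).
  set (o := Z.to_nat ((fw 0%Z + 1 - fx 0%Z) mod B)%Z).
  pose proof (Z.mod_pos_bound (fw 0%Z + 1 - fx 0%Z) B ltac:(lia)) as hm.
  set (p := if (fx 0%Z =? fw 0%Z)%Z then nextph (vph (snd (c 0%Z))) else vph (snd (c 0%Z))).
  assert (hsync : sync o p (fun i => c' (i + a)%Z)).
  { intros i. destruct (S1 (i + a)%Z) as (_ & _ & v & e1 & e2 & e3). exists v.
    rewrite e1. rewrite cx in e2 |- *. unfold a in *.
    replace (i + - fx 0%Z + fx 0%Z)%Z with i in e2 |- * by lia.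
    split; [|split; auto].
    - do 2 f_equal. rewrite cw, (succ_mod hb). unfold o. rewrite Z2Nat.id by lia.
      rewrite Zplus_mod_idemp_r. f_equal. lia.
    - rewrite e3, cp. unfold p.
      replace (fx (i + - fx 0%Z)%Z =? fw (i + - fx 0%Z)%Z)%Z with (fx 0%Z =? fw 0%Z)%Z; auto.
      rewrite (cx (i + - fx 0%Z)%Z), (cw (i + - fx 0%Z)%Z).
      apply eq_true_iff_eq. rewrite !Z.eqb_eq. split; [intros ->; auto|]. intros E.
      assert (E' : ((fx 0%Z - fw 0%Z) mod B = 0)%Z).
      { replace (fx 0%Z - fw 0%Z)%Z with ((i + - fx 0%Z + fx 0%Z) - (i + - fx 0%Z + fw 0%Z))%Z by lia.
        rewrite Zminus_mod, E, Z.sub_diag. apply Z.mod_0_l; lia. }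
      apply Z.mod_divide in E' as [q E']; [|lia]. pose proof (hf 0%Z).
      assert (q <= -1 \/ q = 0 \/ 1 <= q)%Z as [h|[h|h]] by lia; nia. }
  apply (@sync_reach (3 * b) o p (fun i => c' (i + a)%Z) T); auto.
  - unfold wait. destruct (Nat.eqb_spec o 0), p; lia.
  - lia.
  - now apply alive_tr.
Qed.

(** After synchronization, [0 < T] leaves at least one complete macro step. Surviving it makes every
    block well marked, so the row can be decoded into a row of the next level, which would then live
    for [T] steps. *)
Lemma alive_up T : 0 < T -> (forall z, (forall J, valid (2 * b) (z J)) -> ~ al' T z) ->
  forall c, (forall i, valid b (c i)) -> ~ al (1 + (3 * b + 3 * b * T)) c.
Proof.
  intros hT hz c hc ha. destruct (alive_sync _ hc ha) as (v & hv & h).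
  assert (nk : nokill b s gam v).
  { change (cfg b v 0) with (cfg b (u b s gam v 0) 0) in h. rewrite alive_cfg in h.
    intros t i ht. apply (h t). nia. }
  destruct hv as [hv1 hv2].
  pose proof (proj1 (@nokill_iff b s gam hb v hv1) nk) as (hs & hw & _).
  assert (R : exists z, rep b v z).
  { destruct (functional_choice _ (fun J => @wellmarked_rep b s gam hb v J hw)) as [z z_spec].
    now exists z. }
  destruct R as [z hr]. apply (hz z (fun J => proj2 (hr J))).
  apply (sim_alive T (conj hv1 hv2) hr hs), h.
Qed.


Lemma halt_dead c : hlt s = true -> ~ al 1 c.
Proof.
  intros h (c' & h1 & _). specialize (h1 0%Z). unfold Hlev in h1.
  destruct (c (0 - 1)%Z) as [[? ?] ?], (c 0%Z) as [[? ?] ?], (c (0 + 1)%Z) as [[? ?] ?].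
  destruct (_ && _); [|discriminate]. unfold phi, kill in h1. cbn [lcls cst] in h1.
  rewrite h in h1. discriminate.
Qed.

(** The clock is set one step after the start of [P1]: in the interior of that phase only the
    halting test and the agreement of the phases are active. *)
Lemma alive_one : hlt s = false -> exists c, (forall i, valid b (c i)) /\ al 1 c.
Proof.
  intros hs. pose proof (b_pos hb) as hb0. pose proof (K_lt_b hb) as hK.
  set (v0 := idle P1 blank false false false false false).
  set (c := fun i : Z => ((i mod B)%Z, ((i + 1) mod B)%Z, v0) : state).
  exists c. split; [intros i; split; apply Z.mod_pos_bound; lia|].
  assert (E : forall i, Hlev b s gam (c (i - 1)%Z) (c i) (c (i + 1)%Z) <> None).
  { intros i. unfold c, Hlev. rewrite !(succ_mod hb), !Z.eqb_refl. cbn [andb].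
    unfold phi. replace (kill _ _ _ _) with false; [discriminate|]. symmetry.
    assert (D : (i mod B =? (i + 1) mod B)%Z = false).
    { change (cdg (clat b s gam 1 i) = false).
      change 1 with (0 * b + 1). rewrite (cdg_at s gam hb) by lia. reflexivity. }
    unfold kill, eph. cbn [lcls cst cdg cz cL]. rewrite D, hs. reflexivity. }
  exists (fun i => match Hlev b s gam (c (i - 1)%Z) (c i) (c (i + 1)%Z) with Some x => x | None => c i end).
  split; [|exact I]. intros i. specialize (E i). destruct (Hlev _ _ _ _ _ _); congruence.
Qed.
End Alive.

(** * The tower of levels *)

Section Levels.
Variables (b0 p0 : nat) (s0 : St) (gam0 : Z -> Sy).
Hypothesis hb0 : C0 <= b0.
Hypothesis hp0 : p0 + 1 <= b0.
Hypothesis hgam0 : forall x, (Z.of_nat p0 <= x)%Z -> gam0 x = blank.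
Hypothesis hdelta : forall s, delta s false blank blank blank = blank.

Fixpoint lev (n : nat) : St * (Z -> Sy) :=
  match n with
  | 0 => (s0, gam0)
  | S m => let (s, g) := lev m in (step s (g 0%Z), gnext s g)
  end.

Definition bn (n : nat) : nat := 2 ^ n * b0.

Lemma bn_ge n : b0 + n <= bn n.
Proof. unfold bn. pose proof (Nat.pow_gt_lin_r 2 n). nia. Qed.

(** A machine step enlarges the tape by at most one cell, whereas the block length grows by at least
    one per level. *)
Lemma lev_support n x : (Z.of_nat (p0 + n) <= x)%Z -> snd (lev n) x = blank.
Proof.
  revert x. induction n as [|n IH]; intros x h; [apply hgam0; lia|].
  cbn [lev]. destruct (lev n) as [s g]. cbn [snd] in *. unfold gnext.
  destruct (Z.eqb_spec x 0); [lia|]. rewrite !IH by lia. apply hdelta.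
Qed.

Lemma lev_gam n x : (Z.of_nat (bn n) - 1 <= x)%Z -> snd (lev n) x = blank.
Proof. intros h. apply lev_support. pose proof (bn_ge n). lia. Qed.

Lemma bn_C0 n : C0 <= bn n.
Proof. pose proof (bn_ge n). lia. Qed.

Notation aln n := (alive (bn n) (fst (lev n)) (snd (lev n))).

Lemma alnS n T c : aln (S n) T c <->
  alive (2 * bn n) (step (fst (lev n)) (snd (lev n) 0%Z)) (gnext (fst (lev n)) (snd (lev n))) T c.
Proof.
  cbn [lev]. destruct (lev n) as [s g]. cbn [fst snd].
  replace (bn (S n)) with (2 * bn n) by (unfold bn; cbn [Nat.pow]; lia). tauto.
Qed.

Lemma validS n c : (forall i : Z, valid (bn (S n)) (c i)) <-> forall i, valid (2 * bn n) (c i).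
Proof. replace (bn (S n)) with (2 * bn n) by (unfold bn; cbn [Nat.pow]; lia). tauto. Qed.

(** Level [N] dies in one step. Going down one level replaces a time bound [T] by
    [1 + 3 * b + 3 * b * T], with [b] the block length there, uniformly over all rows. *)
Theorem halting_mortal N : hlt (fst (lev N)) = true ->
  exists T, forall c, (forall i, valid b0 (c i)) -> ~ alive b0 s0 gam0 T c.
Proof.
  intros h. assert (E : forall m, m <= N -> exists T, 0 < T /\
    forall c, (forall i, valid (bn (N - m)) (c i)) -> ~ aln (N - m) T c).
  { induction m as [|m IH]; intros hm.
    - exists 1. split; [lia|]. intros c _. rewrite Nat.sub_0_r. apply halt_dead; auto.
    - destruct IH as (T & hT & IH); [lia|]. replace (N - m) with (S (N - S m)) in IH by lia.
      exists (1 + (3 * bn (N - S m) + 3 * bn (N - S m) * T)). split; [lia|].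
      apply alive_up; auto using bn_C0, lev_gam.
      intros z hz. rewrite <- alnS. apply IH. now apply validS. }
  destruct (E N) as (T & _ & hT); auto. rewrite Nat.sub_diag in hT. exists T. intros c hc.
  specialize (hT c). unfold bn in hT. cbn in hT. rewrite Nat.add_0_r in hT. auto.
Qed.

(** Induction on the time for all levels simultaneously: a row of level [n + 1] living [T + 1] steps
    is encoded by one of level [n] living three block lengths times as long, hence at least one step
    more. *)
Theorem nonhalting_immortal : (forall n, hlt (fst (lev n)) = false) ->
  forall T, exists c, (forall i, valid b0 (c i)) /\ alive b0 s0 gam0 T c.
Proof.
  intros h. assert (E : forall T n, exists c, (forall i, valid (bn n) (c i)) /\ aln n (S T) c).
  { induction T as [|T IH]; intros n.
    - apply alive_one; auto using bn_C0.
    - destruct (IH (S n)) as (z & hz & hal). rewrite alnS in hal. rewrite validS in hz.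
      destruct (@alive_down (bn n) (fst (lev n)) (snd (lev n)) (bn_C0 n) (@lev_gam n) hdelta (S T) z (h n) hz hal) as (c & hc & hc').
      exists c. split; auto. revert hc'. apply alive_le; auto using bn_C0.
      pose proof (b_pos (bn_C0 n)). nia. }
  intros T. destruct (E T 0) as (c & hc & hc'). assert (e : bn 0 = b0) by (unfold bn; cbn; lia).
  rewrite e in *. cbn [lev fst snd] in hc'.
  exists c. split; auto. revert hc'. apply alive_le; auto.
Qed.
End Levels.
End Sim.

(** * Counter machines *)

Definition store := nat -> nat.
Definition set_reg (m : store) (r v : nat) : store := fun x => if x =? r then v else m x.

Lemma set_eq m r v : set_reg m r v r = v.
Proof. unfold set_reg. now rewrite Nat.eqb_refl. Qed.
Lemma set_ne m r v x : x <> r -> set_reg m r v x = m x.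
Proof. intros h. unfold set_reg. now rewrite (proj2 (Nat.eqb_neq _ _) h). Qed.

Inductive prog :=
| PSkip
| PInc (r : nat)
| PSeq (p q : prog)
| PLoop (r : nat) (p : prog).

Inductive exec : prog -> store -> store -> Prop :=
| ex_skip m : exec PSkip m m
| ex_inc r m : exec (PInc r) m (set_reg m r (S (m r)))
| ex_seq p q m1 m2 m3 : exec p m1 m2 -> exec q m2 m3 -> exec (PSeq p q) m1 m3
| ex_loop0 r p m : m r = 0 -> exec (PLoop r p) m m
| ex_loopS r p m1 m2 m3 : m1 r <> 0 -> exec p (set_reg m1 r (m1 r - 1)) m2 ->
    exec (PLoop r p) m2 m3 -> exec (PLoop r p) m1 m3.

Definition clear r := PLoop r PSkip.
Definition copy a d t := PSeq (clear d) (PSeq (clear t)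
  (PSeq (PLoop a (PSeq (PInc d) (PInc t))) (PLoop t (PInc a)))).

Lemma exec_clear r m : exists m', exec (clear r) m m' /\ m' r = 0 /\ forall x, x <> r -> m' x = m x.
Proof.
  remember (m r) as n eqn:e. revert m e. induction n as [|n IH]; intros m e.
  - exists m. split; [now constructor|]. auto.
  - destruct (IH (set_reg m r n)) as (m' & h1 & h2 & h3); [now rewrite set_eq|].
    exists m'. split; [|split; auto].
    + econstructor; [lia|constructor|]. now replace (m r - 1) with n by lia.
    + intros x hx. rewrite h3, set_ne; auto.
Qed.

Lemma exec_copy a d t m : a <> d -> a <> t -> d <> t ->
  exists m', exec (copy a d t) m m' /\ m' d = m a /\ forall x, x <> d -> x <> t -> m' x = m x.
Proof.
  intros had hat hdt.
  destruct (exec_clear d m) as (m1 & e1 & c1 & k1).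
  destruct (exec_clear t m1) as (m2 & e2 & c2 & k2).
  assert (L1 : forall n m, m a = n -> exists m', exec (PLoop a (PSeq (PInc d) (PInc t))) m m' /\
    m' a = 0 /\ m' d = m d + n /\ m' t = m t + n /\ forall x, x <> a -> x <> d -> x <> t -> m' x = m x).
  { induction n as [|n IH]; intros m0 e.
    - exists m0. split; [now constructor|]. repeat split; auto; lia.
    - set (m3 := set_reg m0 a n). set (m4 := set_reg m3 d (S (m3 d))). set (m5 := set_reg m4 t (S (m4 t))).
      destruct (IH m5) as (m' & h1 & h2 & h3 & h4 & h5).
      { unfold m5, m4, m3. rewrite 2!set_ne by auto. apply set_eq. }
      exists m'. split.
      { apply ex_loopS with m5; [lia| |exact h1]. replace (m0 a - 1) with n by lia.
        apply ex_seq with m4; constructor. }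
      split; auto. rewrite h3, h4. unfold m5, m4, m3.
      split; [|split].
      + rewrite set_ne, set_eq, set_ne by auto. lia.
      + rewrite set_eq, !set_ne by auto. lia.
      + intros x hx1 hx2 hx3. rewrite h5 by auto. unfold m5, m4, m3. now rewrite !set_ne by auto. }
  assert (L2 : forall n m, m t = n -> exists m', exec (PLoop t (PInc a)) m m' /\
    m' a = m a + n /\ forall x, x <> a -> x <> t -> m' x = m x).
  { induction n as [|n IH]; intros m0 e.
    - exists m0. split; [now constructor|]. repeat split; auto; lia.
    - set (m3 := set_reg m0 t n). set (m4 := set_reg m3 a (S (m3 a))).
      destruct (IH m4) as (m' & h1 & h2 & h3).
      { unfold m4, m3. rewrite set_ne by auto. apply set_eq. }
      exists m'. split.
      { apply ex_loopS with m4; [lia| |exact h1]. replace (m0 t - 1) with n by lia. constructor. }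
      split.
      + rewrite h2. unfold m4, m3. rewrite set_eq, set_ne by auto. lia.
      + intros x hx1 hx2. rewrite h3 by auto. unfold m4, m3. now rewrite !set_ne by auto. }
  destruct (L1 _ m2 eq_refl) as (m3 & e3 & a3 & d3 & t3 & k3).
  destruct (L2 _ m3 eq_refl) as (m4 & e4 & a4 & k4).
  assert (ha : m2 a = m a) by (rewrite k2, k1; auto).
  exists m4. split; [|split].
  - eapply ex_seq; [exact e1|]. eapply ex_seq; [exact e2|]. eapply ex_seq; eauto.
  - rewrite k4, d3, k2, c1 by auto. lia.
  - intros x hx1 hx2. destruct (Nat.eq_dec x a) as [->|].
    + rewrite a4, a3, t3, c2. lia.
    + rewrite k4, k3, k2, k1; auto.
Qed.

(** * Compiling recursive functions into loop programs *)

Section RfInd.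
Variable P : rf -> Prop.
Hypotheses (h0 : P RZero) (h1 : P RSucc) (h2 : forall i, P (RProj i))
  (h3 : forall f gs, P f -> Forall P gs -> P (RComp f gs))
  (h4 : forall f g, P f -> P g -> P (RPrec f g)) (h5 : forall f, P f -> P (RMu f)).

Fixpoint rf_nested_ind (f : rf) : P f :=
  match f with
  | RZero => h0 | RSucc => h1 | RProj i => h2 i
  | RComp f gs => h3 (rf_nested_ind f)
      ((fix go (l : list rf) : Forall P l :=
          match l with
          | [] => Forall_nil P
          | g :: l' => Forall_cons g (rf_nested_ind g) (go l')
          end) gs)
  | RPrec f g => h4 (rf_nested_ind f) (rf_nested_ind g)
  | RMu f => h5 (rf_nested_ind f)
  end.
End RfInd.

Fixpoint seqs (l : list prog) : prog :=
  match l with [] => PSkip | p :: l' => PSeq p (seqs l') end.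

(* Arguments are read from the registers [args], the result goes to [o]; registers from [t] on are scratch. *)
Fixpoint rfprog (f : rf) (args : list nat) (o t : nat) : prog :=
  match f with
  | RZero => clear o
  | RSucc => PSeq (copy (nth 0 args 0) o t) (PInc o)
  | RProj i => copy (nth i args 0) o t
  | RComp f gs =>
      let n := length gs in
      PSeq ((fix go (l : list rf) (j : nat) : prog :=
               match l with
               | [] => PSkip
               | g :: l' => PSeq (rfprog g args j (t + n)) (go l' (S j))
               end) gs t)
           (rfprog f (seq t n) o (t + n))
  | RPrec f g =>
      let rest := tl args in
      PSeq (copy (hd 0 args) (t + 2) (t + 4)) (PSeq (clear t) (PSeq (rfprog f rest (t + 1) (t + 4))
        (PSeq (PLoop (t + 2) (PSeq (rfprog g (t :: (t + 1) :: rest) (t + 3) (t + 4))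
                               (PSeq (copy (t + 3) (t + 1) (t + 4)) (PInc t))))
          (copy (t + 1) o (t + 4)))))
  | RMu f =>
      PSeq (clear t) (PSeq (rfprog f (t :: args) (t + 1) (t + 2))
        (PSeq (PLoop (t + 1) (PSeq (PInc t) (rfprog f (t :: args) (t + 1) (t + 2))))
          (copy t o (t + 2))))
  end.

Definition computes (f : rf) : Prop :=
  forall args o t m y, (forall a, In a args -> a < t) -> o < t -> ~ In o args ->
  eval f (map m args) y ->
  exists m', exec (rfprog f args o t) m m' /\ m' o = y /\ forall r, r < t -> r <> o -> m' r = m r.

Lemma map_eq_on (l : list nat) (m m' : store) : (forall a, In a l -> m' a = m a) -> map m' l = map m l.
Proof. intros h. apply map_ext_in. exact h. Qed.

(** Collects the intermediate values of the recursion, which the invariant of the compiled loop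
    refers to. *)
Lemma prec_chain f g n v y : eval (RPrec f g) (n :: v) y ->
  exists ys, eval f v (ys 0) /\ (forall i, i < n -> eval g (i :: ys i :: v) (ys (S i))) /\ ys n = y.
Proof.
  revert y. induction n as [|n IH]; intros y h; inversion h; subst.
  - exists (fun _ => y). repeat split; auto; lia.
  - match goal with H : eval (RPrec f g) _ _ |- _ => destruct (IH _ H) as (ys & h1 & h2 & h3) end.
    exists (fun i => if i =? S n then y else ys i). split; [exact h1|]. split.
    + intros i hi. destruct (Nat.eqb_spec i (S n)); [lia|]. destruct (Nat.eqb_spec (S i) (S n)) as [e|].
      * injection e as ->. now rewrite h3.
      * apply h2; lia.
    + now rewrite Nat.eqb_refl.
Qed.

Lemma rfprog_correct f : computes f.
Proof.
  induction f as [| |i|f gs IHf IHgs|f g IHf IHg|f IHf] using rf_nested_ind;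
    intros args o t m y ha ho hn he; cbn [rfprog].
  - inversion he; subst. destruct (exec_clear o m) as (m' & e & c & k). exists m'; auto.
  - destruct args as [|a args]; [inversion he|]. cbn [map] in he. inversion he; subst. cbn [nth]. assert (a < t) by (apply ha; left; auto).
    assert (a <> o) by (intros ->; apply hn; left; auto).
    destruct (@exec_copy a o t m) as (m' & e & c & k); try lia.
    exists (set_reg m' o (S (m' o))). split; [eapply ex_seq; [exact e|constructor]|].
    rewrite set_eq. split; [now rewrite c|]. intros r hr hro. rewrite set_ne by auto. apply k; lia.
  - inversion he as [| |i' v hi E| | | |]; subst. rewrite length_map in hi.
    assert (hin : In (nth i args 0) args) by (apply nth_In; auto).
    assert (nth i args 0 < t) by (apply ha; auto).
    assert (nth i args 0 <> o) by (intros e; apply hn; rewrite <- e; auto).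
    destruct (@exec_copy (nth i args 0) o t m) as (m' & e & c & k); try lia.
    exists m'. split; auto. split; [|intros; apply k; lia].
    rewrite c. rewrite (nth_indep (map m args) 0 (m 0)) by (rewrite length_map; auto). now rewrite map_nth.
  - inversion he as [| | |f' gs' v ws y' hws hf| | |]; subst.
    set (n := length gs).
    assert (G : forall l j ws m, Forall computes l -> t <= j -> j + length l = t + n ->
      evals l (map m args) ws ->
      exists m', exec ((fix go (l : list rf) (j : nat) : prog :=
               match l with
               | [] => PSkip
               | g :: l' => PSeq (rfprog g args j (t + n)) (go l' (S j))
               end) l j) m m' /\ map m' (seq j (length l)) = ws /\
        forall r, r < j -> m' r = m r).
    { clear -ha. induction l as [|g l IH]; intros j ws m hl hj hlen hev.
      - inversion hev; subst. exists m. split; [constructor|]. auto.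
      - inversion hev as [|g' gs' v w ws' h1 h2]; subst. inversion hl as [|? ? hg hl']; subst.
        cbn [length] in hlen.
        destruct (hg args j (t + n) m w) as (m1 & e1 & c1 & k1); auto.
        + intros a hin. specialize (ha a hin). lia.
        + lia.
        + intros hin. specialize (ha j hin). lia.
        + destruct (IH (S j) ws' m1) as (m2 & e2 & c2 & k2); auto; try lia.
          { rewrite (map_eq_on args m m1); auto. intros a hin. specialize (ha a hin). apply k1; lia. }
          exists m2. split; [eapply ex_seq; eauto|]. split.
          * cbn [seq map length]. rewrite c2, k2, c1 by lia. auto.
          * intros r hr. rewrite k2, k1; lia. }
    destruct (G gs t ws m) as (m1 & e1 & c1 & k1); auto; try lia.
    destruct (IHf (seq t n) o (t + n) m1 y) as (m2 & e2 & c2 & k2).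
    + intros a hin. apply in_seq in hin. lia.
    + lia.
    + intros hin. apply in_seq in hin. lia.
    + unfold n. now rewrite c1.
    + exists m2. split; [eapply ex_seq; eauto|]. split; auto. intros r hr hro.
      rewrite k2, k1; auto; lia.
  - destruct args as [|a rest]; [inversion he|]. cbn [hd tl].
    assert (hat : a < t) by (apply ha; left; auto).
    assert (har : forall x, In x rest -> x < t) by (intros; apply ha; right; auto).
    destruct (@exec_copy a (t + 2) (t + 4) m) as (m1 & e1 & c1 & k1); try lia.
    destruct (exec_clear t m1) as (m2 & e2 & c2 & k2).
    cbn [map] in he. destruct (prec_chain he) as (ys & hy0 & hys & hyn).
    assert (mr2 : map m2 rest = map m rest).
    { apply map_eq_on. intros x hx. specialize (har x hx). rewrite k2, k1; lia. }
    destruct (IHf rest (t + 1) (t + 4) m2 (ys 0)) as (m3 & e3 & c3 & k3).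
    { intros x hx. specialize (har x hx). lia. }
    { lia. }
    { intros hx. specialize (har _ hx). lia. }
    { now rewrite mr2. }
    assert (L : forall d i m0, i + d = m a ->
      m0 t = i -> m0 (t + 1) = ys i -> m0 (t + 2) = d -> map m0 rest = map m rest ->
      exists m', exec (PLoop (t + 2) (PSeq (rfprog g (t :: (t + 1) :: rest) (t + 3) (t + 4))
                               (PSeq (copy (t + 3) (t + 1) (t + 4)) (PInc t)))) m0 m' /\
        m' (t + 1) = y /\ forall r, r < t -> m' r = m0 r).
    { induction d as [|d IHd]; intros i m0 hi ht ht1 ht2 hrest.
      - exists m0. split; [now constructor|]. split; auto. rewrite ht1, <- hyn. f_equal; lia.
      - set (n0 := set_reg m0 (t + 2) d).
        assert (N0 : forall r, r < t + 2 -> n0 r = m0 r) by (intros; apply set_ne; lia).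
        assert (hr0 : map n0 rest = map m rest).
        { rewrite <- hrest. apply map_eq_on. intros x hx. specialize (har x hx). apply N0; lia. }
        destruct (IHg (t :: (t + 1) :: rest) (t + 3) (t + 4) n0 (ys (S i))) as (n1 & f1 & d1 & l1).
        { intros x [<-|[<-|hx]]; try lia. specialize (har x hx). lia. }
        { lia. }
        { intros [h|[h|hx]]; try lia. specialize (har _ hx). lia. }
        { cbn [map]. rewrite hr0, !N0, ht, ht1 by lia. apply hys; lia. }
        destruct (@exec_copy (t + 3) (t + 1) (t + 4) n1) as (n2 & f2 & d2 & l2); try lia.
        set (n3 := set_reg n2 t (S (n2 t))).
        assert (N3 : forall r, r < t -> n3 r = m0 r).
        { intros r hr. unfold n3. rewrite set_ne, l2, l1, N0; auto; lia. }
        destruct (IHd (S i) n3) as (n4 & f4 & d4 & l4).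
        { lia. }
        { unfold n3. rewrite set_eq, l2, l1, N0; lia. }
        { unfold n3. rewrite set_ne, d2, d1; auto; lia. }
        { unfold n3. rewrite set_ne, l2, l1 by lia. apply set_eq. }
        { rewrite <- hrest. apply map_eq_on. intros x hx. apply N3. apply har; auto. }
        exists n4. split; [|split; auto].
        + apply ex_loopS with n3; [lia| |exact f4].
          replace (m0 (t + 2) - 1) with d by lia. fold n0.
          eapply ex_seq; [exact f1|]. eapply ex_seq; [exact f2|constructor].
        + intros r hr. rewrite l4, N3; auto. }
    destruct (L (m a) 0 m3) as (m4 & e4 & c4 & k4); auto.
    { rewrite k3; auto; lia. }
    { rewrite k3, k2, c1; lia. }
    { rewrite <- mr2. apply map_eq_on. intros x hx. specialize (har x hx). apply k3; lia. }
    destruct (@exec_copy (t + 1) o (t + 4) m4) as (m5 & e5 & c5 & k5); try lia.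
    exists m5. split; [|split].
    + do 4 (eapply ex_seq; eauto).
    + congruence.
    + intros r hr hro. rewrite k5, k4, k3, k2, k1; lia.
  - inversion he as [| | | | | |f' v n hn0 hlt E]; subst.
    destruct (exec_clear t m) as (m1 & e1 & c1 & k1).
    assert (V : exists ys, ys y = 0 /\ (forall i, i < y -> ys i <> 0) /\
      forall i, i <= y -> eval f (i :: map m args) (ys i)).
    { assert (H : forall i, exists z, i <= y -> (i = y -> z = 0) /\ (i < y -> z <> 0) /\ eval f (i :: map m args) z).
      { intros i. destruct (lt_eq_lt_dec i y) as [[l| ->]|l].
        - destruct (hlt i l) as (z & hz & ez). exists z. intros _. repeat split; auto; lia.
        - exists 0. intros _. repeat split; auto; lia.
        - exists 0. lia. }
      destruct (functional_choice _ H) as [ys hys]. exists ys. split; [|split].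
      - now apply hys.
      - intros i hi. apply hys; lia.
      - intros i hi. now apply hys. }
    destruct V as (ys & hy & hne & hev).
    assert (B : forall i m0, i <= y -> m0 t = i -> map m0 args = map m args ->
      exists m', exec (rfprog f (t :: args) (t + 1) (t + 2)) m0 m' /\ m' (t + 1) = ys i /\ m' t = i /\
        forall r, r < t -> m' r = m0 r).
    { intros i m0 hi ht hargs. destruct (IHf (t :: args) (t + 1) (t + 2) m0 (ys i)) as (m' & e' & c' & k').
      - intros x [<-|hx]; try lia. specialize (ha x hx). lia.
      - lia.
      - intros [h|hx]; try lia. specialize (ha _ hx). lia.
      - cbn [map]. rewrite ht, hargs. auto.
      - exists m'. split; auto. split; auto. split; [rewrite k'; lia|]. intros; apply k'; lia. }
    destruct (B 0 m1) as (m2 & e2 & c2 & t2 & k2); try lia.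
    { apply map_eq_on. intros x hx. specialize (ha x hx). apply k1; lia. }
    assert (L : forall d i m0, i + d = y -> m0 t = i -> m0 (t + 1) = ys i -> map m0 args = map m args ->
      exists m', exec (PLoop (t + 1) (PSeq (PInc t) (rfprog f (t :: args) (t + 1) (t + 2)))) m0 m' /\
        m' t = y /\ forall r, r < t -> m' r = m0 r).
    { induction d as [|d IHd]; intros i m0 hi ht ht1 hargs.
      - exists m0. split; [constructor; rewrite ht1, <- hy; f_equal; lia|]. split; auto; lia.
      - set (n0 := set_reg m0 (t + 1) (m0 (t + 1) - 1)). set (n1 := set_reg n0 t (S (n0 t))).
        assert (N1 : forall r, r < t -> n1 r = m0 r).
        { intros r hr. unfold n1, n0. rewrite !set_ne; lia. }
        assert (hr1 : map n1 args = map m args).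
        { rewrite <- hargs. apply map_eq_on. intros x hx. apply N1, ha, hx. }
        destruct (B (S i) n1) as (n2 & f2 & d2 & b2 & l2); auto; try lia.
        { unfold n1, n0. rewrite set_eq, set_ne; lia. }
        destruct (IHd (S i) n2) as (n3 & f3 & d3 & l3); auto; try lia.
        { rewrite <- hr1. apply map_eq_on. intros x hx. apply l2, ha, hx. }
        exists n3. split; [|split; auto].
        + apply ex_loopS with n2; [rewrite ht1; apply hne; lia| |exact f3].
          eapply ex_seq; [constructor|]. exact f2.
        + intros r hr. rewrite l3, l2, N1; auto. }
    destruct (L y 0 m2) as (m3 & e3 & c3 & k3); auto; try lia.
    { apply map_eq_on. intros x hx. specialize (ha x hx). rewrite k2, k1; lia. }
    destruct (@exec_copy t o (t + 2) m3) as (m4 & e4 & c4 & k4); try lia.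
    exists m4. split; [|split].
    + do 3 (eapply ex_seq; eauto).
    + congruence.
    + intros r hr hro. rewrite k4, k3, k2, k1; lia.
Qed.

(** * Register machines *)

Inductive instr := INC (r : nat) | DEC (r j : nat) | JMP (j : nat).

Definition mstep (P : list instr) (c : nat * store) : nat * store :=
  let (pc, m) := c in
  match nth_error P pc with
  | Some (INC r) => (S pc, set_reg m r (S (m r)))
  | Some (DEC r j) => if m r =? 0 then (j, m) else (S pc, set_reg m r (m r - 1))
  | Some (JMP j) => (j, m)
  | None => c
  end.

Definition mrun (P : list instr) (n : nat) (c : nat * store) : nat * store := Nat.iter n (mstep P) c.

Lemma mrun_add P n n' c : mrun P (n + n') c = mrun P n' (mrun P n c).
Proof. unfold mrun. rewrite Nat.add_comm. apply Nat.iter_add. Qed.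

Fixpoint plen (p : prog) : nat :=
  match p with
  | PSkip => 0 | PInc _ => 1 | PSeq p q => plen p + plen q | PLoop _ p => plen p + 2
  end.

Fixpoint code (p : prog) (b : nat) : list instr :=
  match p with
  | PSkip => []
  | PInc r => [INC r]
  | PSeq p q => code p b ++ code q (b + plen p)
  | PLoop r p => DEC r (b + plen p + 2) :: code p (S b) ++ [JMP b]
  end.

Lemma code_len p b : length (code p b) = plen p.
Proof. revert b; induction p; intros b; simpl; rewrite ?length_app, ?IHp, ?IHp1, ?IHp2; simpl; lia. Qed.

Lemma code_run p m m' : exec p m m' -> forall P A C b, P = A ++ code p b ++ C -> length A = b ->
  exists n, mrun P n (b, m) = (b + plen p, m').
Proof.
  induction 1 as [m|r m|p q m1 m2 m3 _ IH1 _ IH2|r p m h|r p m1 m2 m3 h _ IH1 _ IH2];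
    intros P A C b hP hA; cbn [code plen] in *.
  - exists 0. now rewrite Nat.add_0_r.
  - exists 1. cbn. subst P. rewrite nth_error_app2, hA, Nat.sub_diag by lia. cbn. now rewrite Nat.add_1_r.
  - destruct (IH1 P A (code q (b + plen p) ++ C) b) as (n1 & e1); auto.
    { now rewrite hP, <- app_assoc. }
    destruct (IH2 P (A ++ code p b) C (b + plen p)) as (n2 & e2).
    { now rewrite hP, <- !app_assoc. }
    { rewrite length_app, code_len. lia. }
    exists (n1 + n2). rewrite mrun_add, e1, e2. f_equal. lia.
  - exists 1. cbn. subst P. rewrite nth_error_app2, hA, Nat.sub_diag by lia. cbn. rewrite h.
    cbn. f_equal. lia.
  - destruct (IH1 P (A ++ [DEC r (b + plen p + 2)]) ([JMP b] ++ C) (S b)) as (n1 & e1).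
    { rewrite hP, <- !app_assoc. cbn. now rewrite <- app_assoc. }
    { rewrite length_app. cbn. lia. }
    destruct (IH2 P A C b hP hA) as (n2 & e2).
    exists (1 + (n1 + (1 + n2))). rewrite !mrun_add.
    assert (E0 : mrun P 1 (@pair nat store b m1) = (S b, set_reg m1 r (m1 r - 1))).
    { cbn. rewrite hP, nth_error_app2, hA, Nat.sub_diag by lia. cbn.
      now rewrite (proj2 (Nat.eqb_neq _ _) h). }
    assert (E1 : mrun P 1 (@pair nat store (S b + plen p) m2) = (b, m2)).
    { change (mrun P 1 (S b + plen p, m2)) with (mstep P (S b + plen p, m2)). unfold mstep. subst P. rewrite nth_error_app2, hA by lia.
      replace (S b + plen p - b) with (S (plen p)) by lia. cbn.
      rewrite <- app_assoc, nth_error_app2, code_len, Nat.sub_diag by (rewrite code_len; lia). reflexivity. }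
    rewrite E0, e1, E1. exact e2.
Qed.

(* Runs [c] on register 0 and halts exactly when the result is nonzero. *)
Definition tester (c : rf) : list instr :=
  let p := rfprog c [0] 1 2 in code p 0 ++ [DEC 1 (plen p)].

Definition input (x : nat) : store := fun r => if r =? 0 then x else 0.

Lemma tester_run c x y : eval c [x] y -> exists n m,
  mrun (tester c) n (0, input x) = (plen (rfprog c [0] 1 2), m) /\ m 1 = y.
Proof.
  intros h. destruct (@rfprog_correct c [0] 1 2 (input x) y) as (m & e & hy & _); auto.
  - intros a [<-|[]]; lia.
  - intros [|[]]; lia.
  - destruct (code_run e [] [DEC 1 (plen (rfprog c [0] 1 2))] (eq_refl : tester c = _) eq_refl) as (n & hn).
    exists n, m. auto.
Qed.

Lemma tester_last c : nth_error (tester c) (plen (rfprog c [0] 1 2)) = Some (DEC 1 (plen (rfprog c [0] 1 2))).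
Proof. unfold tester. rewrite nth_error_app2; rewrite code_len; auto. now rewrite Nat.sub_diag. Qed.

Lemma tester_len c : length (tester c) = S (plen (rfprog c [0] 1 2)).
Proof. unfold tester. rewrite length_app, code_len. cbn. lia. Qed.

Lemma tester_halts c x : eval c [x] 1 ->
  exists n, fst (mrun (tester c) n (0, input x)) = length (tester c).
Proof.
  intros h. destruct (tester_run h) as (n & m & e & hm). exists (n + 1).
  rewrite mrun_add, e, tester_len. cbn. rewrite tester_last, hm. reflexivity.
Qed.

Lemma mrun_end P n c : fst c = length P -> mrun P n c = c.
Proof.
  intros h. induction n as [|n IH]; auto. change (mrun P (S n) c) with (mstep P (mrun P n c)).
  rewrite IH. destruct c as [pc m]. cbn in *.
  now rewrite (proj2 (nth_error_None P pc)) by lia.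
Qed.

(** The run reaches the last instruction with register 1 equal to 0 and jumps to itself forever. A
    halted run is stationary too, and the two stationary states differ at a common later time. *)
Lemma tester_loops c x : eval c [x] 0 ->
  forall n, fst (mrun (tester c) n (0, input x)) <> length (tester c).
Proof.
  intros h n E. destruct (tester_run h) as (n0 & m & e & hm).
  assert (S1 : forall k, mrun (tester c) k (plen (rfprog c [0] 1 2), m) = (plen (rfprog c [0] 1 2), m)).
  { induction k as [|k IH]; auto.
    change (mstep (tester c) (mrun (tester c) k (plen (rfprog c [0] 1 2), m)) = (plen (rfprog c [0] 1 2), m)).
    rewrite IH. unfold mstep. now rewrite tester_last, hm. }
  assert (E1 := mrun_add (tester c) n n0 (0, input x)). rewrite (@mrun_end _ n0 _ E) in E1.
  assert (E2 := mrun_add (tester c) n0 n (0, input x)). rewrite e, S1, (Nat.add_comm n0 n), E1 in E2.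
  rewrite E2, tester_len in E. cbn [fst] in E. lia.
Qed.

(* Machine configurations as level data: the control state is [fin], and the symbol at [x]
   records which registers hold the value [x]. *)
Fixpoint bits (k : nat) : Type := match k with 0 => unit | S j => (bool * bits j)%type end.

Fixpoint bget (k : nat) : bits k -> nat -> bool :=
  match k return bits k -> nat -> bool with
  | 0 => fun _ _ => false
  | S j => fun v i => match i with 0 => fst v | S i' => bget j (snd v) i' end
  end.

Fixpoint bmk (k : nat) (f : nat -> bool) : bits k :=
  match k return bits k with
  | 0 => tt
  | S j => (f 0, bmk j (fun i => f (S i)))
  end.

Lemma bget_bmk k f i : i < k -> bget k (bmk k f) i = f i.
Proof.
  revert f i. induction k as [|k IH]; intros f i h; [lia|].
  destruct i as [|i]; cbn; auto. apply (IH (fun i => f (S i))). lia.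
Qed.

Lemma bmk_ext k f g : (forall i, i < k -> f i = g i) -> bmk k f = bmk k g.
Proof.
  revert f g. induction k as [|k IH]; intros f g h; cbn; auto. f_equal; [apply h; lia|].
  apply IH. intros i hi. apply h; lia.
Qed.

Lemma finite_bits k : finite (bits k).
Proof.
  induction k; cbn; [|apply finite_prod; auto using finite_bool].
  exists 1, (fun _ => 0), (fun _ => tt). intros []; auto.
Qed.

(** * Register machines as level data *)

Section Machine.
Variables (P : list instr) (k : nat).
Definition ireg (i : instr) : nat := match i with INC r => r | DEC r _ => r | JMP _ => 0 end.
Definition itarget (i : instr) : nat := match i with DEC _ j => j | JMP j => j | INC _ => 0 end.
Hypothesis hP : forall i, In i P -> ireg i < k /\ itarget i <= length P.

Notation ctl := (fin (length P)).
Notation sym := (bits k).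

Definition cst_step (s : ctl) (g : sym) : ctl :=
  match nth_error P (fval _ s) with
  | Some (INC _) => fmk _ (S (fval _ s))
  | Some (DEC r j) => if bget k g r then fmk _ j else fmk _ (S (fval _ s))
  | Some (JMP j) => fmk _ j
  | None => s
  end.

(** Register [r] is a single mark at the cell of its value. [INC] moves the mark right and [DEC]
    moves it left, except that a mark at 0 stays, since a zero register is not decremented. *)
Definition sym_step (s : ctl) (z : bool) (gl g gr : sym) : sym :=
  bmk k (fun i =>
    match nth_error P (fval _ s) with
    | Some (INC r) => if i =? r then bget k gl i else bget k g i
    | Some (DEC r _) => if i =? r then (z && bget k g i) || bget k gr i else bget k g i
    | _ => bget k g i
    end).

Definition sym_blank : sym := bmk k (fun _ => false).
Definition ctl_halt (s : ctl) : bool := fval _ s =? length P.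

Lemma sym_step_blank s : sym_step s false sym_blank sym_blank sym_blank = sym_blank.
Proof.
  unfold sym_step, sym_blank. apply bmk_ext. intros i hi.
  rewrite !bget_bmk by auto. destruct (nth_error P _) as [[]|]; auto; now destruct (i =? _).
Qed.

Definition sym_of (m : store) (x : Z) : sym := bmk k (fun i => (x =? Z.of_nat (m i))%Z).

Lemma mstep_pc c : fst c <= length P -> fst (mstep P c) <= length P.
Proof.
  destruct c as [pc m]. cbn. intros h. destruct (nth_error P pc) as [i|] eqn:e; auto.
  assert (hlt : pc < length P) by (apply nth_error_Some; congruence).
  destruct (hP i (nth_error_In _ _ e)) as [_ h2].
  destruct i; cbn in *; try lia. destruct (m r =? 0); cbn; lia.
Qed.

Lemma machine_levels m0 n :
  let c := mrun P n (0, m0) in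
  fst c <= length P /\
  fst (lev cst_step sym_step sym_blank (fmk _ 0) (sym_of m0) n) = fmk _ (fst c) /\
  forall x, (0 <= x)%Z -> snd (lev cst_step sym_step sym_blank (fmk _ 0) (sym_of m0) n) x = sym_of (snd c) x.
Proof.
  induction n as [|n (IH1 & IH2 & IH3)]; [cbn; split; [lia|auto]|].
  cbv zeta in *. change (mrun P (S n) (0, m0)) with (mstep P (mrun P n (0, m0))).
  split; [now apply mstep_pc|].
  destruct (mrun P n (0, m0)) as [pc m]. cbn [fst snd] in *. cbn [lev].
  destruct (lev _ _ _ _ _ n) as [s g]. cbn [fst snd] in *. subst s. cbn [mstep].
  split.
  - unfold cst_step. rewrite fval_fmk by auto. rewrite IH3 by lia.
    destruct (nth_error P pc) as [i|] eqn:e; auto.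
    destruct (hP i (nth_error_In _ _ e)) as [h1 h2].
    destruct i as [r|r j|j]; cbn in *; auto. unfold sym_of. rewrite bget_bmk by auto.
    destruct (Nat.eqb_spec (m r) 0) as [->|]; auto.
    destruct (Z.eqb_spec 0 (Z.of_nat (m r))); auto; lia.
  - intros x hx. unfold gnext, sym_step. rewrite fval_fmk by auto.
    assert (hl : (if (x =? 0)%Z then sym_blank else g (x - 1)%Z) =
                 bmk k (fun i => negb (x =? 0)%Z && (x - 1 =? Z.of_nat (m i))%Z)).
    { destruct (Z.eqb_spec x 0); auto. apply IH3; lia. }
    rewrite hl, !IH3 by lia. unfold sym_of. apply bmk_ext. intros i hi. rewrite !bget_bmk by auto.
    destruct (nth_error P pc) as [ins|] eqn:e; auto.
    destruct ins as [r|r j|j]; cbn [fst snd]; auto.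
    + unfold set_reg. destruct (Nat.eqb_spec i r) as [->|]; auto.
      destruct (Z.eqb_spec x 0), (Z.eqb_spec (x - 1) (Z.of_nat (m r))), (Z.eqb_spec x (Z.of_nat (S (m r))));
        cbn; auto; lia.
    + destruct (Nat.eqb_spec (m r) 0) as [e0|]; cbn [snd].
      * destruct (Nat.eqb_spec i r) as [->|]; auto.
        destruct (Z.eqb_spec x 0), (Z.eqb_spec x (Z.of_nat (m r))), (Z.eqb_spec (x + 1) (Z.of_nat (m r)));
          cbn; auto; lia.
      * unfold set_reg. destruct (Nat.eqb_spec i r) as [->|]; auto.
        destruct (Z.eqb_spec x 0), (Z.eqb_spec x (Z.of_nat (m r))), (Z.eqb_spec (x + 1) (Z.of_nat (m r))),
          (Z.eqb_spec x (Z.of_nat (m r - 1)));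
          cbn; auto; lia.
Qed.
End Machine.

Fixpoint pmax (p : prog) : nat :=
  match p with
  | PSkip => 0 | PInc r => r | PSeq p q => Nat.max (pmax p) (pmax q) | PLoop r p => Nat.max r (pmax p)
  end.

Lemma code_wf p b i : In i (code p b) -> ireg i <= pmax p /\ itarget i <= b + plen p.
Proof.
  revert b. induction p as [|r|p IHp q IHq|r p IHp]; intros b; cbn.
  - intros [].
  - intros [<-|[]]; cbn; lia.
  - rewrite in_app_iff. intros [h|h]; [apply IHp in h|apply IHq in h]; lia.
  - intros [<-|h]; [cbn; lia|]. apply in_app_iff in h as [h|[<-|[]]]; [apply IHp in h|cbn]; lia.
Qed.

Lemma tester_wf c i : In i (tester c) ->
  ireg i < S (S (pmax (rfprog c [0] 1 2))) /\ itarget i <= length (tester c).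
Proof.
  rewrite tester_len. unfold tester. rewrite in_app_iff. intros [h|[<-|[]]]; [apply code_wf in h|cbn]; lia.
Qed.

(** * Topological entropy *)

Local Open Scope R_scope.

Lemma bounded_max (P : nat -> Prop) (M : nat) : P 0%nat -> (forall n, P n -> (n <= M)%nat) ->
  exists N, P N /\ forall n, P n -> (n <= N)%nat.
Proof.
  intros h0. induction M as [|M IH]; intros hM.
  - exists 0%nat. auto.
  - destruct (classic (P (S M))) as [h|h]; [exists (S M); auto|].
    apply IH. intros n hn. specialize (hM n hn). assert (n <> S M) by (intros ->; auto). lia.
Qed.

Lemma least_exists (P : nat -> Prop) n : P n -> exists m, P m /\ forall j, (j < m)%nat -> ~ P j.
Proof.
  induction n as [n IH] using lt_wf_ind. intros hn.
  destruct (classic (exists j, (j < n)%nat /\ P j)) as [(j & hj & hp)|h]; [eauto|].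
  exists n. split; auto. intros j hj hp. apply h. eauto.
Qed.

Lemma pow_inv_lt i j : (i < j)%nat -> / 2 ^ j < / 2 ^ i.
Proof.
  intros h. apply Rinv_lt_contravar; [|apply Rlt_pow; [lra|auto]].
  apply Rmult_lt_0_compat; apply pow_lt; lra.
Qed.

(** Distances are 0 or powers of one half, so separation at scale [eps] amounts to a difference
    among the first [m] letters. This turns the metric definition of entropy into counting. *)
Lemma depth_exists eps : eps > 0 -> exists m, forall i, (i < m)%nat <-> / 2 ^ i > eps.
Proof.
  intros he. assert (E : exists N, / 2 ^ N <= eps).
  { destruct (pow_lt_1_zero (/ 2)) with (y := eps) as [N hN]; auto.
    - rewrite Rabs_right; lra.
    - exists N. specialize (hN N (le_n N)). rewrite pow_inv in hN.
      apply Rabs_def2 in hN. lra. }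
  destruct E as [N hN]. destruct (least_exists (fun i => / 2 ^ i <= eps) N hN) as (m & h1 & h2).
  exists m. intros i. split.
  - intros h. apply Rnot_le_gt. auto.
  - intros h. destruct (le_lt_dec m i) as [l|]; auto. exfalso.
    destruct (Nat.eq_dec m i) as [->|]; [lra|]. pose proof (@pow_inv_lt m i ltac:(lia)). lra.
Qed.

Lemma limsup_exists (u : nat -> R) (C : R) : (forall n, 0 <= u n <= C) -> exists l, is_limsup u l.
Proof.
  intros hu. set (E := fun x => forall N, exists n, (N <= n)%nat /\ u n > x).
  destruct (completeness E) as [l [h1 h2]].
  - exists C. intros x hx. destruct (hx 0%nat) as (n & _ & h). specialize (hu n). lra.
  - exists (-1). intros N. exists N. split; auto. specialize (hu N). lra.
  - exists l. intros e he. split.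
    + assert (hn : ~ E (l + e / 2)) by (intros h; specialize (h1 _ h); lra).
      apply not_all_ex_not in hn as [N hN]. exists N. intros n hn.
      apply Rnot_ge_lt. intros h. apply hN. exists n. split; auto; lra.
    + intros N. destruct (classic (exists x, E x /\ x > l - e)) as [(x & hx & hxl)|h].
      * destruct (hx N) as (n & hn & hu'). exists n. split; auto; lra.
      * exfalso. assert (l <= l - e); [|lra]. apply h2. intros x hx.
        apply Rnot_gt_le. intros hg. apply h. eauto.
Qed.

Lemma limsup_le u v l l' : (forall n, u n <= v n) -> is_limsup u l -> is_limsup v l' -> l <= l'.
Proof.
  intros h hu hv. apply Rnot_gt_le. intros hg.
  destruct (hu ((l - l') / 2)) as [_ h1]; [lra|].
  destruct (hv ((l - l') / 2)) as [[N h2] _]; [lra|].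
  destruct (h1 N) as (n & hn & h3). specialize (h2 n hn). specialize (h n). lra.
Qed.

Lemma limsup_ub u l C D : 0 <= D -> (forall n, u n <= C + D / INR (S n)) -> is_limsup u l -> l <= C.
Proof.
  intros hD h hu. apply Rnot_gt_le. intros hg. destruct (hu ((l - C) / 2)) as [_ h1]; [lra|].
  destruct (INR_unbounded (D * (2 / (l - C)))) as [N hN].
  destruct (h1 N) as (n & hn & h2). specialize (h n).
  assert (hS : 0 < INR (S n)) by apply lt_0_INR, Nat.lt_0_succ.
  assert (D / INR (S n) < (l - C) / 2); [|lra].
  apply Rmult_lt_reg_r with (INR (S n)); auto. unfold Rdiv at 1. rewrite Rmult_assoc, Rinv_l, Rmult_1_r by lra.
  assert (INR N <= INR (S n)) by (apply le_INR; lia).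
  apply Rmult_lt_reg_r with (2 / (l - C)); [apply Rdiv_lt_0_compat; lra|].
  replace ((l - C) / 2 * INR (S n) * (2 / (l - C))) with (INR (S n)) by (field; lra). lra.
Qed.

Lemma limsup_lb u l C : (forall n, C <= u n) -> is_limsup u l -> C <= l.
Proof.
  intros h hu. apply Rnot_gt_le. intros hg. destruct (hu (C - l)) as [[N h1] _]; [lra|].
  specialize (h1 N (le_n N)). specialize (h N). lra.
Qed.

Lemma ln2_pos : 0 < ln 2.
Proof. rewrite <- ln_1. apply ln_increasing; lra. Qed.

Lemma log2_le x y : 0 < x -> x <= y -> log2 x <= log2 y.
Proof.
  intros hx h. unfold log2. apply Rmult_le_compat_r; [left; apply Rinv_0_lt_compat, ln2_pos|].
  destruct h as [h|<-]; [left; now apply ln_increasing|lra].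
Qed.

Lemma log2_lt x y : 0 < x -> x < y -> log2 x < log2 y.
Proof.
  intros hx h. unfold log2. apply Rmult_lt_compat_r; [apply Rinv_0_lt_compat, ln2_pos|].
  now apply ln_increasing.
Qed.

Lemma log2_1 : log2 1 = 0.
Proof. unfold log2. rewrite ln_1. unfold Rdiv. ring. Qed.

Lemma log2_mult x y : 0 < x -> 0 < y -> log2 (x * y) = log2 x + log2 y.
Proof. intros. unfold log2. rewrite ln_mult by auto. unfold Rdiv. ring. Qed.

Lemma log2_pow x n : 0 < x -> log2 (x ^ n) = INR n * log2 x.
Proof.
  intros h. induction n as [|n IH]; [simpl; rewrite log2_1; ring|].
  rewrite S_INR. simpl pow. rewrite log2_mult, IH by (auto; now apply pow_lt). ring.
Qed.

Section Entropy.
Variables (k : nat) (F : config -> config).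

Definition same (n m : nat) (x y : config) : Prop :=
  forall t i, (t < n)%nat -> (i < m)%nat -> Nat.iter t F x i = Nat.iter t F y i.

Definition sep (n m : nat) (L : list config) : Prop :=
  (forall x, In x L -> in_space k x) /\
  forall i j, (i < j)%nat -> (j < length L)%nat ->
    ~ same n m (nth i L (fun _ => 0%nat)) (nth j L (fun _ => 0%nat)).

Lemma nsep_same n m eps x y : eps > 0 -> (forall i, (i < m)%nat <-> / 2 ^ i > eps) ->
  nsep F n eps x y <-> ~ same n m x y.
Proof.
  intros he hm. split.
  - intros (t & ht & d & [[_ ->]|(i & h1 & _ & ->)] & hd); [lra|]. intros hs. apply h1, hs; auto.
    now apply hm.
  - intros h. apply not_all_ex_not in h as [t h]. apply not_all_ex_not in h as [i h].
    apply imply_to_and in h as [ht h]. apply imply_to_and in h as [hi h].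
    destruct (least_exists (fun i => Nat.iter t F x i <> Nat.iter t F y i) i h) as (j & h1 & h2).
    exists t. split; auto. exists (/ 2 ^ j). split.
    + right. exists j. split; auto. split; auto. intros j' hj'. now apply NNPP, h2.
    + apply hm. destruct (le_lt_dec j i); [lia|]. exfalso. now apply (h2 i).
Qed.

Lemma separated_sep n m eps L : eps > 0 -> (forall i, (i < m)%nat <-> / 2 ^ i > eps) ->
  separated_set k F n eps L <-> sep n m L.
Proof.
  intros he hm. unfold separated_set, sep.
  split; intros [h1 h2]; split; auto; intros i j hi hj; apply (@nsep_same n m eps _ _ he hm); auto.
Qed.

Variable a : nat.
Hypothesis hk : (1 <= k)%nat.
Hypothesis ha : (1 <= a)%nat.
Hypothesis bound : forall m, exists D, (1 <= D)%nat /\ forall n L, sep n m L -> (length L <= a ^ n * D)%nat.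

Lemma sep_nil n m : sep n m [].
Proof. split; [intros x []|]. simpl. intros; lia. Qed.

Lemma sep_one n m : sep n m [fun _ => 0%nat].
Proof. split; [intros x [<-|[]] i; lia|]. simpl. intros; lia. Qed.

Lemma max_exists n m : exists N, (exists L, sep n m L /\ length L = N) /\ forall L, sep n m L -> (length L <= N)%nat.
Proof.
  destruct (bound m) as (D & _ & hD).
  destruct (@bounded_max (fun N => exists L, sep n m L /\ length L = N) (a ^ n * D)) as (N & h1 & h2).
  - exists []. split; auto using sep_nil.
  - intros N (L & hL & <-). auto.
  - exists N. split; auto. intros L hL. apply h2. eauto.
Qed.

(** The growth rate [LS m] at depth [m] is at most [log2 a], because the factor [D] disappears in
    the limit, and it increases with [m]; the entropy is its supremum. Hence orbits that are already
    separated at depth 1 give a lower bound. *)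
Theorem entropy_exists : exists h, is_entropy k F h /\ 0 <= h <= log2 (INR a) /\
  forall c, (1 <= c)%nat -> (forall n, exists L, sep n 1 L /\ (c ^ n <= length L)%nat) -> log2 (INR c) <= h.
Proof.
  destruct (functional_choice _ (fun p => max_exists (fst p) (snd p))) as [s hs].
  set (N := fun n m => s (n, m)).
  assert (hN : forall n m, (exists L, sep n m L /\ length L = N n m) /\
    forall L, sep n m L -> (length L <= N n m)%nat) by (intros n m; apply (hs (n, m))).
  clearbody N. clear s hs.
  set (v := fun m n => log2 (INR (N (S n) m)) / INR (S n)).
  assert (pS : forall n, 0 < INR (S n)) by (intros; apply lt_0_INR; lia).
  assert (N1 : forall n m, 1 <= INR (N n m)).
  { intros n m. change 1 with (INR 1). apply le_INR. apply (proj2 (hN n m) _ (@sep_one n m)). }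
  assert (v0 : forall m n, 0 <= v m n).
  { intros m n. unfold v. apply Rmult_le_pos; [|left; now apply Rinv_0_lt_compat].
    rewrite <- log2_1. apply log2_le; auto; lra. }
  assert (hla : 0 <= log2 (INR a)).
  { rewrite <- log2_1. apply log2_le; [lra|]. change 1 with (INR 1). now apply le_INR. }
  assert (vD : forall m, exists D, 0 <= D /\ forall n, v m n <= log2 (INR a) + D / INR (S n)).
  { intros m. destruct (bound m) as (D & hD1 & hD). exists (log2 (INR D)).
    assert (1 <= INR D) by (change 1 with (INR 1); now apply le_INR).
    split; [rewrite <- log2_1; apply log2_le; lra|]. intros n. unfold v.
    destruct (proj1 (hN (S n) m)) as (L & hL & e). specialize (hD _ _ hL). rewrite e in hD.
    apply Rle_trans with (log2 (INR a ^ S n * INR D) / INR (S n)).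
    - apply Rmult_le_compat_r; [left; now apply Rinv_0_lt_compat|].
      apply log2_le; [specialize (N1 (S n) m); lra|]. rewrite <- pow_INR, <- mult_INR. now apply le_INR.
    - assert (0 < INR a) by (apply lt_0_INR; lia).
      rewrite log2_mult, log2_pow by (try apply pow_lt; lra).
      apply Req_le. field. specialize (pS n). lra. }
  assert (vb : forall m, exists C, forall n, 0 <= v m n <= C).
  { intros m. destruct (vD m) as (D & hD & h). exists (log2 (INR a) + D). intros n. split; auto.
    apply Rle_trans with (1 := h n). apply Rplus_le_compat_l.
    rewrite <- (Rmult_1_r D) at 2. apply Rmult_le_compat_l; auto.
    rewrite <- Rinv_1. apply Rinv_le_contravar; [lra|]. change 1 with (INR 1). apply le_INR. lia. }
  assert (lE : forall m, exists l, is_limsup (v m) l).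
  { intros m. destruct (vb m) as [C hC]. exact (limsup_exists _ hC). }
  destruct (functional_choice _ lE) as [LS hLS].
  assert (LSmono : forall m m', (m <= m')%nat -> LS m <= LS m').
  { intros m m' h. apply limsup_le with (v m) (v m'); auto. intros n. unfold v.
    apply Rmult_le_compat_r; [left; now apply Rinv_0_lt_compat|].
    apply log2_le; [specialize (N1 (S n) m); lra|]. apply le_INR.
    destruct (proj1 (hN (S n) m)) as (L & [hL1 hL2] & <-). apply hN. split; auto.
    intros i j hi hj hs. apply (hL2 i j hi hj). intros t i' ht hi'. apply hs; auto; lia. }
  assert (LSub : forall m, LS m <= log2 (INR a)).
  { intros m. destruct (vD m) as (D & hD & h). exact (limsup_ub hD h (hLS m)). }
  assert (LS0 : forall m, 0 <= LS m) by (intros m; exact (limsup_lb (v0 m) (hLS m))).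
  destruct (completeness (fun x => exists m, x = LS m)) as [h [h1 h2]].
  { exists (log2 (INR a)). intros x [m ->]. auto. }
  { exists (LS 0%nat). eauto. }
  assert (hub : forall m, LS m <= h) by (intros m; apply h1; eauto).
  exists h. split; [|split].
  - assert (dE : forall eps, exists m, eps > 0 -> forall i, (i < m)%nat <-> / 2 ^ i > eps).
    { intros eps. destruct (classic (eps > 0)) as [he|he].
      - destruct (depth_exists he) as [m hm]. eauto.
      - exists 0%nat. tauto. }
    destruct (functional_choice _ dE) as [dp hdp].
    exists (fun n eps => N (S n) (dp eps)), (fun eps => LS (dp eps)). split; [|split].
    + intros n eps he. destruct (hN (S n) (dp eps)) as [(L & hL & e) hm]. split.
      * exists L. split; auto. now apply (separated_sep (S n) L he (hdp eps he)).
      * intros L' hL'. apply hm. now apply (separated_sep (S n) L' he (hdp eps he)).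
    + intros eps he. apply hLS.
    + intros eta heta.
      assert (exists m, LS m > h - eta) as [m hm].
      { apply NNPP. intros hne. assert (h <= h - eta); [|lra]. apply h2. intros x [m ->].
        apply Rnot_gt_le. intros hg. apply hne. eauto. }
      exists (/ 2 ^ m). split; [apply Rinv_0_lt_compat, pow_lt; lra|]. intros eps [he1 he2].
      assert (m < dp eps)%nat by (apply hdp; auto).
      pose proof (@LSmono m (dp eps) ltac:(lia)). pose proof (hub (dp eps)).
      rewrite Rabs_left1; lra.
  - split; [apply Rle_trans with (LS 0%nat); auto|]. apply h2. intros x [m ->]. auto.
  - intros c hc hs. apply Rle_trans with (LS 1%nat); auto. apply limsup_lb with (v 1%nat); auto.
    assert (0 < INR c) by (apply lt_0_INR; lia).
    intros n. unfold v. destruct (hs (S n)) as (L & hL & hl).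
    apply Rmult_le_reg_r with (INR (S n)); auto.
    unfold Rdiv. rewrite Rmult_assoc, Rinv_l, Rmult_1_r by (specialize (pS n); lra).
    rewrite Rmult_comm, <- log2_pow by auto. apply log2_le; [now apply pow_lt|].
    rewrite <- pow_INR. apply le_INR. pose proof (proj2 (hN (S n) 1%nat) L hL). lia.
Qed.
End Entropy.

(** * Counting orbits by codes of finite words *)

Section Counting.
Variables (k : nat) (F : config -> config).

Lemma sep_le n m M (c : config -> nat) L :
  (forall x, In x L -> (c x < M)%nat) ->
  (forall x y, In x L -> In y L -> c x = c y -> same F n m x y) ->
  sep k F n m L -> (length L <= M)%nat.
Proof.
  intros h1 h2 [_ h3]. rewrite <- (length_map c L), <- (length_seq M 0).
  apply NoDup_incl_length.
  - apply NoDup_nth with (d := c (fun _ => 0%nat)). rewrite length_map. intros i j hi hj e.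
    rewrite !map_nth in e.
    destruct (lt_eq_lt_dec i j) as [[l|]|l]; auto; exfalso.
    + apply (h3 i j l hj). apply h2; auto; apply nth_In; auto.
    + apply (h3 j i l hi). apply h2; auto; apply nth_In; auto.
  - intros z hz. apply in_map_iff in hz as (x & <- & hx). apply in_seq. specialize (h1 x hx). lia.
Qed.

Lemma digits_inj b c d u v : (c < b)%nat -> (d < b)%nat -> (c + b * u = d + b * v)%nat -> c = d /\ u = v.
Proof.
  intros hc hd e. destruct (lt_eq_lt_dec u v) as [[l| ->]|l]; [|lia|].
  - assert (b * S u <= b * v)%nat by (apply Nat.mul_le_mono_l; lia). lia.
  - assert (b * S v <= b * u)%nat by (apply Nat.mul_le_mono_l; lia). lia.
Qed.

Fixpoint wcode (b p : nat) (x : config) : nat :=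
  match p with 0%nat => 0%nat | S q => (x 0%nat + b * wcode b q (fun i => x (S i)))%nat end.

Lemma wcode_lt b p x : (forall i, (i < p)%nat -> (x i < b)%nat) -> (wcode b p x < b ^ p)%nat.
Proof.
  revert x. induction p as [|p IH]; intros x h; simpl; [lia|].
  pose proof (h 0%nat ltac:(lia)). specialize (IH (fun i => x (S i)) ltac:(intros; apply h; lia)). nia.
Qed.

Lemma wcode_inj b p x y : (forall i, (i < p)%nat -> (x i < b)%nat) -> (forall i, (i < p)%nat -> (y i < b)%nat) ->
  wcode b p x = wcode b p y -> forall i, (i < p)%nat -> x i = y i.
Proof.
  revert x y. induction p as [|p IH]; intros x y hx hy e i hi; [lia|]. simpl in e.
  pose proof (hx 0%nat ltac:(lia)). pose proof (hy 0%nat ltac:(lia)).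
  assert (x 0%nat = y 0%nat /\ wcode b p (fun i => x (S i)) = wcode b p (fun i => y (S i))) as [e1 e2] by (eapply digits_inj; eauto).
  destruct i as [|i]; auto.
  apply (IH (fun i => x (S i)) (fun i => y (S i))); auto; try lia; intros; [apply hx|apply hy]; lia.
Qed.
End Counting.

(** * Skew products over a cellular automaton *)

Local Open Scope nat_scope.

Definition rule3 (k : nat) (f : nat -> nat -> nat -> nat) : list nat :=
  map (fun i => f (i / k / k) ((i / k) mod k) (i mod k)) (seq 0 (k ^ 3)).

Lemma rule3_wf k f : (forall a b c, f a b c < k) -> wf_rule k 2 (rule3 k f).
Proof.
  intros h. split; unfold rule3.
  - now rewrite length_map, length_seq.
  - intros a ha. apply in_map_iff in ha as (i & <- & _). apply h.
Qed.

Lemma divmod_add k a b : b < k -> (a * k + b) / k = a /\ (a * k + b) mod k = b.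
Proof.
  intros h. rewrite Nat.div_add_l, Nat.div_small by lia.
  rewrite (Nat.add_comm (a * k) b), Nat.Div0.mod_add, Nat.mod_small by lia. lia.
Qed.

Lemma ca_rule3 k f x i : in_space k x -> ca k 2 (rule3 k f) x i = f (x i) (x (S i)) (x (S (S i))).
Proof.
  intros h. unfold ca, rule3. cbn [seq map word_index fold_left]. unfold word_index.
  cbn [fold_left]. rewrite Nat.mul_0_l, Nat.add_0_l.
  pose proof (h i). pose proof (h (S i)). pose proof (h (S (S i))).
  set (n := (x i * k + x (S i)) * k + x (S (S i))).
  assert (hn : n < k ^ 3).
  { assert (h1 : x i * k + x (S i) < k * k) by nia. unfold n. cbn [Nat.pow]. nia. }
  rewrite nth_indep with (d' := f (0 / k / k) ((0 / k) mod k) (0 mod k)) by (now rewrite length_map, length_seq).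
  rewrite (map_nth (fun j => f (j / k / k) ((j / k) mod k) (j mod k))), seq_nth by auto.
  rewrite Nat.add_0_l. unfold n.
  destruct (@divmod_add k (x i * k + x (S i)) (x (S (S i)))) as [-> ->]; auto.
  destruct (@divmod_add k (x i) (x (S i))) as [-> ->]; auto.
Qed.

Section Product.
Variables (N m : nat) (h : nat -> nat -> nat -> nat).
Hypothesis hN : 1 <= N.
Hypothesis hm : 1 <= m.
Hypothesis hlt : forall a b c, h a b c < N.
Hypothesis h0 : h 0 0 0 = 0.

Definition asize := N * m * m.
Definition pk (a x y : nat) : nat := (a * m + x) * m + y.
Definition pa (c : nat) : nat := c / m / m.
Definition px (c : nat) : nat := (c / m) mod m.
Definition py (c : nat) : nat := c mod m.

Definition ruleF3 (c0 c1 c2 : nat) : nat :=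
  pk (h (pa c0) (pa c1) (pa c2)) (py c0) ((px c0 + (if pa c0 =? 0 then 0 else py c1)) mod m).
Definition ruleG3 (c0 c1 c2 : nat) : nat :=
  pk (h (pa c0) (pa c1) (pa c2)) (py c0) (px c0).

Lemma pk_lt a x y : a < N -> x < m -> y < m -> pk a x y < asize.
Proof. unfold pk, asize. intros. assert (a * m + x < N * m) by nia. nia. Qed.

Lemma pk_proj a x y : x < m -> y < m -> pa (pk a x y) = a /\ px (pk a x y) = x /\ py (pk a x y) = y.
Proof.
  intros hx hy. unfold pa, px, py, pk. destruct (@divmod_add m (a * m + x) y hy) as [-> ->].
  destruct (@divmod_add m a x hx) as [-> ->]. auto.
Qed.

Lemma pk_eta c : pk (pa c) (px c) (py c) = c.
Proof.
  unfold pk, pa, px, py. pose proof (Nat.div_mod c m). pose proof (Nat.div_mod (c / m) m). nia.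
Qed.

Lemma pa_lt c : c < asize -> pa c < N.
Proof. intros hc. unfold pa, asize in *. apply Nat.Div0.div_lt_upper_bound, Nat.Div0.div_lt_upper_bound. lia. Qed.
Lemma px_lt c : px c < m. Proof. apply Nat.mod_upper_bound; lia. Qed.
Lemma py_lt c : py c < m. Proof. apply Nat.mod_upper_bound; lia. Qed.
Lemma mod_lt c : c mod m < m. Proof. apply Nat.mod_upper_bound; lia. Qed.

Lemma ruleF3_lt a b c : ruleF3 a b c < asize.
Proof. apply pk_lt; auto using py_lt, mod_lt. Qed.
Lemma ruleG3_lt a b c : ruleG3 a b c < asize.
Proof. apply pk_lt; auto using py_lt, px_lt. Qed.

Definition prodF := ca asize 2 (rule3 asize ruleF3).
Definition prodG := ca asize 2 (rule3 asize ruleG3).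
Definition basec (x : config) : config := fun i => pa (x i).
Definition fibx (x : config) : config := fun i => px (x i).
Definition fiby (x : config) : config := fun i => py (x i).
Definition baseca (a : config) : config := fun i => h (a i) (a (S i)) (a (S (S i))).

Lemma F_eq x : in_space asize x -> prodF x = fun i => ruleF3 (x i) (x (S i)) (x (S (S i))).
Proof. intros hx. apply functional_extensionality. intros i. now apply ca_rule3. Qed.
Lemma G_eq x : in_space asize x -> prodG x = fun i => ruleG3 (x i) (x (S i)) (x (S (S i))).
Proof. intros hx. apply functional_extensionality. intros i. now apply ca_rule3. Qed.

Lemma F_in x : in_space asize x -> in_space asize (prodF x).
Proof. intros hx i. rewrite F_eq by auto. apply ruleF3_lt. Qed.
Lemma G_in x : in_space asize x -> in_space asize (prodG x).
Proof. intros hx i. rewrite G_eq by auto. apply ruleG3_lt. Qed.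

Lemma iter_in (f : config -> config) : (forall x, in_space asize x -> in_space asize (f x)) ->
  forall n x, in_space asize x -> in_space asize (Nat.iter n f x).
Proof. intros hf n x hx. induction n; simpl; auto. Qed.

Lemma config_eq x y : basec x = basec y -> fibx x = fibx y -> fiby x = fiby y -> x = y.
Proof.
  intros e1 e2 e3. apply functional_extensionality. intros i.
  rewrite <- (pk_eta (x i)), <- (pk_eta (y i)).
  change (pk (basec x i) (fibx x i) (fiby x i) = pk (basec y i) (fibx y i) (fiby y i)). now rewrite e1, e2, e3.
Qed.

Lemma F_proj x : in_space asize x -> basec (prodF x) = baseca (basec x) /\ fibx (prodF x) = fiby x /\
  fiby (prodF x) = fun i => (fibx x i + (if basec x i =? 0 then 0 else fiby x (S i))) mod m.
Proof.
  intros hx. rewrite F_eq by auto. unfold basec, fibx, fiby, ruleF3.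
  repeat split; apply functional_extensionality; intros i; apply pk_proj; auto using py_lt, mod_lt.
Qed.

Lemma G_proj x : in_space asize x -> basec (prodG x) = baseca (basec x) /\ fibx (prodG x) = fiby x /\ fiby (prodG x) = fibx x.
Proof.
  intros hx. rewrite G_eq by auto. unfold basec, fibx, fiby, ruleG3.
  repeat split; apply functional_extensionality; intros i; apply pk_proj; auto using py_lt, px_lt.
Qed.

Lemma iterS (f : config -> config) n x : Nat.iter (S n) f x = Nat.iter n f (f x).
Proof. apply Nat.iter_succ_r. Qed.

Lemma iter_A (f : config -> config) : (forall x, in_space asize x -> in_space asize (f x)) ->
  (forall x, in_space asize x -> basec (f x) = baseca (basec x)) ->
  forall n x, in_space asize x -> basec (Nat.iter n f x) = Nat.iter n baseca (basec x).
Proof.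
  intros hf hA n x hx. induction n as [|n IH]; auto. simpl. rewrite hA, IH; auto using iter_in.
Qed.

Definition local3 (f : config -> config) : Prop :=
  forall x y i, in_space asize x -> in_space asize y ->
    x i = y i -> x (S i) = y (S i) -> x (S (S i)) = y (S (S i)) -> f x i = f y i.

Lemma F_local : local3 prodF.
Proof. intros x y i hx hy e1 e2 e3. rewrite !F_eq by auto. congruence. Qed.
Lemma G_local : local3 prodG.
Proof. intros x y i hx hy e1 e2 e3. rewrite !G_eq by auto. congruence. Qed.

Lemma iter_local f : local3 f -> (forall x, in_space asize x -> in_space asize (f x)) ->
  forall n x y i, in_space asize x -> in_space asize y ->
  (forall j, i <= j <= i + 2 * n -> x j = y j) -> Nat.iter n f x i = Nat.iter n f y i.
Proof.
  intros hl hf n. induction n as [|n IH]; intros x y i hx hy e.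
  - apply e; lia.
  - rewrite !iterS. apply IH; auto. intros j hj. apply hl; auto; apply e; lia.
Qed.

Lemma A_in x : in_space asize x -> in_space N (basec x).
Proof. intros hx i. apply pa_lt, hx. Qed.

Theorem entropy_local f : local3 f -> (forall x, in_space asize x -> in_space asize (f x)) ->
  exists e, is_entropy asize f e /\
  forall c, 1 <= c -> (forall n, exists L, sep asize f n 1 L /\ c ^ n <= length L) -> (log2 (INR c) <= e)%R.
Proof.
  intros hl hf. assert (hK : 1 <= asize) by (unfold asize; nia).
  destruct (@entropy_exists asize f (asize * asize)) as (e & h1 & _ & h2); try nia.
  - intros w. exists (asize ^ w). split; [pose proof (Nat.pow_nonzero asize w); lia|]. intros n L hL.
    apply (@sep_le asize f n w _ (wcode asize (w + 2 * n))) with (3 := hL).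
    + intros x hx. replace ((asize * asize) ^ n * asize ^ w) with (asize ^ (w + 2 * n)).
      * apply wcode_lt. intros i _. now apply (proj1 hL).
      * rewrite Nat.pow_add_r, Nat.pow_mul_r. replace (asize ^ 2) with (asize * asize) by (cbn; lia). lia.
    + intros x y hx hy e t i ht hi. apply (proj1 hL) in hx, hy.
      apply iter_local; auto. intros j hj. eapply wcode_inj; eauto. lia.
  - exists e. auto.
Qed.

(** The fibre part of [prodG] only swaps the two entries of its own cell, so information from the
    right enters through the base alone. This makes the growth rate of [prodG] independent of
    [m]. *)
Lemma iter_G_eq n x y i : in_space asize x -> in_space asize y ->
  (forall j, i <= j <= i + 2 * n -> basec x j = basec y j) -> x i = y i ->
  Nat.iter n prodG x i = Nat.iter n prodG y i.
Proof.
  revert x y. induction n as [|n IH]; intros x y hx hy e e'; auto.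
  rewrite !iterS. destruct (G_proj hx) as (a1 & _), (G_proj hy) as (b1 & _).
  apply IH; auto using G_in.
  - intros j hj. rewrite a1, b1. unfold baseca. now rewrite !e by lia.
  - rewrite !G_eq by auto. unfold ruleG3.
    change (pk (h (basec x i) (basec x (S i)) (basec x (S (S i)))) (py (x i)) (px (x i)) =
            pk (h (basec y i) (basec y (S i)) (basec y (S (S i)))) (py (y i)) (px (y i))).
    now rewrite !e, e' by lia.
Qed.

Theorem entropy_G : exists e, is_entropy asize prodG e /\ (e <= log2 (INR (N * N)))%R.
Proof.
  assert (hK : 1 <= asize) by (unfold asize; nia).
  destruct (@entropy_exists asize prodG (N * N)) as (e & h1 & h2 & _); try nia.
  - intros w. exists (N ^ w * asize ^ w). split.
    { pose proof (Nat.pow_nonzero asize w). pose proof (Nat.pow_nonzero N w). nia. }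
    intros n L hL.
    apply (@sep_le asize prodG n w _ (fun x => wcode asize w x + asize ^ w * wcode N (w + 2 * n) (basec x))) with (3 := hL).
    + intros x hx. apply (proj1 hL) in hx.
      pose proof (@wcode_lt asize w x (fun i _ => hx i)).
      pose proof (@wcode_lt N (w + 2 * n) (basec x) (fun i _ => A_in hx i)) as h4.
      replace ((N * N) ^ n * (N ^ w * asize ^ w)) with (asize ^ w * N ^ (w + 2 * n)); [nia|].
      rewrite Nat.pow_add_r, Nat.pow_mul_r. replace (N ^ 2) with (N * N) by (cbn; lia). lia.
    + intros x y hx hy e t i ht hi. apply (proj1 hL) in hx, hy.
      apply digits_inj in e as [e1 e2]; try (apply wcode_lt; auto).
      apply iter_G_eq; auto.
      * intros j hj. apply (@wcode_inj N (w + 2 * n) (basec x) (basec y)); try (intros; apply A_in; auto); auto; lia.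
      * apply (@wcode_inj asize w x y); auto.
  - exists e. split; auto. apply h2.
Qed.

Lemma mod_cancel p u v : u < m -> v < m -> (p + u) mod m = (p + v) mod m -> u = v.
Proof.
  intros hu hv e. pose proof (Nat.div_mod (p + u) m). pose proof (Nat.div_mod (p + v) m).
  rewrite e in *. assert ((p + u) / m = (p + v) / m) by nia. nia.
Qed.

(** At a live cell [i] the new entry [y] is the old [x] of the cell plus the old [y] of cell
    [i + 1], and the old [x] is the [y] of one step before. So the column of [y] at cell [i]
    determines the column at [i + 1], at the cost of one time step. *)
Lemma trace_determines n x y : in_space asize x -> in_space asize y -> basec x = basec y -> fibx x = fibx y ->
  (forall t i, t <= n -> Nat.iter t baseca (basec x) i <> 0) ->
  (forall t, t < n -> fiby (Nat.iter t prodF x) 0 = fiby (Nat.iter t prodF y) 0) ->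
  forall i, i < n -> fiby x i = fiby y i.
Proof.
  intros hx hy eA eX halive e.
  assert (E : forall i t, i + t < n -> fiby (Nat.iter t prodF x) i = fiby (Nat.iter t prodF y) i).
  { induction i as [|i IH]; intros t ht; [apply e; lia|].
    assert (hX : fibx (Nat.iter t prodF x) i = fibx (Nat.iter t prodF y) i).
    { destruct t as [|t]; [simpl; now rewrite eX|]. simpl.
      rewrite (proj1 (proj2 (F_proj (iter_in _ F_in t hx)))), (proj1 (proj2 (F_proj (iter_in _ F_in t hy)))).
      apply IH; lia. }
    pose proof (IH (S t) ltac:(lia)) as h2. simpl in h2.
    rewrite (proj2 (proj2 (F_proj (iter_in _ F_in t hx)))), (proj2 (proj2 (F_proj (iter_in _ F_in t hy)))), hX in h2.
    rewrite !(@iter_A prodF F_in (fun x hx => proj1 (F_proj hx))), <- eA in h2 by auto.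
    assert (ha : Nat.iter t baseca (basec x) i <> 0) by (apply halive; lia).
    apply Nat.eqb_neq in ha. rewrite ha in h2.
    apply mod_cancel in h2; auto; apply py_lt. }
  intros i hi. apply (E i 0). lia.
Qed.

Lemma digit_inj b n c d : c < b ^ n -> d < b ^ n ->
  (forall i, i < n -> (c / b ^ i) mod b = (d / b ^ i) mod b) -> c = d.
Proof.
  revert c d. induction n as [|n IH]; intros c d hc hd e; [simpl in *; lia|].
  assert (b <> 0) by (intros ->; simpl in hc; lia).
  assert (e0 := e 0 ltac:(lia)). rewrite Nat.pow_0_r, !Nat.div_1_r in e0.
  assert (e1 : c / b = d / b).
  { apply IH; try (apply Nat.Div0.div_lt_upper_bound; simpl in *; lia).
    intros i hi. specialize (e (S i) ltac:(lia)). rewrite !Nat.Div0.div_div. exact e. }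
  rewrite (Nat.div_mod c b), (Nat.div_mod d b) by auto. congruence.
Qed.

Theorem entropy_F_ge :
  (forall T, exists a, in_space N a /\ forall t i, t <= T -> Nat.iter t baseca a i <> 0) ->
  exists e, is_entropy asize prodF e /\ (log2 (INR m) <= e)%R.
Proof.
  intros hal. destruct (@entropy_local prodF F_local F_in) as (e & h1 & h2). exists e. split; auto.
  apply h2; auto. intros n. destruct (hal n) as (a & ha & hal').
  (* One configuration for each string of [n] digits in base [m], all over the same live base. By
     [trace_determines] their traces at cell 0 during [n] steps are distinct. *)
  set (cf := fun c i => pk (a i) 0 ((c / m ^ i) mod m)).
  assert (hp : forall c i, pa (cf c i) = a i /\ px (cf c i) = 0 /\ py (cf c i) = (c / m ^ i) mod m).
  { intros c i. apply pk_proj; [lia|apply mod_lt]. }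
  assert (hcf : forall c, in_space asize (cf c)).
  { intros c i. apply pk_lt; [apply ha|lia|apply mod_lt]. }
  exists (map cf (seq 0 (m ^ n))). rewrite length_map, length_seq. split; auto. split.
  - intros x hx. apply in_map_iff in hx as (c & <- & _). auto.
  - rewrite length_map, length_seq. intros i j hi hj hs.
    rewrite !nth_indep with (d := fun _ => 0) (d' := cf 0) in hs by (rewrite length_map, length_seq; lia).
    rewrite !map_nth, !seq_nth in hs by lia. simpl in hs.
    assert (i = j); [|lia]. apply (@digit_inj m n); try lia. intros l hl.
    rewrite <- (proj2 (proj2 (hp i l))), <- (proj2 (proj2 (hp j l))).
    apply (@trace_determines n (cf i) (cf j)); auto.
    + apply functional_extensionality. intros q. unfold basec. now rewrite !(proj1 (hp _ q)).
    + apply functional_extensionality. intros q. unfold fibx. now rewrite !(proj1 (proj2 (hp _ q))).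
    + intros t q ht. replace (basec (cf i)) with a; auto.
      apply functional_extensionality. intros q'. unfold basec. now rewrite (proj1 (hp _ q')).
    + intros t ht. unfold fiby. f_equal. apply hs; lia.
Qed.

(** * The nilpotent case *)

Section Nilpotent.
Variable T : nat.
Hypothesis nilp : forall a, in_space N a -> forall i, Nat.iter T baseca a i = 0.

Lemma nil_later d a : in_space N a -> Nat.iter (d + T) baseca a = fun _ => 0.
Proof.
  intros ha. induction d as [|d IH].
  - apply functional_extensionality. now apply nilp.
  - simpl. rewrite IH. apply functional_extensionality. intros i. apply h0.
Qed.

(** From time [T] on the base is dead and [f] acts on each cell separately, so the first [w + 2 * T]
    letters determine the first [w] cells at all times. *)
Lemma entropy_zero f : local3 f -> (forall x, in_space asize x -> in_space asize (f x)) ->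
  (forall x y i, in_space asize x -> in_space asize y -> (forall j, basec x j = 0) -> (forall j, basec y j = 0) ->
     x i = y i -> f x i = f y i) ->
  (forall x, in_space asize x -> basec (f x) = baseca (basec x)) -> is_entropy asize f 0.
Proof.
  intros hl hf hz hA. assert (hK : 1 <= asize) by (unfold asize; nia).
  destruct (@entropy_exists asize f 1) as (e & h1 & h2 & _); auto.
  - intros w. exists (asize ^ (w + 2 * T)). split; [pose proof (Nat.pow_nonzero asize (w + 2 * T)); lia|].
    intros n L hL. rewrite Nat.pow_1_l, Nat.mul_1_l.
    apply (@sep_le asize f n w _ (wcode asize (w + 2 * T))) with (3 := hL).
    + intros x hx. apply wcode_lt. intros i _. now apply (proj1 hL).
    + intros x y hx hy e t i ht hi. apply (proj1 hL) in hx, hy.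
      assert (E : forall j, j < w + 2 * T -> x j = y j) by (intros j hj; eapply wcode_inj; eauto).
      destruct (le_lt_dec t T) as [l|l].
      * apply iter_local; auto. intros j hj. apply E; lia.
      * replace t with ((t - T) + T) by lia. generalize (t - T). intros d.
        induction d as [|d IH].
        -- apply iter_local; auto. intros j hj. apply E; lia.
        -- simpl. apply hz; auto using iter_in; intros j; rewrite iter_A, nil_later; auto using A_in.
  - replace 0%R with e; auto. destruct h2 as [h2 h3]. simpl in h3. rewrite log2_1 in h3. lra.
Qed.

Lemma F_entropy_zero : is_entropy asize prodF 0.
Proof.
  apply entropy_zero; auto using F_local, F_in.
  - intros x y i hx hy ax ay e. rewrite !F_eq by auto. unfold ruleF3.
    unfold basec in ax, ay. now rewrite !ax, !ay, e.
  - intros x hx. apply (F_proj hx).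
Qed.

Lemma G_entropy_zero : is_entropy asize prodG 0.
Proof.
  apply entropy_zero; auto using G_local, G_in.
  - intros x y i hx hy ax ay e. rewrite !G_eq by auto. unfold ruleG3.
    unfold basec in ax, ay. now rewrite !ax, !ay, e.
  - intros x hx. apply (G_proj hx).
Qed.

(* The fibre map of [prodF] over a fixed base is invertible, with inverse [unstep]. *)
Definition unstep (a c : config) : config :=
  fun i => pk (a i) ((fiby c i + (if a i =? 0 then 0 else m - fibx c (S i))) mod m) (fibx c i).

(** Pulls the fibres of [c] back by [n] steps along the base orbit of [a]. The base map is not
    invertible, but its orbit is known from [a], so only the fibres of [c] are read. *)
Fixpoint unsteps (n : nat) (a c : config) : config :=
  match n with
  | 0 => fun i => pk (a i) (fibx c i) (fiby c i)
  | S n' => unstep a (unsteps n' (baseca a) c)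
  end.

Lemma H_in a : in_space N (baseca a).
Proof. intros i. apply hlt. Qed.

Lemma unstep_proj a c : basec (unstep a c) = a /\
  fibx (unstep a c) = (fun i => (fiby c i + (if a i =? 0 then 0 else m - fibx c (S i))) mod m) /\ fiby (unstep a c) = fibx c.
Proof.
  unfold unstep, basec, fibx, fiby.
  repeat split; apply functional_extensionality; intros i; apply pk_proj; auto using px_lt, mod_lt.
Qed.

Lemma unsteps_A n a c : basec (unsteps n a c) = a.
Proof.
  destruct n; [|apply unstep_proj]. apply functional_extensionality. intros i.
  apply pk_proj; [apply px_lt|apply py_lt].
Qed.

Lemma unsteps_in n a c : in_space N a -> in_space asize (unsteps n a c).
Proof.
  intros ha. destruct n; intros i; apply pk_lt; auto; [apply px_lt|apply py_lt|apply mod_lt|apply px_lt].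
Qed.

Lemma mod_undo p q : p < m -> ((p + q) mod m + (m - q mod m)) mod m = p.
Proof.
  intros hp. pose proof (mod_lt q). rewrite Nat.Div0.add_mod_idemp_l.
  replace (p + q + (m - q mod m)) with (p + (q / m + 1) * m).
  - rewrite Nat.Div0.mod_add, Nat.mod_small; auto.
  - pose proof (Nat.div_mod q m). nia.
Qed.

Lemma unstep_F x : in_space asize x -> unstep (basec x) (prodF x) = x.
Proof.
  intros hx. destruct (F_proj hx) as (e1 & e2 & e3).
  destruct (unstep_proj (basec x) (prodF x)) as (f1 & f2 & f3). apply config_eq; auto; [|congruence].
  rewrite f2, e3, e2. apply functional_extensionality. intros i.
  pose proof (px_lt (x i) : fibx x i < m). destruct (basec x i =? 0).
  - now rewrite !Nat.add_0_r, Nat.Div0.mod_mod, Nat.mod_small.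
  - pose proof (py_lt (x (S i)) : fiby x (S i) < m).
    rewrite <- (Nat.mod_small (fiby x (S i)) m) at 2 by auto. now apply mod_undo.
Qed.

Lemma F_unstep a d : in_space N a -> basec d = baseca a -> prodF (unstep a d) = d.
Proof.
  intros ha hd. assert (hin : in_space asize (unstep a d)).
  { intros i. apply pk_lt; auto; [apply mod_lt|apply px_lt]. }
  destruct (F_proj hin) as (e1 & e2 & e3). destruct (unstep_proj a d) as (f1 & f2 & f3).
  apply config_eq; try congruence. rewrite e3, f1, f2, f3.
  apply functional_extensionality. intros i.
  pose proof (py_lt (d i) : fiby d i < m). destruct (a i =? 0).
  - now rewrite !Nat.add_0_r, Nat.Div0.mod_mod, Nat.mod_small.
  - pose proof (px_lt (d (S i)) : fibx d (S i) < m).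
    rewrite Nat.Div0.add_mod_idemp_l. replace (fiby d i + (m - fibx d (S i)) + fibx d (S i)) with (fiby d i + 1 * m) by lia.
    rewrite Nat.Div0.mod_add, Nat.mod_small; auto.
Qed.

Lemma unsteps_F n x c : in_space asize x -> fibx c = fibx (Nat.iter n prodF x) -> fiby c = fiby (Nat.iter n prodF x) ->
  unsteps n (basec x) c = x.
Proof.
  revert x. induction n as [|n IH]; intros x hx eX eY.
  - simpl in *. rewrite eX, eY. apply functional_extensionality. intros i. apply pk_eta.
  - cbn [unsteps]. rewrite <- (proj1 (F_proj hx)), IH; auto using F_in.
    + now apply unstep_F.
    + now rewrite <- iterS.
    + now rewrite <- iterS.
Qed.

Lemma F_unsteps n a c : in_space N a ->
  fibx (Nat.iter n prodF (unsteps n a c)) = fibx c /\ fiby (Nat.iter n prodF (unsteps n a c)) = fiby c.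
Proof.
  revert a. induction n as [|n IH]; intros a ha.
  - split; apply functional_extensionality; intros i; apply pk_proj; apply px_lt || apply py_lt.
  - rewrite iterS. cbn [unsteps]. rewrite F_unstep; auto using unsteps_A. apply IH, H_in.
Qed.

Lemma unsteps_local n a a' c c' i : (forall j, i <= j <= i + 3 * n -> a j = a' j) ->
  (forall j, i <= j <= i + 3 * n -> c j = c' j) -> unsteps n a c i = unsteps n a' c' i.
Proof.
  revert a a' i. induction n as [|n IH]; intros a a' i ha hc.
  - simpl. unfold fibx, fiby. rewrite ha, hc by lia. reflexivity.
  - cbn [unsteps]. unfold unstep, fibx, fiby. rewrite ha by lia.
    assert (hH : forall j, i <= j <= S i + 3 * n -> baseca a j = baseca a' j).
    { intros j hj. unfold baseca. rewrite (ha j), (ha (S j)), (ha (S (S j))) by lia. reflexivity. }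
    rewrite (IH (baseca a) (baseca a') i), (IH (baseca a) (baseca a') (S i)); auto; intros j hj; apply hH || apply hc; lia.
Qed.

(* After [2 * T] steps the base is dead, so [prodF] and [prodG] have the same fibre dynamics. *)
Definition conjmap (x : config) : config :=
  fun i => pk (basec x i) (fibx (Nat.iter (2 * T) prodF x) i) (fiby (Nat.iter (2 * T) prodF x) i).

Lemma conjmap_proj x : basec (conjmap x) = basec x /\ fibx (conjmap x) = fibx (Nat.iter (2 * T) prodF x) /\ fiby (conjmap x) = fiby (Nat.iter (2 * T) prodF x).
Proof.
  unfold conjmap, basec, fibx, fiby.
  repeat split; apply functional_extensionality; intros i; apply pk_proj; auto using px_lt, py_lt.
Qed.

Lemma conjmap_in x : in_space asize x -> in_space asize (conjmap x).
Proof. intros hx i. apply pk_lt; [apply A_in, hx|apply px_lt|apply py_lt]. Qed.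

Lemma F_shift n x : in_space asize x -> Nat.iter n prodF (shift x) = shift (Nat.iter n prodF x).
Proof.
  intros hx. assert (E : forall y, in_space asize y -> prodF (shift y) = shift (prodF y)).
  { intros y hy. rewrite !F_eq; auto. intros i; apply hy. }
  induction n as [|n IH]; auto. simpl. rewrite IH, E; auto using iter_in, F_in.
Qed.

Theorem F_G_conjugate : strongly_conjugate asize prodF prodG.
Proof.
  exists conjmap. split; [|split].
  - split; [exact conjmap_in|]. split.
    + intros x hx w. exists (w + 2 * (2 * T)). intros y hy e i hi. unfold conjmap, basec, fibx, fiby.
      rewrite e by lia. rewrite (@iter_local prodF F_local F_in (2 * T) x y i); auto.
      intros j hj. apply e; lia.
    + exists (fun c => unsteps (2 * T) (basec c) c). split; [|split; [|split]].
      * intros x hx. apply unsteps_in, A_in, hx.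
      * intros x hx w. exists (w + 3 * (2 * T)). intros y hy e i hi. apply unsteps_local.
        -- intros j hj. unfold basec. rewrite e; auto; lia.
        -- intros j hj. apply e; lia.
      * intros x hx i. destruct (conjmap_proj x) as (e1 & e2 & e3). rewrite e1, unsteps_F; auto.
      * intros x hx i. destruct (conjmap_proj (unsteps (2 * T) (basec x) x)) as (e1 & e2 & e3).
        rewrite unsteps_A in e1. destruct (@F_unsteps (2 * T) (basec x) x (A_in hx)) as (e4 & e5).
        apply (f_equal (fun c : config => c i)), config_eq; congruence.
  - intros x hx i. apply (f_equal (fun c : config => c i)). destruct (G_proj (conjmap_in hx)) as (e1 & e2 & e3).
    destruct (conjmap_proj x) as (f1 & f2 & f3), (conjmap_proj (prodF x)) as (g1 & g2 & g3).
    pose proof (iter_in prodF F_in (2 * T) hx) as hin. destruct (F_proj hin) as (a1 & a2 & a3).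
    rewrite <- iterS in g2, g3. simpl Nat.iter in g2, g3.
    (* Over a dead base a step of [prodF] on the fibres is the swap, that is, a step of [prodG]. *)
    assert (hA : forall j, basec (Nat.iter (2 * T) prodF x) j = 0).
    { intros j. rewrite (@iter_A prodF F_in (fun x hx => proj1 (F_proj hx))) by auto.
      replace (2 * T) with (T + T) by lia. rewrite nil_later; auto using A_in. }
    apply config_eq.
    + rewrite g1, e1, f1. apply (F_proj hx).
    + rewrite e2, f3, g2. exact a2.
    + rewrite e3, f2, g3. etransitivity; [exact a3|]. apply functional_extensionality. intros j.
      rewrite hA. simpl. rewrite Nat.add_0_r, Nat.mod_small; auto. apply px_lt.
  - intros x hx i. unfold conjmap. rewrite F_shift by auto. reflexivity.
Qed.
End Nilpotent.
End Product.

(** * Computability of the reduction *)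

Definition comp (L : nat) (f : list nat -> nat) : Prop :=
  exists c, forall v, length v = L -> eval c v (f v).

Lemma comp_ext L f g : (forall v, length v = L -> f v = g v) -> comp L f -> comp L g.
Proof. intros h [c hc]. exists c. intros v hv. rewrite <- h; auto. Qed.

Lemma comp_nth L i : i < L -> comp L (fun v => nth i v 0).
Proof. intros h. exists (RProj i). intros v hv. constructor. lia. Qed.

Lemma comp_list L n f gs : comp n f -> length gs = n -> Forall (comp L) gs ->
  comp L (fun v => f (map (fun g => g v) gs)).
Proof.
  intros [c hc] hn hgs.
  assert (E : exists cs, forall v, length v = L -> evals cs v (map (fun g => g v) gs)).
  { clear hn. induction hgs as [|g gs [d hd] _ [ds hds]].
    - exists []. constructor.
    - exists (d :: ds). intros v hv. cbn. constructor; auto. }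
  destruct E as [cs hcs]. exists (RComp c cs). intros v hv. econstructor; [apply hcs; auto|].
  apply hc. now rewrite length_map.
Qed.

Lemma comp_app1 L f g : comp 1 (fun v => f (nth 0 v 0)) -> comp L g -> comp L (fun v => f (g v)).
Proof. intros hf hg. apply (@comp_list L 1 _ [g] hf); auto. Qed.

Lemma comp_S L g : comp L g -> comp L (fun v => S (g v)).
Proof.
  apply (@comp_app1 L S). exists RSucc. intros [|x [|]] h; try discriminate. constructor.
Qed.

Lemma comp_const L n : comp L (fun _ => n).
Proof. induction n; [exists RZero; constructor|now apply comp_S]. Qed.

Lemma comp_nth_tl L i : i < L -> comp (S L) (fun w => nth i (tl w) 0).
Proof.
  intros h. apply comp_ext with (fun w => nth (S i) w 0); [|apply comp_nth; lia].
  intros [|x w] hw; [discriminate|reflexivity].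
Qed.

Lemma comp_tl L f : comp L f -> comp (S L) (fun w => f (tl w)).
Proof.
  intros hf. apply comp_ext with
    (fun w => f (map (fun g => g w) (map (fun i w => nth (S i) w 0) (seq 0 L)))).
  - intros [|x w] h; [discriminate|]. cbn in *. injection h as h. f_equal.
    rewrite map_map. apply nth_ext with 0 0; [now rewrite length_map, length_seq|].
    intros n hn. rewrite length_map, length_seq in hn.
    rewrite nth_indep with (d' := nth 0 w 0) by (now rewrite length_map, length_seq).
    rewrite (map_nth (fun i => nth i w 0)), seq_nth; auto.
  - apply comp_list with (n := L); auto; [now rewrite length_map, length_seq|].
    apply Forall_forall. intros k hk. apply in_map_iff in hk as (i & <- & hi). apply in_seq in hi.
    apply comp_nth. lia.
Qed.

Lemma comp_tl2 L f : comp L f -> comp (S (S L)) (fun w => f (tl (tl w))).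
Proof. intros h. exact (comp_tl (comp_tl h)). Qed.

Lemma comp_cons L f n : comp (S L) f -> comp L n -> comp L (fun v => f (n v :: v)).
Proof.
  intros hf hn.
  apply comp_ext with (fun v => f (map (fun g => g v) (n :: map (fun i v => nth i v 0) (seq 0 L)))).
  - intros v hv. cbn. do 2 f_equal. rewrite map_map.
    apply nth_ext with 0 0; rewrite length_map, length_seq; auto.
    intros i hi. rewrite nth_indep with (d' := nth 0 v 0) by (now rewrite length_map, length_seq).
    rewrite (map_nth (fun i => nth i v 0)), seq_nth; auto.
  - apply (@comp_list L (S L) f (n :: map (fun i v => nth i v 0) (seq 0 L)) hf);
      [cbn; now rewrite length_map, length_seq|].
    constructor; auto. apply Forall_forall. intros k hk. apply in_map_iff in hk as (i & <- & hi).
    apply in_seq in hi. apply comp_nth. lia.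
Qed.

Lemma comp_rec L n base s : comp L n -> comp L base ->
  comp (S (S L)) (fun w => s (nth 0 w 0) (nth 1 w 0) (tl (tl w))) ->
  comp L (fun v => nat_rect (fun _ => nat) (base v) (fun i r => s i r v) (n v)).
Proof.
  intros hn [cb hb] [cs hs].
  assert (E : comp (S L) (fun w => nat_rect (fun _ => nat) (base (tl w)) (fun i r => s i r (tl w)) (nth 0 w 0))).
  { exists (RPrec cb cs). intros [|x v] hv; [discriminate|]. cbn in *. injection hv as hv.
    induction x as [|x IH]; cbn.
    - constructor. auto.
    - econstructor; [exact IH|].
      specialize (hs (x :: nat_rect (fun _ => nat) (base v) (fun i r => s i r v) x :: v)).
      cbn in hs. apply hs. lia. }
  exact (comp_cons E hn).
Qed.

Section Arith.
Variable L : nat.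
Implicit Types f g : list nat -> nat.

Lemma comp_add f g : comp L f -> comp L g -> comp L (fun v => f v + g v).
Proof.
  intros hf hg. eapply comp_ext; [|apply (@comp_rec L g f (fun _ r _ => S r)); auto].
  - intros v _. cbn. induction (g v); cbn; lia.
  - apply comp_S, comp_nth. lia.
Qed.

Lemma comp_pred f : comp L f -> comp L (fun v => pred (f v)).
Proof.
  intros hf. eapply comp_ext; [|apply (@comp_rec L f (fun _ => 0) (fun i _ _ => i)); auto using comp_const].
  - intros v _. cbn. destruct (f v); auto.
  - apply comp_nth. lia.
Qed.
End Arith.

Section Arith2.
Variable L : nat.
Implicit Types f g x y : list nat -> nat.

Lemma comp_sub f g : comp L f -> comp L g -> comp L (fun v => f v - g v).
Proof.
  intros hf hg. eapply comp_ext; [|apply (@comp_rec L g f (fun _ r _ => pred r)); auto].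
  - intros v _. cbn. induction (g v); cbn; lia.
  - apply comp_pred, comp_nth. lia.
Qed.

Lemma comp_mul f g : comp L f -> comp L g -> comp L (fun v => f v * g v).
Proof.
  intros hf hg. eapply comp_ext; [|apply (@comp_rec L f (fun _ => 0) (fun _ r v => r + g v)); auto using comp_const].
  - intros v _. cbn. induction (f v); cbn; lia.
  - apply comp_add; [apply comp_nth; lia|]. now apply comp_tl2.
Qed.

Lemma comp_ifz f x y : comp L f -> comp L x -> comp L y ->
  comp L (fun v => if f v =? 0 then x v else y v).
Proof.
  intros hf hx hy. eapply comp_ext; [|apply (@comp_rec L f x (fun _ _ v => y v)); auto].
  - intros v _. cbn. destruct (f v); auto.
  - now apply comp_tl2.
Qed.

Lemma comp_ifeq f g x y : comp L f -> comp L g -> comp L x -> comp L y ->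
  comp L (fun v => if f v =? g v then x v else y v).
Proof.
  intros hf hg hx hy.
  apply comp_ext with (fun v => if (f v - g v) + (g v - f v) =? 0 then x v else y v).
  - intros v _. destruct (Nat.eqb_spec (f v) (g v)), (Nat.eqb_spec (f v - g v + (g v - f v)) 0); auto; lia.
  - apply comp_ifz; auto using comp_add, comp_sub.
Qed.
End Arith2.

Section Arith3.
Variable L : nat.
Implicit Types f g : list nat -> nat.

Lemma comp_pow f g : comp L f -> comp L g -> comp L (fun v => f v ^ g v).
Proof.
  intros hf hg. eapply comp_ext; [|apply (@comp_rec L g (fun _ => 1) (fun _ r v => f v * r)); auto using comp_const].
  - intros v _. cbn. induction (g v); cbn; lia.
  - apply comp_mul; [now apply comp_tl2|apply comp_nth; lia].
Qed.

(* [a / b] is the number of [i < a] with [(i + 1) * b <= a]. *)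
Lemma comp_div f g : comp L f -> comp L g -> comp L (fun v => f v / g v).
Proof.
  intros hf hg.
  apply comp_ext with (fun v => if g v =? 0 then 0 else
    nat_rect (fun _ => nat) 0 (fun i r => r + (if S i * g v - f v =? 0 then 1 else 0)) (f v)).
  - intros v _. destruct (Nat.eqb_spec (g v) 0) as [->|h]; auto.
    assert (E : forall k, nat_rect (fun _ => nat) 0 (fun i r => r + (if S i * g v - f v =? 0 then 1 else 0)) k
                = Nat.min k (f v / g v)).
    { induction k as [|k IH]; auto. cbn [nat_rect]. rewrite IH.
      pose proof (Nat.div_mod (f v) (g v) h). pose proof (Nat.mod_upper_bound (f v) (g v) h).
      destruct (Nat.eqb_spec (S k * g v - f v) 0) as [e|e].
      - assert (S k <= f v / g v) by nia. lia.
      - assert (f v / g v <= k) by nia. lia. }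
    rewrite E. apply Nat.min_r. pose proof (Nat.div_mod (f v) (g v) h). nia.
  - apply comp_ifz; auto using comp_const. apply (@comp_rec L f (fun _ => 0) (fun i r v => r + (if S i * g v - f v =? 0 then 1 else 0)));
      auto using comp_const. apply comp_add; [apply comp_nth; lia|].
    apply comp_ifz; auto using comp_const. apply comp_sub; [|now apply comp_tl2].
    apply comp_mul; [|now apply comp_tl2]. apply comp_S, comp_nth; lia.
Qed.

Lemma comp_mod f g : comp L f -> comp L g -> comp L (fun v => f v mod g v).
Proof.
  intros hf hg. apply comp_ext with (fun v => f v - g v * (f v / g v)).
  - intros v _. destruct (Nat.eq_dec (g v) 0) as [->|h]; [simpl; lia|]. symmetry. now apply Nat.Div0.mod_eq.
  - auto using comp_sub, comp_mul, comp_div.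
Qed.
End Arith3.

Lemma comp_pair L (f g : list nat -> nat) : comp L f -> comp L g -> comp L (fun v => cantor_pair (f v) (g v)).
Proof. intros hf hg. unfold cantor_pair. auto 8 using comp_add, comp_div, comp_mul, comp_S, comp_const. Qed.
(** A list code is built from its tail, so step [i] of the recursion prepends the entry of index
    [n - S i]. *)
Lemma comp_code_list L n (f : nat -> list nat -> nat) : comp L n ->
  comp (S L) (fun w => f (nth 0 w 0) (tl w)) ->
  comp L (fun v => code_list (map (fun i => f i v) (seq 0 (n v)))).
Proof.
  intros hn hf.
  apply comp_ext with (fun v => nat_rect (fun _ => nat) 0
    (fun i r => S (cantor_pair (f (n v - S i) v) r)) (n v)).
  - intros v _.
    assert (E : forall k, k <= n v -> nat_rect (fun _ => nat) 0 (fun i r => S (cantor_pair (f (n v - S i) v) r)) k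
      = code_list (map (fun i => f i v) (seq (n v - k) k))).
    { induction k as [|k IH]; intros hk; auto. cbn [nat_rect seq map code_list].
      rewrite IH by lia. replace (S (n v - S k)) with (n v - k) by lia. reflexivity. }
    rewrite E by lia. now rewrite Nat.sub_diag.
  - apply (@comp_rec L n (fun _ => 0) (fun i r v => S (cantor_pair (f (n v - S i) v) r))); auto using comp_const.
    apply comp_S, comp_pair; [|apply comp_nth; lia].
    destruct hf as [c hc]. assert (hf : comp (S L) (fun w => f (nth 0 w 0) (tl w))) by (exists c; auto).
    set (w1 := fun w : list nat => n (tl (tl w)) - S (nth 0 w 0)).
    apply comp_ext with (fun w => (fun u => f (nth 0 u 0) (tl u))
       (map (fun g => g w) (w1 :: map (fun i w => nth (S (S i)) w 0) (seq 0 L)))).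
    + intros [|a [|b w]] h; try discriminate. cbn in *. injection h as h. f_equal.
      rewrite map_map. apply nth_ext with 0 0; [now rewrite length_map, length_seq|].
      intros i hi. rewrite length_map, length_seq in hi.
      rewrite nth_indep with (d' := nth 0 w 0) by (now rewrite length_map, length_seq).
      rewrite (map_nth (fun i => nth i w 0)), seq_nth; auto.
    + apply (@comp_list (S (S L)) (S L) (fun u => f (nth 0 u 0) (tl u))
        (w1 :: map (fun i w => nth (S (S i)) w 0) (seq 0 L)) hf); [cbn; now rewrite length_map, length_seq|].
      constructor.
      * apply comp_sub; [now apply comp_tl2|]. apply comp_S, comp_nth; lia.
      * apply Forall_forall. intros k hk. apply in_map_iff in hk as (i & <- & hi).
        apply in_seq in hi. apply comp_nth. lia.
Qed.

(* Only numbers [e = 2 ^ K * (2 * y + 1)] matter: [K] bounds the codes of payloads and [y] is the table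
   of the level 0 local rule, one digit in base [K + 1] per entry.  The program of the simulated machine
   enters through [y] only and its input is [e] itself, so that the machine can be given its own code.
   Letter 0 is the dead state, and a letter [c > 0] stands for the state [(la e c, lw e c, lv e c)]. *)
Definition v2 (e : nat) : nat :=
  nat_rect (fun _ => nat) 0 (fun i r => r + (if e mod 2 ^ S i =? 0 then 1 else 0)) e.
Definition ptab (e : nat) : nat := e / 2 ^ S (v2 e).
(** The block length of level 0. It must be at least [C0] and leave room for the initial tape, whose
    last mark is at [e]. *)
Definition pB (e : nat) : nat := 2 * e + 4.
Definition pN (e : nat) : nat := S (pB e * pB e * v2 e).
(** One more than the square of the number of base letters, whose logarithm bounds the entropy of
    [prodG]. *)
Definition pm (e : nat) : nat := S (pN e * pN e).

(* The outer [mod] only matters for numbers that are not letters. *)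
Definition la (e c : nat) : nat := (pred c / v2 e / pB e) mod pB e.
Definition lw (e c : nat) : nat := (pred c / v2 e) mod pB e.
Definition lv (e c : nat) : nat := pred c mod v2 e.
Definition nsucc (e a : nat) : nat := if S a =? pB e then 0 else S a.

Definition flag (a b : nat) : nat := if a =? b then 1 else 0.
Definition tindex (K ma mw t1 t2 t3 vl v vr : nat) : nat :=
  ((((((ma * S K + mw) * 2 + t1) * 2 + t2) * 2 + t3) * K + vl) * K + v) * K + vr.
Definition digit (y b i : nat) : nat := (y / b ^ i) mod b.

(** [a - (a - K)] is the minimum of [a] and [K]. Digit 0 of the table means death, and a positive
    digit is a payload code plus one. *)
Definition bout (e l c r : nat) : nat :=
  let a := la e c in
  let w := lw e c in
  let K := v2 e in
  digit (ptab e) (S K) (tindex K (a - (a - K)) (w - (w - K)) (flag a e) (flag (S a) (pB e)) (flag a w)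
    (lv e l) (lv e c) (lv e r)).

Definition brule (e l c r : nat) : nat :=
  if l =? 0 then 0 else if c =? 0 then 0 else if r =? 0 then 0 else
  if la e r =? nsucc e (la e c) then
    if lw e r =? nsucc e (lw e c) then
      if bout e l c r =? 0 then 0
      else S ((la e c * pB e + nsucc e (lw e c)) * v2 e + pred (bout e l c r))
    else 0
  else 0.

Definition pair_of (e : nat) : ca_pair :=
  let k := asize (pN e) (pm e) in
  {| alph := k;
     radF := 2; ruleF := rule3 k (ruleF3 (pm e) (brule e));
     radG := 2; ruleG := rule3 k (ruleG3 (pm e) (brule e)) |}.

Create HintDb comp.
Hint Resolve comp_const comp_S comp_add comp_sub comp_mul comp_pred comp_div comp_mod comp_pow
  comp_ifz comp_ifeq comp_pair : comp.

Section Enc.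
Variable L : nat.
Implicit Types e f g l c r : list nat -> nat.

Lemma comp_v2 e : comp L e -> comp L (fun v => v2 (e v)).
Proof.
  intros he. unfold v2.
  apply (@comp_rec L e (fun _ => 0) (fun i q v => q + (if e v mod 2 ^ S i =? 0 then 1 else 0))); auto with comp.
  apply comp_add; [apply comp_nth; lia|]. apply comp_ifz; auto with comp.
  apply comp_mod; [now apply comp_tl2|]. apply comp_pow; auto with comp. apply comp_S, comp_nth; lia.
Qed.
Hint Resolve comp_v2 : comp.

Lemma comp_ptab e : comp L e -> comp L (fun v => ptab (e v)).
Proof. intros. unfold ptab. auto with comp. Qed.
Lemma comp_pB e : comp L e -> comp L (fun v => pB (e v)).
Proof. intros. unfold pB. auto with comp. Qed.
Hint Resolve comp_ptab comp_pB : comp.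
Lemma comp_pN e : comp L e -> comp L (fun v => pN (e v)).
Proof. intros. unfold pN. auto with comp. Qed.
Hint Resolve comp_pN : comp.
Lemma comp_pm e : comp L e -> comp L (fun v => pm (e v)).
Proof. intros. unfold pm. auto with comp. Qed.
Lemma comp_la e c : comp L e -> comp L c -> comp L (fun v => la (e v) (c v)).
Proof. intros. unfold la. auto with comp. Qed.
Lemma comp_lw e c : comp L e -> comp L c -> comp L (fun v => lw (e v) (c v)).
Proof. intros. unfold lw. auto with comp. Qed.
Lemma comp_lv e c : comp L e -> comp L c -> comp L (fun v => lv (e v) (c v)).
Proof. intros. unfold lv. auto with comp. Qed.
Lemma comp_nsucc e c : comp L e -> comp L c -> comp L (fun v => nsucc (e v) (c v)).
Proof. intros. unfold nsucc. auto with comp. Qed.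
Lemma comp_flag f g : comp L f -> comp L g -> comp L (fun v => flag (f v) (g v)).
Proof. intros. unfold flag. auto with comp. Qed.
Hint Resolve comp_pm comp_la comp_lw comp_lv comp_nsucc comp_flag : comp.

Lemma comp_bout e l c r : comp L e -> comp L l -> comp L c -> comp L r ->
  comp L (fun v => bout (e v) (l v) (c v) (r v)).
Proof. intros. unfold bout, digit, tindex. cbv zeta. auto 30 with comp. Qed.
Hint Resolve comp_bout : comp.

Lemma comp_brule e l c r : comp L e -> comp L l -> comp L c -> comp L r ->
  comp L (fun v => brule (e v) (l v) (c v) (r v)).
Proof. intros. unfold brule. auto 20 with comp. Qed.
Hint Resolve comp_brule : comp.

Lemma comp_K e : comp L e -> comp L (fun v => asize (pN (e v)) (pm (e v))).
Proof. intros. unfold asize. auto with comp. Qed.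

Lemma comp_ruleF3 e l c r : comp L e -> comp L l -> comp L c -> comp L r ->
  comp L (fun v => ruleF3 (pm (e v)) (brule (e v)) (l v) (c v) (r v)).
Proof. intros. unfold ruleF3, pk, pa, px, py. auto 20 with comp. Qed.

Lemma comp_ruleG3 e l c r : comp L e -> comp L l -> comp L c -> comp L r ->
  comp L (fun v => ruleG3 (pm (e v)) (brule (e v)) (l v) (c v) (r v)).
Proof. intros. unfold ruleG3, pk, pa, px, py. auto 20 with comp. Qed.
End Enc.

Hint Resolve comp_K comp_ruleF3 comp_ruleG3 : comp.

Theorem enc_computable : exists q, forall e, eval q [e] (enc_pair (pair_of e)).
Proof.
  assert (E : comp 1 (fun v => enc_pair (pair_of (nth 0 v 0)))).
  { assert (c0 : comp 1 (fun v => nth 0 v 0)) by (apply comp_nth; lia).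
    assert (c1 : comp 2 (fun v => nth 0 v 0)) by (apply comp_nth; lia).
    assert (c2 : comp 2 (fun v => nth 0 (tl v) 0)) by (apply comp_nth_tl; lia).
    unfold enc_pair, pair_of. cbn [alph radF ruleF radG ruleG code_list].
    assert (ck : forall L e, comp L e -> comp L (fun v => asize (pN (e v)) (pm (e v)) ^ 3)) by auto with comp.
    assert (T1 : comp 1 (fun v => code_list (rule3 (asize (pN (nth 0 v 0)) (pm (nth 0 v 0)))
       (ruleF3 (pm (nth 0 v 0)) (brule (nth 0 v 0)))))).
    { unfold rule3. apply comp_code_list with (f := fun i v =>
        let k := asize (pN (nth 0 v 0)) (pm (nth 0 v 0)) in
        ruleF3 (pm (nth 0 v 0)) (brule (nth 0 v 0)) (i / k / k) ((i / k) mod k) (i mod k)); auto.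
      cbv zeta. apply comp_ruleF3; auto 8 with comp. }
    assert (T2 : comp 1 (fun v => code_list (rule3 (asize (pN (nth 0 v 0)) (pm (nth 0 v 0)))
       (ruleG3 (pm (nth 0 v 0)) (brule (nth 0 v 0)))))).
    { unfold rule3. apply comp_code_list with (f := fun i v =>
        let k := asize (pN (nth 0 v 0)) (pm (nth 0 v 0)) in
        ruleG3 (pm (nth 0 v 0)) (brule (nth 0 v 0)) (i / k / k) ((i / k) mod k) (i mod k)); auto.
      cbv zeta. apply comp_ruleG3; auto 8 with comp. }
    auto 20 with comp. }
  destruct E as [q hq]. exists q. intros e. exact (hq [e] eq_refl).
Qed.

(** * The reduction *)

Section Compactness.
Variables (N : nat) (f : nat -> nat -> nat).
Hypothesis hf : forall n i, f n i < N.

Definition recurs (l : list nat) : Prop :=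
  forall M, exists n, M <= n /\ forall i, i < length l -> f n i = nth i l 0.

(** If no letter extended the recurrent prefix, the next letter of late sequences through it would
    eventually avoid 0, then 1, and so on up to [N]. *)
Lemma recurs_extend l : recurs l -> exists a, recurs (l ++ [a]).
Proof.
  intros h. apply NNPP. intros hn.
  assert (E : forall K, exists M, forall n, M <= n -> (forall i, i < length l -> f n i = nth i l 0) ->
    K <= f n (length l)).
  { induction K as [|K [M IH]]; [exists 0; intros; lia|].
    assert (hK : ~ recurs (l ++ [K])) by (intros h'; apply hn; eauto).
    apply not_all_ex_not in hK as [M' hM'].
    exists (Nat.max M M'). intros n hmn he. specialize (IH n ltac:(lia) he).
    destruct (Nat.eq_dec (f n (length l)) K) as [e|]; [|lia]. exfalso.
    apply hM'. exists n. split; [lia|]. intros i hi. rewrite length_app in hi. cbn in hi.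
    destruct (Nat.eq_dec i (length l)) as [->|].
    - now rewrite nth_middle.
    - rewrite app_nth1 by lia. apply he; lia. }
  destruct (E N) as [M hM]. destruct (h M) as (n & h1 & h2). specialize (hM n h1 h2).
  specialize (hf n (length l)). lia.
Qed.

Theorem compactness : exists g, forall M, exists n, M <= n /\ forall i, i < M -> f n i = g i.
Proof.
  assert (E : forall l, exists a, recurs l -> recurs (l ++ [a])).
  { intros l. destruct (classic (recurs l)) as [h|h]; [|exists 0; tauto].
    destruct (recurs_extend h) as [a ha]. eauto. }
  destruct (functional_choice _ E) as [nx hnx].
  set (pre := fix pre n := match n with 0 => [] | S k => pre k ++ [nx (pre k)] end).
  assert (hp : forall n, length (pre n) = n /\ recurs (pre n)).
  { induction n as [|n [h1 h2]]; cbn.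
    - split; auto. intros M. exists M. split; auto. cbn. lia.
    - split; [rewrite length_app; cbn; lia|auto]. }
  assert (hg : forall n i, i < n -> nth i (pre n) 0 = nx (pre i)).
  { induction n as [|n IH]; intros i hi; [lia|]. cbn.
    destruct (hp n) as [hl _]. destruct (Nat.eq_dec i n) as [->|].
    - rewrite <- hl at 1. apply nth_middle.
    - rewrite app_nth1 by lia. apply IH; lia. }
  exists (fun i => nx (pre i)). intros M. destruct (hp M) as [hl hr].
  destruct (hr M) as (n & h1 & h2). exists n. split; auto. intros i hi.
  rewrite h2, hg; auto; lia.
Qed.
End Compactness.

(* One-sided orbits of a rule with spreading state 0 versus two-sided ones. *)
Section TwoSided.
Variables (N : nat) (h : nat -> nat -> nat -> nat).
Hypothesis spread : forall a b c, h a b c <> 0 -> a <> 0 /\ b <> 0 /\ c <> 0.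

Definition Hz (z : Z -> nat) : Z -> nat := fun p => h (z (p - 1)%Z) (z p) (z (p + 1)%Z).

Notation H := (baseca h).

Lemma spread_back s a n i : Nat.iter (s + n) H a i <> 0 ->
  forall j, i <= j <= i + 2 * n -> Nat.iter s H a j <> 0.
Proof.
  revert i. induction n as [|n IH]; intros i hi j hj.
  - rewrite Nat.add_0_r in hi. now replace j with i by lia.
  - rewrite Nat.add_succ_r in hi. cbn in hi. apply spread in hi as (h1 & h2 & h3).
    destruct (le_lt_dec j (i + 2 * n)); [apply (IH i h1); lia|].
    destruct (Nat.eq_dec j (i + 2 * n + 1)); [apply (IH (S i) h2); lia|].
    apply (IH (S (S i)) h3); lia.
Qed.

(** The one-sided rule is the centred rule composed with a shift, hence the index drops by [s] after
    [s] steps. The inequality keeps the dependence cone inside the half line. *)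
Lemma Hz_iter s a n p : (Z.of_nat s <= p + Z.of_nat n)%Z ->
  Nat.iter s Hz (fun q => a (Z.to_nat (q + Z.of_nat n))) p =
  Nat.iter s H a (Z.to_nat (p + Z.of_nat n - Z.of_nat s)).
Proof.
  revert p. induction s as [|s IH]; intros p hp.
  - cbn. f_equal. lia.
  - rewrite !Nat.iter_succ. unfold Hz at 1, baseca at 1. rewrite !IH by lia. f_equal; f_equal; lia.
Qed.

Lemma Hz_local s z z' p : (forall q, (p - Z.of_nat s <= q <= p + Z.of_nat s)%Z -> z q = z' q) ->
  Nat.iter s Hz z p = Nat.iter s Hz z' p.
Proof.
  revert p. induction s as [|s IH]; intros p hq.
  - apply hq. lia.
  - rewrite !Nat.iter_succ. unfold Hz at 1 3. f_equal; apply IH; intros q hq'; apply hq; lia.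
Qed.

Definition zcode (p : Z) : nat := if (0 <=? p)%Z then 2 * Z.to_nat p else 2 * Z.to_nat (- p) + 1.
Definition zdec (n : nat) : Z :=
  if Nat.even n then Z.of_nat (n / 2) else (- Z.of_nat (n / 2))%Z.

Lemma zdec_code p : zdec (zcode p) = p.
Proof.
  unfold zdec, zcode. destruct (Z.leb_spec 0 p).
  - rewrite Nat.even_mul. cbn [Nat.even orb]. rewrite Nat.mul_comm, Nat.div_mul; lia.
  - rewrite Nat.even_add, Nat.even_mul. cbn [Nat.even orb eqb]. rewrite Nat.mul_comm.
    rewrite Nat.div_add_l by lia. cbn [Nat.div Nat.divmod fst]. lia.
Qed.

(** For each [n] some row has a live cell 0 at time [n], and since 0 spreads its whole backward cone
    is live. Recentred at cell [n], these cones exhaust the plane of cells and times, and a limit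
    row is live everywhere forever. *)
Theorem not_nilpotent_two_sided :
  ~ (exists T, forall a, in_space N a -> forall i, Nat.iter T H a i = 0) ->
  exists z, (forall p, z p < N) /\ forall s p, Nat.iter s Hz z p <> 0.
Proof.
  intros hn.
  assert (E : forall n, exists a, in_space N a /\ Nat.iter n H a 0 <> 0).
  { intros n. apply NNPP. intros hne. apply hn. exists n. intros a ha i. apply NNPP. intros hi.
    apply hne. exists (fun j => a (j + i)). split; [intros j; apply ha|].
    assert (S : forall s j, Nat.iter s H (fun j => a (j + i)) j = Nat.iter s H a (j + i)).
    { induction s as [|s IH]; intros j; auto. rewrite !Nat.iter_succ. unfold baseca at 1 3. now rewrite !IH. }
    rewrite S. exact hi. }
  destruct (functional_choice _ E) as [a ha].
  destruct (@compactness N (fun n i => a n (Z.to_nat (zdec i + Z.of_nat n)))) as [g hg].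
  { intros n i. apply (ha n). }
  assert (hz : forall M, exists n, M <= n /\ forall q, (- Z.of_nat M <= q <= Z.of_nat M)%Z ->
    a n (Z.to_nat (q + Z.of_nat n)) = g (zcode q)).
  { intros M. destruct (hg (2 * M + 2)) as (n & h1 & h2). exists n. split; [lia|]. intros q hq.
    rewrite <- h2, zdec_code; auto. unfold zcode. destruct (Z.leb_spec 0 q); lia. }
  exists (fun p => g (zcode p)). split.
  - intros p. destruct (hz (Z.abs_nat p)) as (n & _ & e). rewrite <- e by lia. apply (ha n).
  - intros s p. destruct (hz (Z.abs_nat p + s)) as (n & h1 & h2).
    rewrite <- (@Hz_local s (fun q => a n (Z.to_nat (q + Z.of_nat n)))).
    + rewrite Hz_iter by lia. destruct (ha n) as [_ h3].
      assert (h4 : Nat.iter (s + (n - s)) H (a n) 0 <> 0) by (replace (s + (n - s)) with n by lia; exact h3).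
      apply (@spread_back s (a n) (n - s) 0 h4). lia.
    + intros q hq. apply h2. lia.
Qed.
End TwoSided.

(** * Arithmetic of the number [e] and of the letters *)

Lemma digits_exist b (f : nat -> nat) n : 1 <= b -> (forall i, i < n -> f i < b) ->
  exists y, forall i, i < n -> digit y b i = f i.
Proof.
  intros hb. revert f. induction n as [|n IH]; intros f hf; [exists 0; intros; lia|].
  destruct (IH (fun i => f (S i))) as [y hy]; [intros; apply hf; lia|].
  exists (y * b + f 0). pose proof (hf 0 ltac:(lia)).
  destruct (@divmod_add b y (f 0)) as [e1 e2]; auto.
  intros [|i] hi; unfold digit in *.
  - now rewrite Nat.pow_0_r, Nat.div_1_r.
  - rewrite Nat.pow_succ_r', <- Nat.Div0.div_div, e1. apply hy; lia.
Qed.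

Lemma v2_val K y : v2 (2 ^ K * (2 * y + 1)) = K.
Proof.
  unfold v2. set (e := 2 ^ K * (2 * y + 1)).
  assert (D : forall i, (e mod 2 ^ S i =? 0) = (i <? K)).
  { intros i. destruct (Nat.ltb_spec i K).
    - apply Nat.eqb_eq. apply Nat.Div0.mod_divides. exists (2 ^ (K - S i) * (2 * y + 1)).
      unfold e. rewrite Nat.mul_assoc, <- Nat.pow_add_r. f_equal. f_equal. lia.
    - apply Nat.eqb_neq. intros h. apply Nat.Div0.mod_divides in h as [q hq].
      replace (S i) with (K + S (i - K)) in hq by lia. unfold e in hq.
      rewrite Nat.pow_add_r, <- Nat.mul_assoc in hq. apply Nat.mul_cancel_l in hq; [|apply Nat.pow_nonzero; lia].
      rewrite Nat.pow_succ_r', <- Nat.mul_assoc in hq. lia. }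
  assert (C : forall n, nat_rect (fun _ => nat) 0 (fun i r => r + (if e mod 2 ^ S i =? 0 then 1 else 0)) n = Nat.min n K).
  { induction n as [|n IH]; auto. cbn [nat_rect]. rewrite IH, D. destruct (Nat.ltb_spec n K); lia. }
  rewrite C. apply Nat.min_r. pose proof (Nat.pow_gt_lin_r 2 K). unfold e. nia.
Qed.

Lemma ptab_val K y : ptab (2 ^ K * (2 * y + 1)) = y.
Proof.
  unfold ptab. rewrite v2_val. replace (2 ^ S K) with (2 ^ K * 2) by (cbn; lia).
  rewrite <- Nat.Div0.div_div, (Nat.mul_comm (2 ^ K)), Nat.div_mul by (apply Nat.pow_nonzero; lia).
  rewrite (Nat.mul_comm 2 y). now rewrite (proj1 (@divmod_add 2 y 1 ltac:(lia))).
Qed.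

Lemma brule_spread e a b c : brule e a b c <> 0 -> a <> 0 /\ b <> 0 /\ c <> 0.
Proof.
  unfold brule. destruct (Nat.eqb_spec a 0), (Nat.eqb_spec b 0), (Nat.eqb_spec c 0); auto; try tauto.
Qed.

Lemma nsucc_lt e a : a < pB e -> nsucc e a < pB e.
Proof. intros h. unfold nsucc. destruct (Nat.eqb_spec (S a) (pB e)); lia. Qed.

Lemma digit_lt y b i : 1 <= b -> digit y b i < b.
Proof. intros h. apply Nat.mod_upper_bound. lia. Qed.

Definition letter (e a w v : nat) : nat := S ((a * pB e + w) * v2 e + v).

Lemma letter_lt e a w v : a < pB e -> w < pB e -> v < v2 e -> letter e a w v < pN e.
Proof.
  intros ha hw hv. unfold letter, pN. assert (a * pB e + w < pB e * pB e) by nia. nia.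
Qed.

Lemma letter_proj e a w v : a < pB e -> w < pB e -> v < v2 e ->
  la e (letter e a w v) = a /\ lw e (letter e a w v) = w /\ lv e (letter e a w v) = v.
Proof.
  intros ha hw hv. unfold la, lw, lv, letter. cbn [pred].
  destruct (@divmod_add (v2 e) (a * pB e + w) v hv) as [-> ->].
  destruct (@divmod_add (pB e) a w hw) as [-> ->]. rewrite Nat.mod_small; auto.
Qed.

Lemma lw_lt e c : lw e c < pB e.
Proof. apply Nat.mod_upper_bound. unfold pB. lia. Qed.
Lemma la_lt e c : la e c < pB e.
Proof. apply Nat.mod_upper_bound. unfold pB. lia. Qed.

Lemma brule_eq e a b c : a <> 0 -> b <> 0 -> c <> 0 -> brule e a b c =
  if (la e c =? nsucc e (la e b)) && (lw e c =? nsucc e (lw e b)) && negb (bout e a b c =? 0)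
  then letter e (la e b) (nsucc e (lw e b)) (pred (bout e a b c)) else 0.
Proof.
  intros ha hb hc. unfold brule, letter.
  destruct (Nat.eqb_spec a 0), (Nat.eqb_spec b 0), (Nat.eqb_spec c 0); try tauto.
  destruct (la e c =? _), (lw e c =? _), (bout e a b c =? 0); reflexivity.
Qed.

Lemma brule_lt e a b c : brule e a b c < pN e.
Proof.
  assert (h0 : 0 < pN e) by (unfold pN; lia).
  destruct (Nat.eq_dec (brule e a b c) 0) as [->|hne]; auto.
  destruct (brule_spread _ _ _ _ hne) as (ha & hb & hc). rewrite brule_eq in * by auto.
  destruct (_ && _) eqn:E; auto. apply andb_true_iff in E as [_ E]. apply negb_true_iff, Nat.eqb_neq in E.
  apply letter_lt; auto using la_lt, nsucc_lt, lw_lt.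
  assert (bout e a b c < S (v2 e)) by (apply digit_lt; lia). lia.
Qed.

(** On the initial tape register 0 is marked at [e] and all others at 0. The symbol therefore
    depends only on whether the address is [e] and whether it is 0, which survives truncation of the
    address. *)
Definition symbol0 (k : nat) (t1 a : nat) : bits k :=
  if t1 =? 1 then bmk k (fun i => i =? 0) else if a =? 0 then bmk k (fun i => negb (i =? 0)) else bmk k (fun _ => false).

Lemma symbol0_eq k e a : 0 < e ->
  symbol0 k (flag a e) a = sym_of k (input e) (Z.of_nat a).
Proof.
  intros he. unfold symbol0, sym_of, flag, input. destruct (Nat.eqb_spec a e) as [->|hne].
  - apply bmk_ext. intros i _. destruct (Nat.eqb_spec i 0), (Z.eqb_spec (Z.of_nat e) (Z.of_nat 0));
      rewrite ?Z.eqb_refl; auto; lia.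
  - cbn [Nat.eqb]. destruct (Nat.eqb_spec a 0); apply bmk_ext; intros i _;
      destruct (Nat.eqb_spec i 0); cbn [negb]; symmetry;
      (apply Z.eqb_neq; lia) || (apply Z.eqb_eq; lia).
Qed.

(** * The level 0 automaton as a rule on letters *)

Section Encode.
Variables (P : list instr) (k : nat).
Notation St := (fin (length P)).
Notation Sy := (bits k).
Notation cls := (cls St Sy).
Notation stp := (@cst_step P k).
Notation dlt := (@sym_step P k).
Notation blk := (sym_blank k).
Notation hlt := (@ctl_halt P).
Variables (Q : nat) (encC : cls -> nat) (decC : nat -> cls).
Hypothesis HC : forall c, encC c < Q /\ decC (encC c) = c.
Notation V := (V St Sy Q).
Variables (KV : nat) (encV : V -> nat) (decV : nat -> V).
Hypothesis HV : forall v, encV v < KV /\ decV (encV v) = v.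

Notation KE := (C0 Q KV).
Notation Th := (Theta stp dlt blk hlt encC decC KV encV decV).

(* The [a] and [w] coordinates enter truncated at [KE], beyond which [Theta] vanishes. *)
Definition out0 (ma mw t1 t2 t3 vl v vr : nat) : nat :=
  match phi stp dlt blk hlt encC
    (Cls (fmk (length P) 0) (symbol0 k t1 ma) (ma =? 0) (t2 =? 1) (t3 =? 1) (Th (Z.of_nat ma) (Z.of_nat mw)))
    (decV vl) (decV v) (decV vr) with
  | Some v' => S (encV v')
  | None => 0
  end.

Lemma KV_KE : KV < KE.
Proof. unfold C0, XM, Kp. lia. Qed.

Lemma tindex_dec K ma mw t1 t2 t3 vl v vr : mw < S K -> t1 < 2 -> t2 < 2 -> t3 < 2 -> vl < K -> v < K -> vr < K ->
  let i := tindex K ma mw t1 t2 t3 vl v vr in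
  i mod K = vr /\ (i / K) mod K = v /\ (i / K / K) mod K = vl /\ (i / K / K / K) mod 2 = t3 /\
  (i / K / K / K / 2) mod 2 = t2 /\ (i / K / K / K / 2 / 2) mod 2 = t1 /\
  (i / K / K / K / 2 / 2 / 2) mod S K = mw /\ i / K / K / K / 2 / 2 / 2 / S K = ma.
Proof.
  intros h1 h2 h3 h4 h5 h6 h7. cbv zeta. unfold tindex.
  rewrite (proj1 (@divmod_add K _ vr h7)), (proj2 (@divmod_add K _ vr h7)).
  rewrite (proj1 (@divmod_add K _ v h6)), (proj2 (@divmod_add K _ v h6)).
  rewrite (proj1 (@divmod_add K _ vl h5)), (proj2 (@divmod_add K _ vl h5)).
  rewrite (proj1 (@divmod_add 2 _ t3 h4)), (proj2 (@divmod_add 2 _ t3 h4)).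
  rewrite (proj1 (@divmod_add 2 _ t2 h3)), (proj2 (@divmod_add 2 _ t2 h3)).
  rewrite (proj1 (@divmod_add 2 _ t1 h2)), (proj2 (@divmod_add 2 _ t1 h2)).
  rewrite (proj1 (@divmod_add (S K) _ mw h1)), (proj2 (@divmod_add (S K) _ mw h1)).
  repeat split.
Qed.

Lemma tindex_lt K ma mw t1 t2 t3 vl v vr : ma <= K -> mw <= K -> t1 < 2 -> t2 < 2 -> t3 < 2 -> vl < K -> v < K -> vr < K ->
  tindex K ma mw t1 t2 t3 vl v vr < S K * S K * 2 * 2 * 2 * K * K * K.
Proof.
  intros. unfold tindex.
  assert (h1 : ma * S K + mw < S K * S K) by nia. revert h1. generalize (ma * S K + mw), (S K * S K). intros a1 b1 h1.
  assert (h2 : a1 * 2 + t1 < b1 * 2) by nia. revert h2. generalize (a1 * 2 + t1), (b1 * 2). intros a2 b2 h2.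
  assert (h3 : a2 * 2 + t2 < b2 * 2) by nia. revert h3. generalize (a2 * 2 + t2), (b2 * 2). intros a3 b3 h3.
  assert (h4 : a3 * 2 + t3 < b3 * 2) by nia. revert h4. generalize (a3 * 2 + t3), (b3 * 2). intros a4 b4 h4.
  assert (h5 : a4 * K + vl < b4 * K) by nia. revert h5. generalize (a4 * K + vl), (b4 * K). intros a5 b5 h5.
  assert (h6 : a5 * K + v < b5 * K) by nia. revert h6. generalize (a5 * K + v), (b5 * K). intros a6 b6 h6.
  nia.
Qed.

Lemma table_exists : exists y, forall ma mw t1 t2 t3 vl v vr,
  ma <= KE -> mw <= KE -> t1 < 2 -> t2 < 2 -> t3 < 2 -> vl < KE -> v < KE -> vr < KE ->
  digit y (S KE) (tindex KE ma mw t1 t2 t3 vl v vr) = out0 ma mw t1 t2 t3 vl v vr.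
Proof.
  set (f := fun i => out0 (i / KE / KE / KE / 2 / 2 / 2 / S KE) ((i / KE / KE / KE / 2 / 2 / 2) mod S KE)
    ((i / KE / KE / KE / 2 / 2) mod 2) ((i / KE / KE / KE / 2) mod 2) ((i / KE / KE / KE) mod 2)
    ((i / KE / KE) mod KE) ((i / KE) mod KE) (i mod KE)).
  destruct (@digits_exist (S KE) f (S KE * S KE * 2 * 2 * 2 * KE * KE * KE)) as [y hy]; [lia| |].
  - intros i _. unfold f, out0. destruct (phi _ _ _ _ _ _ _ _ _) as [v'|]; [|lia].
    pose proof KV_KE. destruct (HV v'). lia.
  - exists y. intros. rewrite hy by (now apply tindex_lt). unfold f.
    destruct (@tindex_dec KE ma mw t1 t2 t3 vl v vr) as (e1 & e2 & e3 & e4 & e5 & e6 & e7 & e8); auto; try lia.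
    now rewrite e1, e2, e3, e4, e5, e6, e7, e8.
Qed.

Section Fixed.
Variable y : nat.
Hypothesis hy : forall ma mw t1 t2 t3 vl v vr,
  ma <= KE -> mw <= KE -> t1 < 2 -> t2 < 2 -> t3 < 2 -> vl < KE -> v < KE -> vr < KE ->
  digit y (S KE) (tindex KE ma mw t1 t2 t3 vl v vr) = out0 ma mw t1 t2 t3 vl v vr.
Notation ee := (2 ^ KE * (2 * y + 1)).
Notation s0 := (fmk (length P) 0).
Notation gam0 := (sym_of k (input ee)).
Notation b0 := (pB ee).
Notation state := (state St Sy Q).
Notation Hl := (Hlev stp dlt blk hlt encC decC KV encV decV b0 s0 gam0).

Lemma e_gt : KE < ee.
Proof. pose proof (Nat.pow_gt_lin_r 2 KE). nia. Qed.

Definition dec (c : nat) : state := (Z.of_nat (la ee c), Z.of_nat (lw ee c), decV (lv ee c)).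
Definition enc (s : state) : nat :=
  match s with (x, w, v) => letter ee (Z.to_nat x) (Z.to_nat w) (encV v) end.

Lemma dec_valid c : valid b0 (dec c).
Proof. unfold valid, dec. pose proof (la_lt ee c). pose proof (lw_lt ee c). lia. Qed.

Lemma enc_dec s : valid b0 s -> enc s <> 0 /\ enc s < pN ee /\ dec (enc s) = s.
Proof.
  destruct s as [[x w] v]. intros [h1 h2]. destruct (HV v) as [h3 h4]. pose proof KV_KE.
  assert (hv : encV v < v2 ee) by (rewrite v2_val; lia).
  destruct (@letter_proj ee (Z.to_nat x) (Z.to_nat w) (encV v)) as (e1 & e2 & e3); try lia.
  split; [discriminate|]. split; [apply letter_lt; lia|].
  unfold dec, enc. rewrite e1, e2, e3, h4, !Z2Nat.id by lia. reflexivity.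
Qed.

Lemma nsucc_succB a : a < b0 -> Z.of_nat (nsucc ee a) = succB b0 (Z.of_nat a).
Proof.
  intros h. unfold nsucc, succB.
  destruct (Nat.eqb_spec (S a) b0), (Z.eqb_spec (Z.of_nat a) (Z.of_nat b0 - 1)); lia.
Qed.

(** [Theta] vanishes unless [a <= w < KE]; in that case truncation changes nothing, and otherwise
    one of the two inequalities still fails after it. *)
Lemma Theta_trunc a w : Th (Z.of_nat (a - (a - KE))) (Z.of_nat (w - (w - KE))) = Th (Z.of_nat a) (Z.of_nat w).
Proof.
  unfold Theta. destruct (le_lt_dec KE w) as [l|l].
  - replace (_ <? Z.of_nat KE)%Z with false by (symmetry; apply Z.ltb_ge; lia).
    decide_false (Z.of_nat w <? Z.of_nat KE)%Z.
    now rewrite !andb_false_r.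
  - replace (w - (w - KE)) with w by lia. destruct (le_lt_dec a w) as [l'|l'].
    + replace (a - (a - KE)) with a by lia. reflexivity.
    + replace (_ <=? Z.of_nat w)%Z with false by (symmetry; apply Z.leb_gt; lia).
      decide_false (Z.of_nat a <=? Z.of_nat w)%Z.
      now rewrite !andb_false_r.
Qed.

Lemma flag_lt a b : flag a b < 2.
Proof. unfold flag. destruct (a =? b); lia. Qed.

Lemma flag_one a b : (flag a b =? 1) = (a =? b).
Proof. unfold flag. destruct (a =? b); reflexivity. Qed.

Lemma bout_eq l c r : bout ee l c r =
  match phi stp dlt blk hlt encC (lcls stp dlt blk hlt encC decC KV encV decV b0 s0 gam0 (Z.of_nat (la ee c)) (Z.of_nat (lw ee c)))
    (decV (lv ee l)) (decV (lv ee c)) (decV (lv ee r)) with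
  | Some v' => S (encV v') | None => 0 end.
Proof.
  unfold bout. cbv zeta. rewrite ptab_val.
  assert (hv : forall x, lv ee x < KE).
  { intros x. unfold lv. rewrite v2_val. apply Nat.mod_upper_bound. pose proof KV_KE. lia. }
  rewrite v2_val. rewrite hy by (auto using flag_lt; lia). unfold out0, lcls.
  rewrite Theta_trunc, !flag_one.
  pose proof e_gt. pose proof KV_KE.
  assert (E1 : symbol0 k (flag (la ee c) ee) (la ee c - (la ee c - KE)) = gam0 (Z.of_nat (la ee c))).
  { rewrite <- symbol0_eq by lia. unfold symbol0.
    replace (la ee c - (la ee c - KE) =? 0) with (la ee c =? 0); auto.
    destruct (Nat.eqb_spec (la ee c) 0), (Nat.eqb_spec (la ee c - (la ee c - KE)) 0); auto; lia. }
  rewrite E1.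
  replace (la ee c - (la ee c - KE) =? 0) with (Z.of_nat (la ee c) =? 0)%Z
    by (destruct (Z.eqb_spec (Z.of_nat (la ee c)) 0), (Nat.eqb_spec (la ee c - (la ee c - KE)) 0); auto; lia).
  replace (S (la ee c) =? b0) with (Z.of_nat (la ee c) =? Z.of_nat b0 - 1)%Z
    by (destruct (Z.eqb_spec (Z.of_nat (la ee c)) (Z.of_nat b0 - 1)), (Nat.eqb_spec (S (la ee c)) b0); auto; lia).
  replace (la ee c =? lw ee c) with (Z.of_nat (la ee c) =? Z.of_nat (lw ee c))%Z
    by (destruct (Z.eqb_spec (Z.of_nat (la ee c)) (Z.of_nat (lw ee c))), (Nat.eqb_spec (la ee c) (lw ee c)); auto; lia).
  reflexivity.
Qed.

Lemma brule_Hl l c r : l <> 0 -> c <> 0 -> r <> 0 ->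
  brule ee l c r = match Hl (dec l) (dec c) (dec r) with Some s => enc s | None => 0 end.
Proof.
  intros hl hc hr. rewrite brule_eq by auto. unfold dec, Hlev.
  rewrite <- !nsucc_succB by (auto using la_lt, lw_lt).
  replace (Z.of_nat (la ee r) =? Z.of_nat (nsucc ee (la ee c)))%Z with (la ee r =? nsucc ee (la ee c))
    by (destruct (Nat.eqb_spec (la ee r) (nsucc ee (la ee c))), (Z.eqb_spec (Z.of_nat (la ee r)) (Z.of_nat (nsucc ee (la ee c)))); auto; lia).
  replace (Z.of_nat (lw ee r) =? Z.of_nat (nsucc ee (lw ee c)))%Z with (lw ee r =? nsucc ee (lw ee c))
    by (destruct (Nat.eqb_spec (lw ee r) (nsucc ee (lw ee c))), (Z.eqb_spec (Z.of_nat (lw ee r)) (Z.of_nat (nsucc ee (lw ee c)))); auto; lia).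
  rewrite bout_eq. destruct ((la ee r =? _) && (lw ee r =? _)); cbn [andb]; auto.
  destruct (phi _ _ _ _ _ _ _ _ _) as [v'|]; cbn [Nat.eqb negb pred]; auto.
  unfold enc. now rewrite !Nat2Z.id.
Qed.

Hypothesis hP : forall i, In i P -> ireg i < k /\ itarget i <= length P.
Notation N := (pN ee).
Notation Hb := (baseca (brule ee)).
Notation alive0 := (alive stp dlt blk hlt encC decC KV encV decV b0 s0 gam0).

Lemma Hlev_valid l c r s : valid b0 c -> Hl l c r = Some s -> valid b0 s.
Proof.
  destruct l as [[xl wl] vl], c as [[x w] v], r as [[xr wr] vr]. unfold Hlev, valid. intros [h1 h2] h.
  destruct (_ && _); [|discriminate].
  destruct (phi _ _ _ _ _ _ _ _ _) as [v'|]; [|discriminate].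
  assert (E : s = (x, succB b0 w, v')) by congruence. rewrite E. split; auto.
  unfold succB. destruct (Z.eqb_spec w (Z.of_nat b0 - 1)); lia.
Qed.

Lemma gam0_support x : (Z.of_nat (S ee) <= x)%Z -> gam0 x = blk.
Proof.
  intros h. unfold sym_of, sym_blank. apply bmk_ext. intros i _. unfold input.
  apply Z.eqb_neq. destruct (i =? 0); lia.
Qed.

Lemma alive_of_letters T z : (forall s p, Nat.iter s (Hz (brule ee)) z p <> 0) ->
  alive0 T (fun p => dec (z p)).
Proof.
  revert z. induction T as [|T IH]; intros z hz; [exact I|].
  exists (fun p => dec (Hz (brule ee) z p)). split.
  - intros p. pose proof (hz 1 p) as h1. cbn in h1. unfold Hz in h1 |- *.
    rewrite brule_Hl in h1 |- * by apply (hz 0).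
    destruct (Hl _ _ _) as [s|] eqn:E; [|tauto].
    f_equal. symmetry. apply enc_dec. eapply Hlev_valid; [|exact E]. apply dec_valid.
  - apply IH. intros s p. rewrite <- Nat.iter_succ_r. apply hz.
Qed.

(** The one-sided rule writes the new state of the middle cell at the left end of its window, so
    [off] grows by one per step. *)
Lemma letters_of_alive T off c a : (forall p, valid b0 (c p)) -> alive0 T c ->
  (forall i, a i = enc (c (Z.of_nat i + off)%Z)) -> forall i, Nat.iter T Hb a i <> 0.
Proof.
  revert off c a. induction T as [|T IH]; intros off c a hv hal ha i.
  - cbn. rewrite ha. now apply enc_dec.
  - destruct hal as (c' & h1 & h2). rewrite Nat.iter_succ_r.
    apply (IH (off + 1)%Z c'); auto.
    + intros p. exact (Hlev_valid _ _ _ (hv p) (h1 p)).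
    + intros j. unfold baseca. rewrite !ha. rewrite brule_Hl by (now apply enc_dec).
      assert (E : forall p, dec (enc (c p)) = c p) by (intros p; now apply enc_dec).
      rewrite !E.
      specialize (h1 (Z.of_nat j + (off + 1))%Z).
      replace (Z.of_nat j + (off + 1) - 1)%Z with (Z.of_nat j + off)%Z in h1 by lia.
      replace (Z.of_nat j + (off + 1) + 1)%Z with (Z.of_nat (S (S j)) + off)%Z in h1 by lia.
      replace (Z.of_nat j + (off + 1))%Z with (Z.of_nat (S j) + off)%Z in h1 |- * by lia.
      now rewrite h1.
Qed.

Lemma level_halt n : hlt (fst (lev stp dlt blk s0 gam0 n)) = (fst (mrun P n (0, input ee)) =? length P).
Proof.
  destruct (@machine_levels P k hP (input ee) n) as (h1 & h2 & _). rewrite h2. unfold ctl_halt.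
  now rewrite fval_fmk.
Qed.

Lemma b0_big : KE <= b0 /\ S ee + 1 <= b0.
Proof. pose proof e_gt. unfold pB. lia. Qed.

Theorem halting_nilpotent n : fst (mrun P n (0, input ee)) = length P ->
  exists T, forall a, in_space N a -> forall i, Nat.iter T Hb a i = 0.
Proof.
  intros hn. apply NNPP. intros hne. destruct b0_big as [hb1 hb2].
  destruct (@halting_mortal St Sy stp dlt blk hlt Q encC decC HC KV encV decV HV b0 (S ee) s0 gam0
    hb1 hb2 gam0_support (@sym_step_blank P k) n) as [T hT].
  { rewrite level_halt. now apply Nat.eqb_eq. }
  destruct (@not_nilpotent_two_sided N (brule ee) (brule_spread ee) hne) as (z & _ & hz).
  apply (hT (fun p => dec (z p))); [intros; apply dec_valid|]. now apply alive_of_letters.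
Qed.

Lemma H_dead t a i : Nat.iter t Hb a i <> 0 -> forall t', t' <= t -> Nat.iter t' Hb a i <> 0.
Proof.
  intros h t' ht. replace t with (t' + (t - t')) in h by lia.
  apply (@spread_back (brule ee) (brule_spread ee) t' a (t - t') i h). lia.
Qed.

Theorem nonhalting_live : (forall n, fst (mrun P n (0, input ee)) <> length P) ->
  forall T, exists a, in_space N a /\ forall t i, t <= T -> Nat.iter t Hb a i <> 0.
Proof.
  intros hn T. destruct b0_big as [hb1 hb2].
  destruct (@nonhalting_immortal St Sy stp dlt blk hlt Q encC decC HC KV encV decV HV b0 (S ee) s0 gam0
    hb1 hb2 gam0_support (@sym_step_blank P k)) with (T := T) as (c & hc & hal).
  { intros n. rewrite level_halt. now apply Nat.eqb_neq. }
  exists (fun i => enc (c (Z.of_nat i))). split; [intros i; now apply enc_dec|].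
  intros t i ht. apply (@H_dead T); auto.
  apply (@letters_of_alive T 0%Z c); auto. intros j. now rewrite Z.add_0_r.
Qed.
End Fixed.
End Encode.

(** The order of choices matters: the numbering of the classes fixes the payload type, its numbering
    fixes the table, and the table fixes [e]. The table sees [e] only through flags, so it can be
    written down before [e] is known. *)
Theorem machine_pair P k : (forall i, In i P -> ireg i < k /\ itarget i <= length P) ->
  exists e,
    (forall n, fst (mrun P n (0, input e)) = length P ->
       exists T, forall a, in_space (pN e) a -> forall i, Nat.iter T (baseca (brule e)) a i = 0) /\
    ((forall n, fst (mrun P n (0, input e)) <> length P) ->
       forall T, exists a, in_space (pN e) a /\ forall t i, t <= T -> Nat.iter t (baseca (brule e)) a i <> 0).
Proof.
  intros hP.
  destruct (finite_cls (finite_fin (length P)) (finite_bits k)) as (Q & encC & decC & HC).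
  destruct (finite_V Q (finite_fin (length P)) (finite_bits k)) as (KV & encV & decV & HV).
  destruct (@table_exists P k Q encC decC KV encV decV HV) as [y hy].
  exists (2 ^ C0 Q KV * (2 * y + 1)). split.
  - intros n. eapply halting_nilpotent; eauto.
  - eapply nonhalting_live; eauto.
Qed.

Local Open Scope R_scope.

Theorem theorem3p2 :
  rec_inseparable
    (* (i): pairs (F,G) with h(F) > h(G) *)
    (fun n => exists p, wf_pair p /\ enc_pair p = n /\
       exists hF hG, is_entropy (alph p) (caF p) hF /\
                     is_entropy (alph p) (caG p) hG /\ hF > hG)
    (* (ii): F, G strongly conjugate and h(F) = h(G) = 0 *)
    (fun n => exists p, wf_pair p /\ enc_pair p = n /\
       strongly_conjugate (alph p) (caF p) (caG p) /\
       is_entropy (alph p) (caF p) 0 /\ is_entropy (alph p) (caG p) 0).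
Proof.
  intros (S & [c hc] & hi & hii). destruct enc_computable as [q hq].
  (* [D] decides from [e] whether the pair built from [e] lies in the set. It is fixed now; the [e]
     belonging to its tester is found afterwards and given to it as input. *)
  set (D := RComp c [q]).
  assert (hD : forall x y, eval c [enc_pair (pair_of x)] y -> eval D [x] y).
  { intros x y h. econstructor; [|exact h]. repeat constructor. apply hq. }
  destruct (machine_pair (tester D) (tester_wf D)) as (e & h1 & h2).
  assert (hN : (1 <= pN e)%nat) by (unfold pN; lia).
  assert (hm : (1 <= pm e)%nat) by (unfold pm; lia).
  assert (h0 : brule e 0 0 0 = 0%nat) by reflexivity.
  assert (hlt : forall a b c, (brule e a b c < pN e)%nat) by (intros; apply brule_lt).
  assert (hwf : wf_pair (pair_of e)).
  { split; [|split].
    - cbn [alph pair_of]. unfold asize. nia.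
    - apply rule3_wf. intros. apply ruleF3_lt; auto.
    - apply rule3_wf. intros. apply ruleG3_lt; auto. }
  (* A positive answer makes the tester halt and puts the pair into (ii), a negative one makes it
     run forever and puts the pair into (i); either way the answer is wrong. *)
  destruct (hc (enc_pair (pair_of e))) as [[hS ev]|[hS ev]].
  - apply (hii (enc_pair (pair_of e))); auto. exists (pair_of e). split; auto. split; auto.
    destruct (tester_halts (hD e _ ev)) as [n hn]. destruct (h1 n hn) as [T hT].
    split; [|split].
    + now apply (@F_G_conjugate (pN e) (pm e) (brule e)) with (T := T).
    + now apply (@F_entropy_zero (pN e) (pm e) (brule e)) with (T := T).
    + now apply (@G_entropy_zero (pN e) (pm e) (brule e)) with (T := T).
  - apply hS, hi. exists (pair_of e). split; auto. split; auto.
    destruct (@entropy_F_ge (pN e) (pm e) (brule e) hN hm hlt h0 (h2 (tester_loops (hD e _ ev)))) as (hF & hF1 & hF2).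
    destruct (@entropy_G (pN e) (pm e) (brule e) hN hm hlt h0) as (hG & hG1 & hG2).
    exists hF, hG. split; [exact hF1|]. split; [exact hG1|].
    apply Rlt_gt, Rle_lt_trans with (1 := hG2), Rlt_le_trans with (2 := hF2).
    apply log2_lt; [apply lt_0_INR; nia|]. apply lt_INR. unfold pm. lia.
Qed.
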